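(* Let $k\geq 2$ and $s\geq 0$ be integers. There is an algorithm that, given a word $w=a_1a_2\cdots a_n$ over a fixed finite alphabet, computes the right minimal period array ${}_s^k rmp_w$ (with respect to exponent $k$ and period larger than $s$) in $O(k\,|w|)$ time.
   Context: For a word $w=a_1\cdots a_n$, $w[p..q]$ denotes $a_pa_{p+1}\cdots a_q$ if $1\le p\le q\le n$, and the empty word otherwise. A word is a $k$th power if it equals $x^k$ for some non-empty word $x$. For integers $k\ge 2$, $s\ge 0$, the minimal period $mp_s^k(u)$ of a word $u$ is the smallest integer $m>s$ such that $km\le |u|$ and the prefix $u[1..km]$ is a $k$th power (i.e. equals $(u[1..m])^k$); if no such $m$ exists, $mp_s^k(u)=+\infty$. The right minimal period array of $w$ is defined by ${}_s^k rmp_w[i]=mp_s^k(w[i..n])$ for $1\le i\le n$. Running time is measured in the unit-cost model where arithmetic operations, comparisons and assignments of $O(\log n)$-bit integers take constant time. *)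

(* Defs.v *)
From mathcomp Require Import all_boot.

Set Implicit Arguments.
Unset Strict Implicit.
Unset Printing Implicit Defensive.

Definition wpow (T : Type) (x : seq T) (k : nat) : seq T := flatten (nseq k x).

Section MinimalPeriod.
Variable T : eqType.
Implicit Types u w : seq T.

Definition power_prefix (k : nat) u (m : nat) : bool :=
  (k * m <= size u) && (take (k * m) u == wpow (take m u) k).

(* [None] stands for +oo.  For k > 0 the search range s < m <= |u| is
   exhaustive, because k * m <= |u| forces m <= |u|; see [mpP]. *)
Definition mp (k s : nat) u : option nat :=
  ohead [seq m <- iota s.+1 (size u - s) | power_prefix k u m].

(* Positions are counted from 0: entry i is the value at the suffix that
   starts with the (i+1)-th letter. *)
Definition rmp (k s : nat) w : seq (option nat) :=
  mkseq (fun i => mp k s (drop i w)) (size w).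

Lemma mpP (k s : nat) u : 0 < k ->
  match mp k s u with
  | Some m => [/\ s < m, power_prefix k u m
                & forall m', s < m' -> power_prefix k u m' -> m <= m']
  | None => forall m, s < m -> ~~ power_prefix k u m
  end.
Proof.
move=> k_gt0; rewrite /mp.
have srch m : s < m -> power_prefix k u m ->
    m \in [seq m <- iota s.+1 (size u - s) | power_prefix k u m].
  move=> lt_sm pm; rewrite mem_filter pm mem_iota lt_sm /= addSn ltnS.
  have le_mu : m <= size u.
    by case/andP: pm => + _; apply: leq_trans; rewrite leq_pmull.
  by rewrite subnKC // ltnW // (leq_trans lt_sm).
have: sorted ltn [seq m <- iota s.+1 (size u - s) | power_prefix k u m].
  by apply: sorted_filter; [apply: ltn_trans | apply: iota_ltn_sorted].
have: forall m, m \in [seq m <- iota s.+1 (size u - s) | power_prefix k u m] ->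
    s < m /\ power_prefix k u m.
  by move=> m; rewrite mem_filter mem_iota => /and3P[].
case: [seq _ <- _ | _] srch => [|m r] srch mem_r /= srt.
  by move=> m lt_sm; apply/negP => /(srch m lt_sm).
have [lt_sm pm] := mem_r m (mem_head m r).
split=> // m' lt_sm' /(srch m' lt_sm'); rewrite inE => /predU1P[-> //|m'r].
by have /allP/(_ m' m'r)/ltnW := order_path_min ltn_trans srt.
Qed.

End MinimalPeriod.

(* A unit-cost random access machine, presented as a structured language.  A
   program has integer variables and zero-initialised arrays; both are named by
   numerals occurring in the program text, so there are finitely many of them.
   Tests read 0 as false, and subtraction is truncated at 0. *)

Inductive binop := Add | Sub | Mul | Div | Mod | Eq | Leq | Ltn.

Inductive expr :=
  | Const of nat
  | Var of nat
  | Read of nat & expr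
  | Bin of binop & expr & expr.

Inductive cmd :=
  | Skip
  | Assign of nat & expr
  | Write of nat & expr & expr
  | Seq of cmd & cmd
  | If of expr & cmd & cmd
  | While of expr & cmd.

Record state := State { var : nat -> nat; arr : nat -> nat -> nat }.

Definition set_var (st : state) (x v : nat) : state :=
  State (fun y => if y == x then v else var st y) (arr st).

Definition set_arr (st : state) (a i v : nat) : state :=
  State (var st)
    (fun b j => if (b == a) && (j == i) then v else arr st b j).

Definition binop_val (o : binop) (x y : nat) : nat :=
  match o with
  | Add => x + y
  | Sub => x - y
  | Mul => x * y
  | Div => x %/ y
  | Mod => x %% y
  | Eq => x == y
  | Leq => x <= y
  | Ltn => x < y
  end.

(* B is the largest integer that fits in a machine word. *)
Definition word (B v : nat) : option nat := if v <= B then Some v else None.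

(* Undefined as soon as some intermediate value does not fit in a word. *)
Fixpoint eval (B : nat) (st : state) (e : expr) : option nat :=
  match e with
  | Const n => word B n
  | Var x => word B (var st x)
  | Read a e1 => obind (fun i => word B (arr st a i)) (eval B st e1)
  | Bin o e1 e2 =>
      obind (fun x => obind (fun y => word B (binop_val o x y)) (eval B st e2))
            (eval B st e1)
  end.

Fixpoint cost (e : expr) : nat :=
  match e with
  | Const _ | Var _ => 1
  | Read _ e1 => (cost e1).+1
  | Bin _ e1 e2 => (cost e1 + cost e2).+1
  end.

(* [exec B c st t st']: with words bounded by B, the command c started in st
   halts in st' after t unit-cost steps.  There is no rule for a command that
   evaluates an expression overflowing the word size. *)
Inductive exec (B : nat) : cmd -> state -> nat -> state -> Prop :=
  | ExecSkip st : exec B Skip st 1 st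
  | ExecAssign x e v st of eval B st e = Some v :
      exec B (Assign x e) st (cost e).+1 (set_var st x v)
  | ExecWrite a e1 e2 i v st of eval B st e1 = Some i & eval B st e2 = Some v :
      exec B (Write a e1 e2) st (cost e1 + cost e2).+1 (set_arr st a i v)
  | ExecSeq c1 c2 st st1 st2 t1 t2 of exec B c1 st t1 st1 & exec B c2 st1 t2 st2 :
      exec B (Seq c1 c2) st (t1 + t2) st2
  | ExecIfTrue e c1 c2 v st st1 t1 of
      eval B st e = Some v & v != 0 & exec B c1 st t1 st1 :
      exec B (If e c1 c2) st ((cost e).+1 + t1) st1
  | ExecIfFalse e c1 c2 st st1 t1 of eval B st e = Some 0 & exec B c2 st t1 st1 :
      exec B (If e c1 c2) st ((cost e).+1 + t1) st1
  | ExecWhileTrue e c1 v st st1 st2 t1 t2 of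
      eval B st e = Some v & v != 0 & exec B c1 st t1 st1
      & exec B (While e c1) st1 t2 st2 :
      exec B (While e c1) st ((cost e).+1 + t1 + t2) st2
  | ExecWhileFalse e c1 st of eval B st e = Some 0 :
      exec B (While e c1) st (cost e).+1 st.

Lemma exec_det B c st t1 st1 t2 st2 :
  exec B c st t1 st1 -> exec B c st t2 st2 -> t1 = t2 /\ st1 = st2.
Proof.
move=> H; elim: H t2 st2 => {c st t1 st1}; intros;
  match goal with
    H : exec _ _ _ ?t ?s |- _ = ?t /\ _ => inversion H; subst; clear H
  end;
  repeat match goal with
    H : eval _ _ _ = Some _, H' : eval _ _ _ = Some _ |- _ =>
      rewrite H in H'; injection H' as H'; subst
  end;
  repeat match goal with
    I : (forall t s, exec ?B ?c ?x t s -> _), J : exec ?B ?c ?x _ _ |- _ =>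
      destruct (I _ _ J); subst; clear J
  end; by [].
Qed.

(* Variables 0, 1, 2 hold |w|, k, s, and array 0 holds the letters of w, coded
   by their ranks in the alphabet; everything else is 0. *)
Definition input (A : finType) (k s : nat) (w : seq A) : state :=
  State (nth 0 [:: size w; k; s])
    (fun a i => if a == 0 then nth 0 [seq val (enum_rank x) | x <- w] i else 0).

(* The result is read from the first n cells of array 1. *)
Definition output (n : nat) (st : state) : seq nat := mkseq (arr st 1) n.

(* 0 is free to encode +oo, since minimal periods are positive. *)
Definition code (v : option nat) : nat := odflt 0 v.

(* The largest word: integers have O(log (n + k + s)) bits, i.e. O(log n) bits
   for fixed k and s.  The parameters k and s occur because they are part of
   the input and have to fit in a word. *)
Definition max_word (c n k s : nat) : nat := (n + k + s + 2) ^ c.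

(* Main.v *)
(* The program runs in time O(|w|), uniformly in k and s.  The suffix automaton
   of w gives, for every prefix, its longest suffix that also ends earlier.
   Cutting off such suffixes from the right end factorizes w so that each factor
   (unless it is a new letter) has an earlier occurrence and cannot be extended
   to the left.  A power inside a factor is copied from that occurrence.  A power
   that crosses the boundary between consecutive factors [a0, a) and [a, b), and
   ends in the second one, starts its second period after a0, as otherwise its
   periodicity would extend the first factor to the left; so its period is at
   most (b - a0) / (k - 1), and it lies in a window of length O(b - a0).  There
   two runs of the Z algorithm give, for each period m, the intervals on which w
   agrees with its shift by m around a and around a - m, hence the starts of the
   m-periodic powers.  They are painted in increasing order of m, from the
   leftmost boundary to the rightmost, and the first colour of a position is its
   least crossing period.  Painted positions are skipped in amortized constant
   time by bit masks on blocks of about log n positions together with a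
   union-find structure on the n / log n blocks that relabels the smaller set. *)

Require Import Defs.
From mathcomp Require Import all_boot.
From mathcomp Require Import zify.

Set Implicit Arguments.
Unset Strict Implicit.
Unset Printing Implicit Defensive.

(** * A cost-aware program logic *)

(** The first colour is the least for the following reason. A colour given at an earlier boundary
    belongs to a power that ends no later than the current boundary [a], whereas a power still to be
    painted ends after [a]; from the same start, the latter has the larger period. Each window is
    charged to two adjacent factors, so all windows together have length O(n). Blocks of [b]
    positions, with [b] about log n, are what makes the relabelling linear: its initial potential is
    about [n / b] blocks times [b]. The machine has no rule for overflow, so every intermediate
    value has to be bounded. Stored values are kept at most [M]; an expression with at most 16
    leaves is then at most [M ^ 16], and this is what a word must hold. Time is a resource of the
    program logic, which turns each amortized argument (suffix links, Z boxes, painting,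
    relabelling) into a lower bound on the time left. *)

Fixpoint ev (st : state) (e : expr) : nat :=
  match e with
  | Const n => n
  | Var x => var st x
  | Read a e1 => arr st a (ev st e1)
  | Bin o e1 e2 => binop_val o (ev st e1) (ev st e2)
  end.

(** The exponent in the bound [M ^ esize e] on the value of [e]: sums and products multiply such
    bounds, while a cell is at most [M] whatever its index. *)
Fixpoint esize (e : expr) : nat :=
  match e with
  | Const _ | Var _ => 1
  | Read _ e1 => esize e1
  | Bin _ e1 e2 => esize e1 + esize e2
  end.

Fixpoint econst (e : expr) : nat :=
  match e with
  | Const n => n
  | Var _ => 0
  | Read _ e1 => econst e1
  | Bin _ e1 e2 => maxn (econst e1) (econst e2)
  end.

Fixpoint written_vars (c : cmd) : seq nat :=
  match c with
  | Skip | Write _ _ _ => [::]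
  | Assign x _ => [:: x]
  | Seq c1 c2 | If _ c1 c2 => written_vars c1 ++ written_vars c2
  | While _ c1 => written_vars c1
  end.

Fixpoint written_arrs (c : cmd) : seq nat :=
  match c with
  | Skip | Assign _ _ => [::]
  | Write a _ _ => [:: a]
  | Seq c1 c2 | If _ c1 c2 => written_arrs c1 ++ written_arrs c2
  | While _ c1 => written_arrs c1
  end.

Definition frame (c : cmd) (st st' : state) : Prop :=
  (forall x, x \notin written_vars c -> var st' x = var st x) /\
  (forall a, a \notin written_arrs c -> arr st' a =1 arr st a).

Lemma frame_trans c1 c2 c st st1 st2 :
  {subset written_vars c1 <= written_vars c} ->
  {subset written_vars c2 <= written_vars c} ->
  {subset written_arrs c1 <= written_arrs c} ->
  {subset written_arrs c2 <= written_arrs c} ->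
  frame c1 st st1 -> frame c2 st1 st2 -> frame c st st2.
Proof.
move=> v1 v2 a1 a2 [fv1 fa1] [fv2 fa2]; split=> [x | a] nx.
  by rewrite fv2 ?fv1 //; apply: contra nx => h; [apply: v1 | apply: v2].
by move=> i; rewrite fa2 ?fa1 //; apply: contra nx => h; [apply: a1 | apply: a2].
Qed.

Lemma exec_frame B c st t st' : exec B c st t st' -> frame c st st'.
Proof.
elim=> {c st t st'} //=.
- by move=> x e v st _; split=> // y; rewrite inE /= => /negPf ->.
- move=> a e1 e2 i v st _ _; split=> //= b; rewrite inE /= => /negPf ba j.
  by rewrite ba.
- move=> c1 c2 st st1 st2 _ _ _ f1 _ f2.
  by apply: frame_trans f1 f2 => x; rewrite mem_cat => ->; rewrite ?orbT.
- move=> e c1 c2 v st st1 _ _ _ _ [fv fa]; split=> x; rewrite mem_cat negb_or.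
    by case/andP=> /fv.
  by case/andP=> /fa.
- move=> e c1 c2 st st1 _ _ _ [fv fa]; split=> x; rewrite mem_cat negb_or.
    by case/andP=> _ /fv.
  by case/andP=> _ /fa.
- move=> e c1 v st st1 st2 _ _ _ _ _ f1 _ f2.
  by apply: frame_trans f1 f2.
Qed.

Section Logic.

Variables (B M : nat).

Definition bounded (st : state) : Prop :=
  (forall x, var st x <= M) /\ (forall a i, arr st a i <= M).

Hypotheses (M_gt1 : 1 < M) (powM : M ^ 16 <= B).

(** Sixteen leaves suffice for every expression of the program, and [M ^ 16 <= B] then excludes
    overflow. *)
Definition fits e := (esize e <= 16) && (econst e <= M).

Lemma esize_gt0 e : 0 < esize e.
Proof. by elim: e => //= o e1 h1 e2 _; apply: leq_trans h1 (leq_addr _ _). Qed.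

Lemma eval_ev st e :
  bounded st -> fits e -> eval B st e = Some (ev st e).
Proof.
move=> [bv ba] /andP[le_e le_c].
have M_gt0 : 0 < M by apply: ltnW.
have leM a b : a <= b -> M ^ a <= M ^ b by move=> ?; rewrite leq_exp2l.
have le1M d : 0 < d -> M <= M ^ d by move=> d0; rewrite -{1}[M]expn1 leM.
suff: eval B st e = Some (ev st e) /\ ev st e <= M ^ esize e by case.
have wordE v d : d <= 16 -> v <= M ^ d -> word B v = Some v.
  by move=> d16 vM; rewrite /word (leq_trans vM) // (leq_trans (leM _ _ d16)).
elim: e le_e le_c => [m | x | a e IH | o e1 IH1 e2 IH2] /=.
- by move=> _ mM; rewrite (@wordE m 1) ?expn1.
- by move=> _ _; rewrite (@wordE _ 1) ?expn1.
- move=> le_e le_c; have [-> _] /= := IH le_e le_c.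
  have := leq_trans (ba a (ev st e)) (le1M _ (esize_gt0 e)).
  by move=> h; rewrite (wordE _ (esize e)).
rewrite geq_max => le_e /andP[c1 c2].
have s1 := esize_gt0 e1; have s2 := esize_gt0 e2.
have [|-> /= h1] := IH1 _ c1; first by apply: leq_trans le_e; apply: leq_addr.
have [|-> /= h2] := IH2 _ c2; first by apply: leq_trans le_e; apply: leq_addl.
suff h : binop_val o (ev st e1) (ev st e2) <= M ^ (esize e1 + esize e2).
  by rewrite (wordE _ (esize e1 + esize e2)).
have hl : ev st e1 <= M ^ (esize e1 + esize e2).
  by apply: leq_trans h1 (leM _ _ (leq_addr _ _)).
have hb (b : bool) : b <= M ^ (esize e1 + esize e2).
  by apply: leq_trans (leq_b1 _) _; rewrite expn_gt0 M_gt0.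
have g1 : 1 < M ^ esize e1 by apply: leq_trans M_gt1 (le1M _ s1).
have g2 : 1 < M ^ esize e2 by apply: leq_trans M_gt1 (le1M _ s2).
case: o => //=.
(* A sum is at most the product of the two bounds because both are at least 2. *)
- by rewrite expnD; move: g1 g2 h1 h2; move: (M ^ _) (M ^ _) => p q; nia.
- exact: leq_trans (leq_subr _ _) hl.
- by rewrite expnD leq_mul.
- exact: leq_trans (leq_div _ _) hl.
- exact: leq_trans (leq_mod _ _) hl.
Qed.

(* [T] is the time still available; invariants carry amortised potentials as lower bounds on it. *)
Definition wp (T : nat) (st : state) (c : cmd) (Q : nat -> state -> Prop) :=
  bounded st -> exists t st',
    [/\ exec B c st t st', t <= T, bounded st' & Q (T - t) st'].

Lemma wp_conseq T st c (Q Q' : nat -> state -> Prop) :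
  wp T st c Q ->
  (forall T' st', bounded st' -> frame c st st' -> Q T' st' -> Q' T' st') ->
  wp T st c Q'.
Proof.
move=> h hQ bst; have [t [st' [ex tT b' q]]] := h bst.
by exists t, st'; split=> //; apply: hQ (exec_frame ex) q.
Qed.

Lemma wp_bounded T st c Q : (bounded st -> wp T st c Q) -> wp T st c Q.
Proof. by move=> h b; apply: h. Qed.

Lemma wp_skip T st (Q : nat -> state -> Prop) :
  0 < T -> Q (T - 1) st -> wp T st Skip Q.
Proof. by move=> T0 q b; exists 1, st; split=> //; constructor. Qed.

Lemma wp_assign T st x e (Q : nat -> state -> Prop) :
  fits e -> cost e < T -> (bounded st -> ev st e <= M) ->
  Q (T - (cost e).+1) (set_var st x (ev st e)) -> wp T st (Assign x e) Q.
Proof.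
move=> fe cT evM q b; exists (cost e).+1, (set_var st x (ev st e)).
split=> //; first by constructor; apply: eval_ev.
case: (b) => bv ba; split=> // y /=; case: ifP => // _; exact: evM.
Qed.

Lemma wp_write T st a e1 e2 (Q : nat -> state -> Prop) :
  fits e1 -> fits e2 -> cost e1 + cost e2 < T -> (bounded st -> ev st e2 <= M) ->
  Q (T - (cost e1 + cost e2).+1) (set_arr st a (ev st e1) (ev st e2)) ->
  wp T st (Write a e1 e2) Q.
Proof.
move=> f1 f2 cT evM q b.
exists (cost e1 + cost e2).+1, (set_arr st a (ev st e1) (ev st e2)).
split=> //; first by constructor; apply: eval_ev.
case: (b) => bv ba; split=> // c i /=; case: ifP => // _; exact: evM.
Qed.

Lemma wp_seq T st c1 c2 Q :
  wp T st c1 (fun T' st' => wp T' st' c2 Q) -> wp T st (Seq c1 c2) Q.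
Proof.
move=> h b; have [t1 [st1 [ex1 le1 b1 h2]]] := h b.
have [t2 [st2 [ex2 le2 b2 q]]] := h2 b1.
exists (t1 + t2), st2; split=> //; first exact: ExecSeq ex1 ex2.
  by rewrite -(subnKC le1) leq_add2l.
by rewrite subnDA.
Qed.

Lemma wp_if T st e c1 c2 Q :
  fits e -> cost e < T ->
  (ev st e != 0 -> wp (T - (cost e).+1) st c1 Q) ->
  (ev st e = 0 -> wp (T - (cost e).+1) st c2 Q) ->
  wp T st (If e c1 c2) Q.
Proof.
move=> fe cT h1 h2 b; have E := eval_ev b fe.
case: (ev st e =P 0) => [e0 | /eqP e0].
  have [t [st' [ex le b' q]]] := h2 e0 b.
  exists ((cost e).+1 + t), st'; split=> //; last by rewrite subnDA.
    by apply: ExecIfFalse => //; rewrite E e0.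
  by rewrite -(subnKC cT) leq_add2l.
have [t [st' [ex le b' q]]] := h1 e0 b.
exists ((cost e).+1 + t), st'; split=> //; last by rewrite subnDA.
  exact: (ExecIfTrue _ E e0).
by rewrite -(subnKC cT) leq_add2l.
Qed.

(** The remaining time is the variant: each test consumes some, and the invariant has to guarantee
    enough for the next test. The frame from the entry state lets invariants omit whatever the body
    does not write. *)
Lemma wp_while (I : nat -> state -> Prop) T st e c (Q : nat -> state -> Prop) :
  fits e -> I T st ->
  (forall T' st', bounded st' -> frame c st st' -> I T' st' ->
     [/\ cost e < T',
         ev st' e != 0 -> wp (T' - (cost e).+1) st' c I &
         ev st' e = 0 -> Q (T' - (cost e).+1) st']) ->
  wp T st (While e c) Q.
Proof.
move=> fe IT step.
suff gen m T' st' : T' < m -> frame c st st' -> I T' st' ->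
    wp T' st' (While e c) Q by apply: (gen T.+1).
elim: m T' st' => // m IHm T' st' ltm fr IT' b.
have [cT ht hf] := step _ _ b fr IT'; have E := eval_ev b fe.
case: (ev st' e =P 0) => [e0 | /eqP e0].
  exists (cost e).+1, st'; split=> //; last exact: hf.
  by apply: ExecWhileFalse; rewrite E e0.
have [t1 [st1 [ex1 le1 b1 I1]]] := ht e0 b.
have fr1 : frame c st st1 by apply: frame_trans fr (exec_frame ex1).
have [|t2 [st2 [ex2 le2 b2 q]]] := IHm _ _ _ fr1 I1 b1; first by lia.
exists ((cost e).+1 + t1 + t2), st2; split=> //; last by rewrite !subnDA.
  exact: ExecWhileTrue E e0 ex1 ex2.
lia.
Qed.

End Logic.

(** * The suffix automaton *)

Section Dawg.

Variable W : nat -> nat.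

(* Length of the longest common suffix of the prefixes of lengths [a] and [b]. *)
Fixpoint lcs (a b : nat) : nat :=
  match a, b with
  | a'.+1, b'.+1 => if W a' == W b' then (lcs a' b').+1 else 0
  | _, _ => 0
  end.

Lemma lcsC a b : lcs a b = lcs b a.
Proof. by elim: a b => [|a IH] [|b] //=; rewrite eq_sym IH. Qed.

Lemma lcs_le a b : lcs a b <= a.
Proof. by elim: a b => [|a IH] [|b] //=; case: ifP => // _; rewrite ltnS. Qed.

Lemma lcsnn a : lcs a a = a.
Proof. by elim: a => //= a ->; rewrite eqxx. Qed.

(** Prefix ends under [lcs] form an ultrametric space. This and the recursion on the last letter
    carry the whole automaton proof, which therefore never manipulates words. *)
Lemma lcs_ultra a b c : minn (lcs a b) (lcs b c) <= lcs a c.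
Proof.
elim: a b c => [|a IH] [|b] [|c] //=; rewrite ?min0n ?minn0 //.
case: eqP => [->|_]; last by rewrite min0n.
by case: eqP => _; rewrite ?minn0 // minnSS ltnS.
Qed.

Definition L a b := (lcs a b).+1.

Lemma LC a b : L a b = L b a. Proof. by rewrite /L lcsC. Qed.
Lemma L_le a b : L a b <= a.+1. Proof. exact: lcs_le. Qed.
Lemma Lnn a : L a a = a.+1. Proof. by rewrite /L lcsnn. Qed.
Lemma L0 a : L a 0 = 1. Proof. by case: a. Qed.
Lemma LSS a b : L a.+1 b.+1 = if W a == W b then (L a b).+1 else 1.
Proof. by rewrite /L /=; case: ifP. Qed.

Lemma L_ultra a b c m : m <= L a b -> m <= L b c -> m <= L a c.
Proof. by rewrite /L; have := lcs_ultra a b c; lia. Qed.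

(** Isosceles property of an ultrametric: of three similarities the two smallest agree. *)
Lemma L_eq a b c : L a b < L b c -> L a c = L a b.
Proof.
move=> lt; have h1 := @L_ultra a b c (L a b) (leqnn _) (ltnW lt).
case: (ltngtP (L a c) (L a b)) => // h; try lia.
have := @L_ultra a c b (L a b).+1 h; rewrite [L c b]LC => /(_ lt); lia.
Qed.

Lemma L_gt1 a b : 1 < L a b ->
  exists a' b', [/\ a = a'.+1, b = b'.+1, W a' = W b' & L a b = (L a' b').+1].
Proof.
case: a b => [|a] [|b]; rewrite ?L0 ?(LC 0) ?L0 //.
rewrite LSS; case: eqP => // e _; by exists a, b.
Qed.

(* States are the left-maximal words: [fe v] is the end of an occurrence of the
   word of [v], and [ln v] is one more than its length, so that the virtual state
   0 below the root 1 gets 0.  [lk] are the suffix links, [nx] the transitions. *)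
Record dawg := Dawg {
  cnt : nat; ln : nat -> nat; fe : nat -> nat; lk : nat -> nat;
  nx : nat -> nat -> nat; lst : nat }.

Definition occ (D : dawg) v e := ln D v <= L (fe D v) e.

(** An end [e] that justifies a transition: the word of [v] ends there and the letter [c] follows,
    still inside the prefix of length [x]. *)
Definition arcs (D : dawg) x v c e := [/\ e < x, occ D v e & W e = c].

(** By [dw_max] and [dw_all] the state words are the longest common suffixes of two prefixes,
    possibly equal, so the states are the nodes of the compact tree of the reversed prefixes. By
    [dw_lk] the links are its parent pointers. [dw_fresh] keeps the rows of future states zero. *)
Record dawg_inv (D : dawg) (x : nat) : Prop := DawgInv {
  dw_cnt : 1 < cnt D;
  dw_ln0 : ln D 0 = 0;
  dw_ln1 : ln D 1 = 1;
  dw_lk0 : lk D 0 = 0;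
  dw_fe : forall v, v < cnt D -> fe D v <= x;
  dw_pos : forall v, 0 < v < cnt D -> 0 < ln D v <= (fe D v).+1;
  dw_max : forall v, 0 < v < cnt D -> exists2 e, e <= x & L (fe D v) e = ln D v;
  dw_all : forall e e', e <= x -> e' <= x ->
    exists v, [/\ 0 < v < cnt D, ln D v = L e e' & occ D v e];
  dw_uniq : forall v v', 0 < v < cnt D -> 0 < v' < cnt D -> ln D v = ln D v' ->
    occ D v (fe D v') -> v = v';
  dw_lk : forall v, 0 < v < cnt D ->
    [/\ lk D v < cnt D, ln D (lk D v) < ln D v, occ D (lk D v) (fe D v) &
        forall e, e <= x -> L (fe D v) e < ln D v -> L (fe D v) e <= ln D (lk D v)];
  dw_nx0 : forall c, nx D 0 c = 1;
  dw_nxN : forall v c e, 0 < v < cnt D -> nx D v c = 0 -> ~ arcs D x v c e;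
  dw_nxP : forall v c, 0 < v < cnt D -> nx D v c != 0 ->
    [/\ nx D v c < cnt D, ln D v < ln D (nx D v c), exists e, arcs D x v c e &
        forall e, arcs D x v c e -> occ D (nx D v c) e.+1];
  dw_lst : [/\ 0 < lst D < cnt D, fe D (lst D) = x & ln D (lst D) = x.+1];
  dw_fresh : forall v c, cnt D <= v -> nx D v c = 0 }.

(** * Correctness of one extension of the suffix automaton *)

Section Step.

Variables (D : dawg) (x : nat).
Hypothesis I : dawg_inv D x.

(** The chain of suffix links from [lst], described without iterating links: the states whose word
    is a suffix of the current prefix, and the virtual state. *)
Definition suf v := (v < cnt D) && (ln D v <= L (fe D v) x).

Lemma state_gt0 v : v < cnt D -> 0 < ln D v -> 0 < v < cnt D.
Proof. by case: v => [|v] -> //; rewrite (dw_ln0 I). Qed.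

Lemma suf_lst : suf (lst D).
Proof. by case: (dw_lst I) => /andP[_ h] h1 h2; rewrite /suf h h1 h2 Lnn /=. Qed.

Lemma suf_lk p : suf p -> suf (lk D p).
Proof.
case/andP=> hp sp; case: (posnP p) => [->|p0].
  by rewrite (dw_lk0 I) /suf (dw_ln0 I) (ltnW (dw_cnt I)).
have [|h1 h2 h3 _] := dw_lk I (v := p); first by rewrite p0.
by rewrite /suf h1; apply: L_ultra h3 _; lia.
Qed.

(** The chain has [lk] as its predecessor map: the length of [v] is the common suffix length of
    [fe D p] with [fe D v], or else with the end that makes [v] maximal, and [dw_lk] bounds both. *)
Lemma suf_below p v : suf p -> suf v -> ln D v < ln D p -> ln D v <= ln D (lk D p).
Proof.
move=> /andP[hp sp] /andP[hv sv] lt.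
case: (posnP (ln D v)) => [->//|v0].
have [|e ex he] := dw_max I (v := v); first exact: state_gt0.
have [|_ _ _ h4] := dw_lk I (v := p); first by apply: state_gt0 => //; lia.
have h : ln D v <= L (fe D p) (fe D v).
  by apply: (@L_ultra _ x); [lia | rewrite LC].
have fv := dw_fe I hv.
case: (ltngtP (L (fe D p) (fe D v)) (ln D v)) => h'; try lia.
  rewrite -he (_ : L _ e = L (fe D p) e); last first.
    by rewrite (LC _ e) [RHS]LC; symmetry; apply: L_eq; rewrite LC he LC.
  apply: h4 => //; rewrite LC.
  by rewrite (@L_eq e (fe D v) (fe D p)) (LC e) he // LC.
by rewrite -h'; apply: h4; lia.
Qed.

Lemma suf_uniq p v : suf p -> suf v -> 0 < ln D p -> ln D p = ln D v -> p = v.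
Proof.
move=> /andP[hp sp] /andP[hv sv] p0 e; apply: (dw_uniq I) => //; try by apply: state_gt0 => //; lia.
by rewrite /occ; apply: L_ultra sp _; rewrite LC; lia.
Qed.

Lemma suf_sub p v e : suf p -> suf v -> ln D v <= ln D p -> occ D p e -> occ D v e.
Proof.
move=> /andP[hp sp] /andP[hv sv] le; rewrite /occ => h; apply: L_ultra sv _.
by apply: (@L_ultra _ (fe D p)); [rewrite LC; lia | lia].
Qed.

Lemma lst_no_arc e : ~ arcs D x (lst D) (W x) e.
Proof. by case: (dw_lst I) => _ h1 h2 [lt]; rewrite /occ h1 h2 LC => h; have := L_le e x; lia. Qed.

(* [p] is the longest suffix of the prefix of length [x] that is followed by
   [W x] at some earlier place; the head is [p] followed by this letter. *)
Section Head.

Variable p : nat.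
Let c := W x.
Hypotheses (sp : suf p) (np : nx D p c != 0).
Hypothesis above : forall v, suf v -> ln D p < ln D v -> nx D v c = 0.

Let q := nx D p c.
(** The value of [ln] that a state for the head must have. *)
Definition hd := (ln D p).+1.

Lemma p_state : ln D p = 0 \/ 0 < p < cnt D.
Proof. by case: (posnP p) => [->|p0]; [left; rewrite (dw_ln0 I) | right; case/andP: sp]. Qed.

Lemma p_eq0 : ln D p = 0 -> p = 0.
Proof.
case: (posnP p) => // p0 h; case/andP: sp => hp _.
by have := dw_pos I (v := p); rewrite p0 hp h => /(_ isT).
Qed.

Lemma q_state : 0 < q < cnt D.
Proof.
rewrite /q; case: (posnP p) => [->|p0]; first by rewrite (dw_nx0 I) (dw_cnt I).
case/andP: sp => hp _; have [||-> _ _ _] := dw_nxP I (v := p) (c := c) => //; first by rewrite p0.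
by rewrite lt0n np.
Qed.

Lemma ln_q : hd <= ln D q.
Proof.
rewrite /q /hd; case: (posnP p) => [->|p0]; first by rewrite (dw_nx0 I) (dw_ln0 I) (dw_ln1 I).
case/andP: sp => hp _; by have [||_ h _ _] := dw_nxP I (v := p) (c := c) => //; first by rewrite p0.
Qed.

(** A longer match without its last letter would be a longer suffix state followed by [c] at an
    earlier place, against [above]. *)
Lemma hd_max e : e <= x -> L x.+1 e <= hd.
Proof.
case: e => [|e] ex; first by rewrite L0.
rewrite LSS; case: eqP => // eW; rewrite /hd ltnS leqNgt; apply/negP => lt.
have [|v [v0 lv ov]] := dw_all I (leqnn x) (e' := e); first exact: ltnW.
have sv : suf v by rewrite /suf -/(occ D v x) ov; case/andP: v0 => _ ->.
apply: (dw_nxN I v0 (above sv _)); first by rewrite lv.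
split; [exact: ex | | by rewrite -eW].
by rewrite /occ; apply: L_ultra ov _; rewrite lv.
Qed.

Lemma hd_ex : exists2 e, e <= x & L x.+1 e = hd.
Proof.
rewrite /hd; case: (posnP p) => [->|p0]; first by exists 0; rewrite // L0 (dw_ln0 I).
case/andP: (sp) => hp sp'; have [||_ _ [e [e1 e2 e3]] _] := dw_nxP I (v := p) (c := c) => //; first by rewrite p0.
exists e.+1 => //; apply/eqP; rewrite eqn_leq hd_max //= LSS e3 eqxx ltnS.
by rewrite LC; apply: L_ultra sp'; rewrite LC.
Qed.

(** Each earlier occurrence of the head comes from an arc out of [p], hence by [dw_nxP] is an
    occurrence of [q], whose word may extend the head to the left. *)
Lemma hd_occ e : e <= x -> hd <= L x.+1 e -> occ D q e.
Proof.
rewrite /q /hd; case: (posnP p) => [->|p0].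
  by rewrite (dw_nx0 I) /occ (dw_ln1 I).
case/andP: (sp) => hp sp' ex.
case: p_state => [h|_]; first by rewrite (p_eq0 h) in p0.
have pp := dw_pos I (v := p); rewrite p0 hp in pp; case/andP: (pp isT) => l0 _.
move=> h; have [|a [b [/succn_inj<- eb Wab Lab]]] := L_gt1 (a := x.+1) (b := e); first by lia.
have [||_ _ _ h4] := dw_nxP I (v := p) (c := c) => //; first by rewrite p0.
rewrite eb; apply: h4; split; [lia | | by rewrite -Wab].
by rewrite /occ; apply: L_ultra sp' _; lia.
Qed.

Lemma L_hd_q : L x.+1 (fe D q) = hd.
Proof.
have [e ex he] := hd_ex; have fq := dw_fe I (proj2 (andP q_state)).
apply/eqP; rewrite eqn_leq hd_max //=; apply: (@L_ultra _ e); first by rewrite he.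
by rewrite LC; apply: leq_trans ln_q (hd_occ ex _); rewrite he.
Qed.

Lemma occ_hd e : e <= x -> hd <= L (fe D q) e -> occ D q e.
Proof. by move=> ex h; apply: hd_occ => //; apply: L_ultra h; rewrite L_hd_q. Qed.

Lemma hd_le : hd <= x.+1.
Proof. by have [e ex <-] := hd_ex; rewrite LC; apply: leq_trans (L_le _ _) _. Qed.

(** So [q] is the shortest state whose word ends with the head: both ends that witness the
    maximality of [v] are occurrences of [q]. *)
Lemma state_hd v : 0 < v < cnt D -> hd <= ln D v -> hd <= L x.+1 (fe D v) ->
  ln D q <= ln D v.
Proof.
move=> v0 lv hv; have [e ex he] := dw_max I v0.
have fv := dw_fe I (proj2 (andP v0)).
have oq1 := hd_occ fv hv.
have oq2 : occ D q e by apply: hd_occ => //; apply: L_ultra hv _; rewrite he.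
by rewrite -he; apply: (@L_ultra _ (fe D q)); [rewrite LC|].
Qed.

Lemma arcs_sub v e : suf v -> ln D v <= ln D p -> arcs D x p c e -> arcs D x v c e.
Proof. by move=> sv le [e1 e2 e3]; split=> //; apply: suf_sub le e2. Qed.

Lemma below_nx v : suf v -> 0 < v -> ln D v <= ln D p -> nx D v c != 0.
Proof.
move=> sv v0 le; apply/eqP => h.
have vv : 0 < v < cnt D by case/andP: sv => ->; rewrite v0.
have := dw_pos I vv => /andP[lv _].
case: p_state => [|pp]; first by lia.
have [//|_ _ [e /(arcs_sub sv le) a] _] := dw_nxP I pp (c := c).
exact: (dw_nxN I vv h a).
Qed.

Lemma arcs_q v e : suf v -> 0 < v -> ln D v <= ln D p -> e <= x -> occ D q e ->
  exists2 e', e = e'.+1 & arcs D x v c e'.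
Proof.
move=> sv v0 le ex oq.
have vv : 0 < v < cnt D by case/andP: sv => ->; rewrite v0.
have := dw_pos I vv => /andP[lv _].
have h : hd <= L x.+1 e by apply: (@L_ultra _ (fe D q)); [rewrite L_hd_q | apply: leq_trans ln_q oq].
have [|a [b [/succn_inj<- eb Wab Lab]]] := L_gt1 (a := x.+1) (b := e).
  by apply: leq_trans h; rewrite /hd ltnS; lia.
exists b => //; split; [lia | | by rewrite -Wab].
case/andP: sv => hv sv; rewrite /occ; apply: L_ultra sv _.
by move: h; rewrite Lab /hd; lia.
Qed.

(** The target and [q] bound each other in length, since the ends witnessing the maximality of each
    are occurrences of the other; then [dw_uniq] identifies them. *)
Lemma nx_below v : suf v -> 0 < v -> ln D v <= ln D p ->
  hd < ln D (nx D v c) -> nx D v c = q.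
Proof.
move=> sv v0 le lt.
have vv : 0 < v < cnt D by case/andP: sv => ->; rewrite v0.
have n0 := below_nx sv v0 le; have [h1 h2 _ h4] := dw_nxP I vv n0.
have qq : 0 < nx D v c < cnt D by rewrite lt0n n0.
have [e1 e1x he1] := hd_ex.
have oq1 : occ D q e1 by apply: hd_occ => //; rewrite he1.
have [e1' ee1 a1] := arcs_q sv v0 le e1x oq1.
have o1 := h4 _ a1; rewrite -ee1 in o1.
have le1 : ln D q <= ln D (nx D v c).
  apply: state_hd => //; first exact: ltnW.
  apply: (@L_ultra _ e1); first by rewrite he1.
  by rewrite LC; apply: leq_trans (ltnW lt) o1.
have fq := dw_fe I (proj2 (andP q_state)).
have oqq : occ D q (fe D q) by rewrite /occ Lnn; case/andP: (dw_pos I q_state).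
have [e2 e2x he2] := dw_max I q_state.
have [e2' ee2 a2] := arcs_q sv v0 le e2x (e := e2) (eq_leq (esym he2)).
have [e3' ee3 a3] := arcs_q sv v0 le fq oqq.
have := h4 _ a2; have := h4 _ a3; rewrite -ee2 -ee3 => o3 o2.
have le2 : ln D (nx D v c) <= ln D q.
  by rewrite -he2; apply: (@L_ultra _ (fe D (nx D v c))); [rewrite LC|].
by apply: (dw_uniq I) => //; [exact: q_state | apply/eqP; rewrite eqn_leq le2].
Qed.

(** The states that lead to [q] form an interval of the chain with top [p]. Hence the loop that
    redirects them may stop at the first other target. *)
Lemma nx_between v v' : suf v -> suf v' -> 0 < v -> ln D v <= ln D v' <= ln D p ->
  nx D v c = q -> nx D v' c = q.
Proof.
move=> sv sv' v0 /andP[le1 le2] nv.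
have vv : 0 < v < cnt D by case/andP: sv => ->; rewrite v0.
have := dw_pos I vv => /andP[lv _].
have vv' : 0 < v' < cnt D by apply: state_gt0; [case/andP: sv' | lia].
have v0' : 0 < v' by case/andP: vv'.
have n0' := below_nx sv' v0' le2; have [h1 h2 [e ae] h4] := dw_nxP I vv' n0'.
have qq : 0 < nx D v' c < cnt D by rewrite lt0n n0'.
set q' := nx D v' c in h1 h2 h4 qq *.
have [|_ _ _ hv] := dw_nxP I vv (c := c); first by rewrite nv -lt0n; case/andP: q_state.
rewrite nv in hv.
have sub e' : e' <= x -> occ D q' e' -> occ D q e'.
  move=> ex o.
  have h : (ln D v').+1 <= L e.+1 e'.
    by apply: (@L_ultra _ (fe D q')); [rewrite LC; apply: leq_trans h2 (h4 _ ae) | apply: leq_trans h2 o].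
  have [|a [b [/succn_inj<- eb Wab Lab]]] := L_gt1 (a := e.+1) (b := e'); first by lia.
  case: ae => ae1 ae2 ae3; rewrite eb; apply: hv; split; [lia | | by rewrite -Wab].
  apply: (suf_sub sv' sv le1); rewrite /occ; apply: L_ultra ae2 _; lia.
have fq := dw_fe I h1.
have oqq : occ D q' (fe D q') by rewrite /occ Lnn; case/andP: (dw_pos I qq).
have [e2 e2x he2] := dw_max I qq.
have := sub _ fq oqq; have := sub _ e2x (eq_leq (esym he2)) => o2 o1.
have le : ln D q <= ln D q'.
  by rewrite -he2; apply: (@L_ultra _ (fe D q)); [rewrite LC|].
have [e3 e3x he3] := dw_max I q_state.
have fq2 := dw_fe I (proj2 (andP q_state)).
have oq2 : occ D q (fe D q) by rewrite /occ Lnn; case/andP: (dw_pos I q_state).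
have [e4' ee4 a4] := arcs_q sv' v0' le2 fq2 oq2.
have [e3' ee3 a3] := arcs_q sv' v0' le2 e3x (eq_leq (esym he3)).
have := h4 _ a3; have := h4 _ a4; rewrite -ee3 -ee4 => o4 o3.
have le' : ln D q' <= ln D q.
  by rewrite -he3; apply: (@L_ultra _ (fe D q')); [rewrite LC|].
by apply: (dw_uniq I) => //; [exact: q_state | lia].
Qed.

(** Otherwise the word of the link would end with the head although it is shorter than that of [q],
    against [state_hd]. *)
Lemma lk_q_hd : ln D (lk D q) < hd.
Proof.
have [h1 h2 h3 h4] := dw_lk I q_state.
rewrite ltnNge; apply/negP => h.
have gg : 0 < lk D q < cnt D by apply: state_gt0 => //; apply: leq_trans h.
have : ln D q <= ln D (lk D q); last by lia.
apply: state_hd => //; apply: (@L_ultra _ (fe D q)); first by rewrite L_hd_q.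
by rewrite LC; apply: leq_trans h h3.
Qed.

(** The link word without its last letter is again a longest common suffix of two prefixes, hence a
    state, and it lies on the chain. It limits how far the redirecting loop can descend. *)
Lemma lk_q_ex : 1 < ln D (lk D q) ->
  exists v, [/\ suf v, 0 < v, (ln D v).+1 = ln D (lk D q) & nx D v c = lk D q].
Proof.
move=> g1; have [h1 h2 h3 h4] := dw_lk I q_state; have hh := lk_q_hd.
set g := lk D q in g1 h1 h2 h3 h4 hh *.
have gg : 0 < g < cnt D by apply: state_gt0 => //; apply: ltnW.
have [e ex he] := dw_max I gg; have fg := dw_fe I h1.
have [|a [b [ea eb Wab Lab]]] := L_gt1 (a := fe D g) (b := e); first by rewrite he.
have [||v [v0 lv ov]] := dw_all I (e := a) (e' := b); try lia.
have hx : ln D g <= L (fe D g) x.+1.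
  by apply: (L_ultra h3); rewrite LC L_hd_q ltnW.
have [|a' [b' [ea' eb' Wab' Lab']]] := L_gt1 (a := fe D g) (b := x.+1); first by lia.
have ? : a' = a by lia.
have ? : b' = x by lia.
subst a' b'.
have [v1 v2] := andP v0.
have sv : suf v by rewrite /suf v2; apply: L_ultra ov _; lia.
have aa : arcs D x v c a by split=> //; lia.
have ab : arcs D x v c b.
  split; [lia | | by rewrite -Wab].
  by rewrite /occ; apply: L_ultra ov _; rewrite lv.
have n0 : nx D v c != 0 by apply/eqP => n0; exact: (dw_nxN I v0 n0 aa).
have [t1 t2 _ t4] := dw_nxP I v0 n0.
have o1 := t4 _ aa; have o2 := t4 _ ab; rewrite -ea in o1; rewrite -eb in o2.
exists v; split=> //; first by lia.
apply: (dw_uniq I) => //; first by rewrite lt0n n0.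
apply/eqP; rewrite eqn_leq; apply/andP; split; last by lia.
by rewrite -he; apply: (@L_ultra _ (fe D (nx D v c))); [rewrite LC|].
Qed.

Definition exact_hd := ln D q == hd.
Let cur := cnt D.
Let cl := cur.+1.
Definition head_state := if exact_hd then q else cl.

Definition dstep : dawg := {|
  cnt := if exact_hd then cur.+1 else cur.+2;
  ln := fun v => if v < cur then ln D v else if v == cur then x.+2 else hd;
  fe := fun v => if v < cur then fe D v else if v == cur then x.+1 else fe D q;
  lk := fun v => if v == cur then head_state
                 else if exact_hd then lk D v
                 else if v == cl then lk D q
                 else if v == q then cl else lk D v;
  nx := fun v d =>
    let v' := if ~~ exact_hd && (v == cl) then q else v in
    if (d == c) && suf v' then
      if ln D p < ln D v' then cur
      else if ~~ exact_hd && (nx D v' c == q) then cl else nx D v' c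
    else nx D v' d;
  lst := cur |}.

Lemma cl_cur : (cl < cur = false) * ((cl == cur) = false).
Proof. by rewrite /cl; split; [apply/negbTE; rewrite -leqNgt | apply: gtn_eqF]. Qed.

Variant dstep_state v : Prop :=
  | OldState of v < cur & ln dstep v = ln D v & fe dstep v = fe D v
  | CurState of v = cur & ln dstep v = x.+2 & fe dstep v = x.+1
  | CloneState of v = cl & hd < ln D q & ln dstep v = hd & fe dstep v = fe D q.

Lemma dstep_stateP v : v < cnt dstep -> dstep_state v.
Proof.
move=> vc; case: (ltngtP v cur) => h.
- by apply: OldState => //=; rewrite h.
- have [e ev] : ~~ exact_hd /\ v = cl.
    by move: vc; rewrite /cl /=; case: exact_hd => /=; lia.
  apply: CloneState => //=; rewrite ?ev ?cl_cur //.
  by move: e; rewrite /exact_hd; have := ln_q; lia.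
- by apply: CurState => //=; rewrite h ltnn eqxx.
Qed.

Lemma lt_cur_cnt v : v < cur -> v < cnt dstep.
Proof. by rewrite /=; case: ifP => _; lia. Qed.

Lemma dstep_ln v : v < cur -> ln dstep v = ln D v. Proof. by move=> h; rewrite /= h. Qed.
Lemma dstep_fe v : v < cur -> fe dstep v = fe D v. Proof. by move=> h; rewrite /= h. Qed.
Lemma dstep_ln_cur : ln dstep cur = x.+2. Proof. by rewrite /= ltnn eqxx. Qed.
Lemma dstep_fe_cur : fe dstep cur = x.+1. Proof. by rewrite /= ltnn eqxx. Qed.

Lemma head_stateP :
  [/\ 0 < head_state < cnt dstep, ln dstep head_state = hd & fe dstep head_state = fe D q].
Proof.
have /andP[q0 qc] := q_state; rewrite /head_state /=; case: ifP => e.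
  by rewrite q0 qc; split; [lia | apply/eqP | ].
by rewrite !cl_cur; split=> //; rewrite /cl; lia.
Qed.

Lemma occ_dstep v e : v < cur -> occ dstep v e = occ D v e.
Proof. by move=> h; rewrite /occ dstep_ln ?dstep_fe. Qed.

Lemma dstep_max v : 0 < v < cnt dstep -> exists2 e, e <= x.+1 & L (fe dstep v) e = ln dstep v.
Proof.
case/andP=> v0 /dstep_stateP[h hl hf | h hl hf | h lt hl hf]; rewrite hl hf.
- by have [|e ex he] := dw_max I (v := v); [rewrite v0 | exists e => //; apply: ltnW].
- by exists x.+1; rewrite ?Lnn.
- by exists x.+1 => //; rewrite LC L_hd_q.
Qed.

Lemma dstep_all_new e : e <= x.+1 ->
  exists v, [/\ 0 < v < cnt dstep, ln dstep v = L x.+1 e & occ dstep v x.+1].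
Proof.
rewrite leq_eqVlt => /predU1P[->|/ltnSE ex].
  exists cur; rewrite /occ dstep_ln_cur dstep_fe_cur Lnn; split=> //=.
  by have := dw_cnt I; case: ifP => _; rewrite /cur; lia.
have := hd_max ex; rewrite leq_eqVlt => /predU1P[->|lt].
  have [h1 h2 h3] := head_stateP; exists head_state; split=> //.
  by rewrite /occ h2 h3 LC L_hd_q.
have [e1 e1x he1] := hd_ex.
have E : L e1 e = L x.+1 e.
  by rewrite LC [RHS]LC; apply: L_eq; rewrite he1 LC.
have [v [/andP[v0 vc] hv ov]] := dw_all I e1x ex.
exists v; rewrite v0 lt_cur_cnt // dstep_ln // hv; split=> //.
rewrite occ_dstep //; move: ov; rewrite /occ => ov; apply: L_ultra ov _.
by rewrite LC he1; lia.
Qed.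

Lemma dstep_all e e' : e <= x.+1 -> e' <= x.+1 ->
  exists v, [/\ 0 < v < cnt dstep, ln dstep v = L e e' & occ dstep v e].
Proof.
move=> ex ex'; case: (leqP e x) => h; last first.
  by have -> : e = x.+1 by [lia]; apply: dstep_all_new.
case: (leqP e' x) => h'.
  have [v [/andP[v0 vc] hv ov]] := dw_all I h h'.
  by exists v; rewrite v0 lt_cur_cnt // dstep_ln // occ_dstep.
have -> : e' = x.+1 by lia.
have [v [v0 hv ov]] := dstep_all_new ex.
exists v; rewrite [L e _]LC hv; split=> //; move: ov; rewrite /occ => ov.
by apply: L_ultra ov _; rewrite hv.
Qed.

(** A state with the word of the head would be at least as long as [q] by [state_hd]. *)
Lemma clone_uniq v : 0 < v < cur -> hd < ln D q -> hd = ln D v -> hd <= L (fe D q) (fe D v) -> False.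
Proof.
move=> v0 lt hv h; have := state_hd v0 (eq_leq hv).
suff h' : hd <= L x.+1 (fe D v) by move/(_ h'); lia.
by apply: L_ultra h; rewrite L_hd_q.
Qed.

Lemma dstep_uniq v v' : 0 < v < cnt dstep -> 0 < v' < cnt dstep ->
  ln dstep v = ln dstep v' -> occ dstep v (fe dstep v') -> v = v'.
Proof.
case/andP=> v0 /dstep_stateP sv; case/andP=> v0' /dstep_stateP sv'.
have old u : 0 < u < cur -> ln D u <= x.+1.
  move=> hu; have := dw_pos I hu; have := dw_fe I (proj2 (andP hu)); lia.
have hx := hd_le; rewrite /occ.
case: sv => [h hl hf | h hl hf | h lt hl hf];
case: sv' => [h' hl' hf' | h' hl' hf' | h' lt' hl' hf']; rewrite hl hl' hf hf' => e o.
- by apply: (dw_uniq I) => //; rewrite ?v0 ?v0'.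
- by have := old v; rewrite v0 h => /(_ isT); lia.
- by case: (@clone_uniq v); rewrite ?v0 // -e // LC.
- by have := old v'; rewrite v0' h' => /(_ isT); lia.
- by rewrite h h'.
- lia.
- by case: (@clone_uniq v'); rewrite ?v0'.
- lia.
- by rewrite h h'.
Qed.

(** For an old state the only new comparison is with the prefix of length [x.+1]. Below the head
    length it equals the comparison with an earlier occurrence of the head. At the head length the
    old bound between [v] and [q] suffices, unless [v] is [q], which is relinked to the clone. *)
Lemma dstep_lk v : 0 < v < cnt dstep ->
  [/\ lk dstep v < cnt dstep, ln dstep (lk dstep v) < ln dstep v,
      occ dstep (lk dstep v) (fe dstep v) &
      forall e, e <= x.+1 -> L (fe dstep v) e < ln dstep v ->
        L (fe dstep v) e <= ln dstep (lk dstep v)].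
Proof.
have [/andP[hs0 hsc] hsl hsf] := head_stateP; have hx := hd_le.
have /andP[q0 qc] := q_state; have fq := dw_fe I qc.
have Lq := L_hd_q; have lq := ln_q.
have [g1 g2 g3 g4] := dw_lk I q_state; have gh := lk_q_hd.
case/andP=> v0 /dstep_stateP[h hl hf | h hl hf | h lt hl hf]; last first.
- have -> : lk dstep v = lk D q.
    by rewrite /= h !cl_cur eqxx /exact_hd gtn_eqF.
  rewrite hl hf dstep_ln // occ_dstep // lt_cur_cnt //; split=> // e.
  rewrite leq_eqVlt => /predU1P[->|/ltnSE ex] le; first by move: le; rewrite LC Lq; lia.
  by apply: g4 => //; lia.
- have -> : lk dstep v = head_state by rewrite /= h eqxx.
  rewrite hl hf hsl /occ hsl hsf; split=> //; first by rewrite LC Lq.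
  move=> e; rewrite leq_eqVlt => /predU1P[->|/ltnSE ex]; first by rewrite Lnn ltnn.
  by move=> _; apply: hd_max.
have vv : 0 < v < cur by rewrite v0.
have vcur : (v == cur) = false by apply: ltn_eqF.
have vcl : (v == cl) = false by apply: ltn_eqF; rewrite /cl; lia.
rewrite hl hf; case: (boolP (~~ exact_hd && (v == q))) => [/andP[ne /eqP vq]|nvq].
  have Elk : lk dstep v = cl.
    by rewrite /= vcur (negPf ne) vcl vq eqxx.
  have hsE : head_state = cl by rewrite /head_state (negPf ne).
  rewrite Elk -hsE hsl /occ hsl hsf vq; split=> //.
  - by move: ne; rewrite /exact_hd; lia.
  - by rewrite Lnn; have /andP[] := dw_pos I q_state; lia.
  move=> e; rewrite leq_eqVlt => /predU1P[->|/ltnSE ex] le; first by rewrite LC Lq.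
  rewrite leqNgt; apply/negP => lt.
  by have := occ_hd ex (ltnW lt); rewrite /occ; lia.
have -> : lk dstep v = lk D v.
  rewrite /= vcur; case: ifP => // ne; rewrite vcl; case: ifP => // e.
  by rewrite ne e in nvq.
have [k1 k2 k3 k4] := dw_lk I vv; have fv := dw_fe I h.
rewrite dstep_ln // occ_dstep // lt_cur_cnt //; split=> // e.
rewrite leq_eqVlt => /predU1P[->|/ltnSE ex] le; last exact: k4.
have [e1 e1x he1] := hd_ex.
have := hd_max fv; rewrite leq_eqVlt => /predU1P[E|lt].
  have oq : occ D q (fe D v) by apply: hd_occ; rewrite ?E.
  have [e2 e2x he2] := dw_max I q_state.
  rewrite LC E; case: (ltngtP (ln D q) (ln D v)) => c1.
  - apply: leq_trans lq _.
    case: (ltngtP (L (fe D v) (fe D q)) (ln D q)) => c2.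
    + by move: oq; rewrite /occ LC; lia.
    + suff E2 : L (fe D v) e2 = ln D q by rewrite -E2; apply: k4 => //; rewrite E2.
      by rewrite LC -he2 [RHS]LC; apply: L_eq; rewrite LC he2 [X in _ < X]LC.
    + by rewrite -c2; apply: k4 => //; rewrite c2.
  - have [e3 e3x he3] := dw_max I vv.
    have : hd < ln D v by rewrite -E LC.
    move=> lt; have o3 : occ D q e3.
      by apply: hd_occ => //; apply: (@L_ultra _ (fe D v)); rewrite ?E // he3; apply: ltnW.
    have : ln D q <= ln D v by rewrite -he3; apply: L_ultra o3; rewrite LC.
    by lia.
  - case/negP: nvq; apply/andP; split.
      by rewrite /exact_hd c1; move: le; rewrite LC E; lia.
    by rewrite eq_sym; apply/eqP; apply: (dw_uniq I q_state vv c1).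
have E : L (fe D v) x.+1 = L (fe D v) e1.
  by symmetry; apply: L_eq; rewrite LC he1.
by rewrite E; apply: k4 => //; rewrite -E.
Qed.

Lemma arcs_dstep v d e : v < cur ->
  arcs dstep x.+1 v d e <-> arcs D x v d e \/ [/\ e = x, d = c & suf v].
Proof.
move=> h; rewrite /arcs occ_dstep // /suf h /= -/(occ D v x); split.
  case; rewrite ltnS leq_eqVlt => /predU1P[->|ex] o w; last by left.
  by right.
by case=> [[ex o w] | [-> -> o]]; split=> //; apply: leqW.
Qed.

Lemma nx_dstep_old v d : v < cur -> nx dstep v d =
  if (d == c) && suf v then
    if ln D p < ln D v then cur
    else if ~~ exact_hd && (nx D v c == q) then cl else nx D v c
  else nx D v d.
Proof.
by move=> h; rewrite /= (_ : (v == cl) = false) ?andbF //; apply: ltn_eqF; rewrite /cl; lia.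
Qed.

(** Combines [dw_nxN] and [dw_nxP], so that one case analysis on the kind of state proves both. *)
Definition nx_ok v d :=
  if nx dstep v d == 0 then forall e, ~ arcs dstep x.+1 v d e else
  [/\ nx dstep v d < cnt dstep, ln dstep v < ln dstep (nx dstep v d),
      exists e, arcs dstep x.+1 v d e &
      forall e, arcs dstep x.+1 v d e -> occ dstep (nx dstep v d) e.+1].

Lemma nx_ok_old v d : 0 < v < cur -> nx_ok v d.
Proof.
move=> vv; have /andP[v0 vc] := vv; rewrite /nx_ok nx_dstep_old //.
have [/andP[_ hsc] hsl hsf] := head_stateP.
have lv := dw_pos I vv; have fv := dw_fe I vc.
have cur0 : (cur == 0) = false by apply: gtn_eqF; apply: leq_ltn_trans vc.
have ccur : cur < cnt dstep by rewrite /=; case: ifP => _; lia.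
case: (boolP ((d == c) && suf v)) => [/andP[/eqP -> sv]|/negbTE nds]; last first.
  have ar e : arcs dstep x.+1 v d e <-> arcs D x v d e.
    rewrite arcs_dstep //; split=> [[//|[_ dc s]]|]; last by left.
    by rewrite dc s eqxx in nds.
  case: (eqVneq (nx D v d) 0) => n0; first by move=> e; rewrite ar; apply: dw_nxN.
  have [h1 h2 [e he] h4] := dw_nxP I vv n0.
  rewrite lt_cur_cnt // !dstep_ln //; split=> //; first by exists e; apply/ar.
  by move=> e' /ar he'; rewrite occ_dstep //; apply: h4.
case: (ltnP (ln D p) (ln D v)) => lpv.
  rewrite cur0 dstep_ln // dstep_ln_cur; split=> //; first by lia.
    by exists x; apply/arcs_dstep => //; right.
  move=> e; rewrite arcs_dstep // => -[a|[-> _ _]].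
    by case: (dw_nxN I vv (above sv lpv) a).
  by rewrite /occ dstep_ln_cur dstep_fe_cur Lnn.
have le := lpv.
have n0 := below_nx sv v0 le; have [h1 h2 [e he] h4] := dw_nxP I vv n0.
have aex : exists e, arcs dstep x.+1 v c e by exists e; apply/arcs_dstep => //; left.
have lvh : ln D v < hd by rewrite /hd ltnS.
case: (boolP (~~ exact_hd && (nx D v c == q))) => [/andP[ne /eqP nq]|/negbTE nne].
  have hsE : head_state = cl by rewrite /head_state (negPf ne).
  rewrite (_ : (cl == 0) = false) // -hsE hsl dstep_ln //; split=> //.
  move=> e'; rewrite arcs_dstep // /occ hsl hsf => -[a|[-> _ _]].
    by have := h4 _ a; rewrite nq /occ; apply: leq_trans ln_q.
  by rewrite LC L_hd_q.
rewrite (negPf n0) lt_cur_cnt // !dstep_ln //; split=> //.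
move=> e'; rewrite arcs_dstep // occ_dstep // => -[a|[-> _ _]]; first exact: h4.
(* A longer target would be [q], which is then not exact, and its arc would have been redirected. *)
have le2 : ln D (nx D v c) <= hd.
  rewrite leqNgt; apply/negP => lt; have E := nx_below sv v0 le lt.
  by move: nne; rewrite E eqxx andbT /exact_hd => /negbFE/eqP; rewrite E in lt; lia.
have [e1 e1x he1] := hd_ex.
have oq1 : occ D q e1 by apply: hd_occ => //; rewrite he1.
have [e1' ee1 a1] := arcs_q sv v0 le e1x oq1.
have := h4 _ a1; rewrite -ee1 /occ => o1; apply: L_ultra o1 _.
by rewrite LC he1.
Qed.

Lemma nx_ok_cur d : nx_ok cur d.
Proof.
have nsuf : suf cur = false by rewrite /suf ltnn.
have -> : nx_ok cur d = forall e, ~ arcs dstep x.+1 cur d e.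
  rewrite /nx_ok /= (_ : (cur == cl) = false); last by rewrite eq_sym !cl_cur.
  by rewrite andbF nsuf andbF (dw_fresh I).
move=> e [ex]; rewrite /occ dstep_ln_cur dstep_fe_cur LC => h.
by have := L_le e x.+1; lia.
Qed.

(** Arcs only look at ends up to [x], where the head and [q] have the same occurrences; so the clone
    can share the row of [q]. *)
Lemma nx_ok_clone d : hd < ln D q -> nx_ok cl d.
Proof.
move=> lt; have ne : exact_hd = false by rewrite /exact_hd gtn_eqF.
have /andP[q0 qc] := q_state.
have [/andP[_ hsc] hsl hsf] := head_stateP.
have hsE : head_state = cl by rewrite /head_state ne.
have E : nx dstep cl d = nx dstep q d.
  by rewrite /= ne eqxx (_ : (q == cl) = false) //; apply: ltn_eqF; rewrite /cl; lia.
have ar e : arcs dstep x.+1 cl d e <-> arcs dstep x.+1 q d e.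
  rewrite /arcs (@occ_dstep q) // {1}/occ -hsE hsl hsf.
  split=> -[h1 h2 h3]; split=> //; first by apply: occ_hd.
  by apply: leq_trans (ltnW lt) h2.
have := nx_ok_old d q_state; rewrite /nx_ok E; case: ifP => [n0 h e|n0].
  by rewrite ar.
rewrite dstep_ln // -hsE hsl hsE => -[h1 h2 [e he] h4]; split=> //.
- by apply: ltn_trans h2.
- by exists e; apply/ar.
- by move=> e' /ar; apply: h4.
Qed.

Lemma nx_okP v d : 0 < v < cnt dstep -> nx_ok v d.
Proof.
case/andP=> v0 /dstep_stateP[h _ _ | h _ _ | h lt _ _].
- by apply: nx_ok_old; rewrite v0.
- by rewrite h; apply: nx_ok_cur.
- by rewrite h; apply: nx_ok_clone.
Qed.

Lemma dstep_inv : dawg_inv dstep x.+1.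
Proof.
have c1 := dw_cnt I; have [/andP[hs0 hsc] hsl hsf] := head_stateP.
have c0 : 0 < cur by apply: ltnW.
have /andP[q0 qc] := q_state; have fq := dw_fe I qc.
constructor.
- by rewrite /=; case: ifP => _; rewrite /cur; lia.
- by rewrite dstep_ln // (dw_ln0 I).
- by rewrite dstep_ln // (dw_ln1 I).
- rewrite /= (ltn_eqF c0) (dw_lk0 I) /= (ltn_eqF q0); case: ifP => //.
- move=> v /dstep_stateP[h _ -> | h _ -> | h _ _ ->] //; last by apply: leqW.
  by apply/leqW/(dw_fe I).
- move=> v /andP[v0 /dstep_stateP[h -> -> | h -> -> | h lt -> ->]] //.
    by apply: (dw_pos I); rewrite v0.
    by rewrite leqnn.
  by rewrite /hd ltnS /= (leq_trans (ltnW lt)) //; case/andP: (dw_pos I q_state).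
- exact: dstep_max.
- exact: dstep_all.
- exact: dstep_uniq.
- exact: dstep_lk.
- move=> d; rewrite nx_dstep_old // (dw_ln0 I) ltn0 !(dw_nx0 I).
  case: ifP => // _; case: ifP => // /andP[ne /eqP q1].
  have lq := ln_q; have l1 : ln D q = 1 by rewrite -q1 (dw_ln1 I).
  by move: ne; rewrite /exact_hd; move: lq; rewrite l1 /hd; case: (ln D p).
- move=> v d e vv n0; have := nx_okP d vv; rewrite /nx_ok n0 eqxx; exact.
- by move=> v d vv n0; have := nx_okP d vv; rewrite /nx_ok (negPf n0).
- split; [| exact: dstep_fe_cur | exact: dstep_ln_cur].
  by rewrite /= c0; case: ifP => _; lia.
- move=> v d h; have h' : cur <= v.
    by move: h; rewrite /=; case: ifP => _; lia.
  have h2 : (~~ exact_hd && (v == cl)) = false.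
    by move: h; rewrite /= /cl; case: ifP => _ h //=; apply: gtn_eqF; lia.
  by rewrite /= h2 /suf ltnNge h' /= andbF (dw_fresh I).
Qed.

(** The purpose of the automaton: the link of the new last state records the longest suffix of the
    new prefix that ends earlier, together with such an end. *)
Lemma dstep_head :
  [/\ fe dstep (lk dstep cur) <= x, hd <= L x.+1 (fe dstep (lk dstep cur)),
      ln dstep (lk dstep cur) = hd & forall e, e <= x -> L x.+1 e <= hd].
Proof.
have /andP[q0 qc] := q_state; have [h1 h2 h3] := head_stateP.
have -> : lk dstep cur = head_state by rewrite /= eqxx.
by rewrite h2 h3 L_hd_q dw_fe //; split=> //; apply: hd_max.
Qed.
End Head.
End Step.
End Dawg.

(** * Programs *)

(* Registers [v...] and arrays [a...]: the registers [vn], [vk], [vs] and the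
   array [aW] hold the input, and [aOut] the output. *)
Local Coercion Var : nat >-> expr.
Local Notation "# n" := (Const n) (at level 0, n at level 0).
Local Notation "x ::= e" := (Assign x e) (at level 60, no associativity).
Local Notation "c1 ;; c2" := (Seq c1 c2) (at level 61, right associativity).
Local Notation "x +@ y" := (Bin Add x y) (at level 50, left associativity).
Local Notation "x -@ y" := (Bin Defs.Sub x y) (at level 50, left associativity).
Local Notation "x *@ y" := (Bin Mul x y) (at level 40, left associativity).
Local Notation "x /@ y" := (Bin Div x y) (at level 40, left associativity).
Local Notation "x %@ y" := (Bin Mod x y) (at level 40, left associativity).
Local Notation "x ==@ y" := (Bin Eq x y) (at level 55, right associativity).
Local Notation "x <=@ y" := (Bin Leq x y) (at level 55, right associativity).
Local Notation "x <@ y" := (Bin Ltn x y) (at level 55, right associativity).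

Local Notation vn := 0 (only parsing).
Local Notation vk := 1 (only parsing).
Local Notation vs := 2 (only parsing).
Local Notation vsig := 3 (only parsing).
Local Notation vx := 4 (only parsing).
Local Notation vc := 5 (only parsing).
Local Notation vcur := 6 (only parsing).
Local Notation vcnt := 7 (only parsing).
Local Notation vp := 8 (only parsing).
Local Notation vq := 9 (only parsing).
Local Notation vcl := 10 (only parsing).
Local Notation vd := 11 (only parsing).
Local Notation vlast := 12 (only parsing).
Local Notation aW := 0 (only parsing).
Local Notation aOut := 1 (only parsing).
Local Notation aNext := 2 (only parsing).
Local Notation aLen := 3 (only parsing).
Local Notation aFe := 4 (only parsing).
Local Notation aLk := 5 (only parsing).
Local Notation aG := 6 (only parsing).
Local Notation aSrc := 7 (only parsing).
Local Notation zN := 30 (only parsing).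
Local Notation zi := 31 (only parsing).
Local Notation zl := 32 (only parsing).
Local Notation zr := 33 (only parsing).
Local Notation zz := 34 (only parsing).
Local Notation aY := 10 (only parsing).

Local Notation vbb := 13 (only parsing).
Local Notation vB := 14 (only parsing).
Local Notation vy := 15 (only parsing).
Local Notation vi := 16 (only parsing).
Local Notation vf := 17 (only parsing).
Local Notation vj := 18 (only parsing).
Local Notation vp1 := 19 (only parsing).
Local Notation vq1 := 20 (only parsing).
Local Notation vr := 21 (only parsing).
Local Notation vm := 22 (only parsing).
Local Notation aNB := 8 (only parsing).
Local Notation aPow := 9 (only parsing).
Local Notation aLsb := 13 (only parsing).
Local Notation aMask := 14 (only parsing).
Local Notation aId := 15 (only parsing).
Local Notation aLo := 16 (only parsing).
Local Notation aHi := 17 (only parsing).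
Local Notation aCand := 18 (only parsing).
Local Notation vr0 := 23 (only parsing).
Local Notation va0 := 24 (only parsing).
Local Notation va := 25 (only parsing).
Local Notation vb := 26 (only parsing).
Local Notation vlo := 27 (only parsing).
Local Notation vmm := 28 (only parsing).
Local Notation vt := 29 (only parsing).
Local Notation ve := 35 (only parsing).
Local Notation vA := 36 (only parsing).
Local Notation vpv := 37 (only parsing).
Local Notation vfb := 38 (only parsing).
Local Notation aZf := 11 (only parsing).
Local Notation aZb := 12 (only parsing).
Local Notation vyy := 39 (only parsing).

Lemma b2n0 (b : bool) : (nat_of_bool b != 0) = b.
Proof. by case: b. Qed.

(** The expressions treated here contain small literals only, so [64 <= M] covers [econst]. *)
Ltac fit := match goal with H : is_true (64 <= _) |- _ =>
  by apply/andP; split; [ | apply: leq_trans H] end.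
Ltac wgo lem :=
  match goal with H1 : is_true (1 < ?M), H2 : is_true (?M ^ 16 <= _) |- _ => apply: (lem _ _ H1 H2) end.
Ltac wasg := wgo @wp_assign; [fit | by rewrite /=; lia | move=> [bv ba]; rewrite /= | rewrite /=].
Ltac wwr := wgo @wp_write; [fit | fit | by rewrite /=; lia | move=> [bv ba]; rewrite /= | rewrite /=].
Ltac wif := wgo @wp_if; [fit | by rewrite /=; lia | rewrite /= ?b2n0 | rewrite /= ].
Ltac wwh I := match goal with H1 : is_true (1 < ?M), H2 : is_true (?M ^ 16 <= _) |- _ =>
  apply: (@wp_while _ _ H1 H2 I); first fit end.

(** * The Z algorithm *)

Definition zextend :=
  While ((zi +@ zz <@ zN) *@ (Read aY zz ==@ Read aY (zi +@ zz))) (zz ::= zz +@ #1).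

(** A product of tests is a conjunction. A value is copied only if it stays strictly inside the box
    [[zl, zr)]; otherwise matching resumes at [zr], and truncated subtraction makes it start from 0
    beyond the box. The last write serves the empty suffix. *)
Definition zalg (az : nat) :=
  zl ::= #0 ;; zr ::= #0 ;; zi ::= #1 ;;
  While (zi <@ zN)
    (If ((zi <@ zr) *@ (Read az (zi -@ zl) <@ zr -@ zi))
       (Write az zi (Read az (zi -@ zl)))
       (zz ::= zr -@ zi ;; zextend ;; Write az zi zz ;; zl ::= zi ;; zr ::= zi +@ zz) ;;
     zi ::= zi +@ #1) ;;
  Write az zN #0.

Definition isZ (N : nat) (Y : nat -> nat) (j z : nat) : Prop :=
  [/\ j + z <= N, forall t, t < z -> Y t = Y (j + t)
    & j + z < N -> Y z <> Y (j + z)].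

Section ZAlgorithm.
Variables (B M : nat).
Hypotheses (M_gt : 64 <= M) (powM : M ^ 16 <= B).
Let M1 : 1 < M. Proof. exact: leq_trans M_gt. Qed.

Lemma zextend_spec T st :
  var st zi + var st zz <= var st zN ->
  20 * (var st zN - (var st zi + var st zz)) + 20 <= T ->
  wp B M T st zextend (fun T' st' =>
    [/\ var st zz <= var st' zz, var st zi + var st' zz <= var st zN,
     forall t, var st zz <= t < var st' zz -> arr st aY t = arr st aY (var st zi + t),
     (var st zi + var st' zz < var st zN -> arr st aY (var st' zz) <> arr st aY (var st zi + var st' zz)) &
     T <= T' + 20 * (var st' zz - var st zz) + 20]).
Proof.
move=> hN hT; rewrite /zextend.
apply: (@wp_while _ _ M1 powM (fun T' st' =>
  [/\ var st zz <= var st' zz, var st zi + var st' zz <= var st zN,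
     (forall t, var st zz <= t < var st' zz -> arr st aY t = arr st aY (var st zi + t)) &
     20 * (var st zN - (var st zi + var st' zz)) + 20 <= T' /\ T <= T' + 20 * (var st' zz - var st zz)])); first fit.
  by split=> // [t|]; lia.
move=> T' st' b' fr [h1 h2 h3 [h4 h5]]; split=> /=; first by lia.
  rewrite (fr.1 zi) // (fr.1 zN) // !(fr.2 aY) // => hc.
  wasg; first by have := bv zN; rewrite (fr.1 zN) //; lia.
  split; try lia.
  by move=> t ht; case: (t =P var st' zz) => [->|ne]; [lia | apply: h3; lia].
rewrite (fr.1 zi) // (fr.1 zN) // !(fr.2 aY) // => hc.
by split=> //; lia.
Qed.

Lemma zalg_spec az T st :
  az != aY -> 200 * (var st zN + 1) <= T ->
  wp B M T st (zalg az) (fun T' st' =>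
    [/\ forall j, 0 < j < var st zN -> isZ (var st zN) (arr st aY) j (arr st' az j),
     arr st' az (var st zN) = 0 & T <= T' + 200 * (var st zN + 1)]).
Proof.
move=> azY hT; rewrite /zalg; set N := var st zN in hT *; set Y := arr st aY.
have aYz : (aY == az) = false by rewrite eq_sym; apply/negbTE.
do 3 (apply: wp_seq; wasg; first by lia).
apply: wp_seq.
(* Successful comparisons move [zr] to the right, so the term [20 * (N - zr)] pays for them. *)
apply: (@wp_while _ _ M1 powM (fun T' st' =>
  [/\ var st' zl < var st' zi <= N.+1, var st' zl <= var st' zr, var st' zr <= N,
     0 < var st' zr -> 0 < var st' zl &
  [/\ (forall j, 0 < j < var st' zi -> j < N -> isZ N Y j (arr st' az j)),
      (forall t, t < var st' zr - var st' zl -> Y t = Y (var st' zl + t)) &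
     100 * (N - var st' zi) + 20 * (N - var st' zr) + 20 <= T' /\
     T <= T' + 100 * (var st' zi) + 20 * var st' zr]])); first fit.
  by rewrite /=; split=> //; split=> // [j|]; lia.
move=> T' st' b' fr [h1 h2 h3 h4 [h5 h6 [h7 h8]]]; split=> /=; first by lia.
  rewrite (fr.1 zN) //= -/N b2n0 => hc.
  apply: wp_seq; wif => hb.
    wwr; first exact: ba.
    wasg; first by have := bv zN; rewrite /= (fr.1 zN) //= -/N; lia.
    split; try lia.
    split; try lia.
    move=> j hj jN; rewrite eqxx /=; case: eqP => [E|ne] /=; last by apply: h5; lia.
    have [||z1 z2 z3] := h5 (var st' zi - var st' zl); try lia.
    have sh t : t <= arr st' az (var st' zi - var st' zl) ->
        Y (var st' zi - var st' zl + t) = Y (j + t).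
      by move=> ht; rewrite h6; [congr Y; lia | lia].
    split; [lia | |].
      by move=> t ht; rewrite z2 //; apply: sh; lia.
    by move=> ht; rewrite -sh //; apply: z3; lia.
  by [].
  apply: wp_seq; wasg; first by have := bv zr; lia.
  apply: wp_seq; apply: (wp_conseq (zextend_spec _ _)) => /=; rewrite ?(fr.1 zN) //= -/N; try lia.
  move=> T1 st1 b1 fr1 [e1 e2 e3 e4 e5].
  have Ezi : var st1 zi = var st' zi by rewrite fr1.1.
    have EY : arr st' aY =1 Y by move=> t; rewrite (fr.2 aY) // /zextend /= !inE !aYz.
  have e3' t : t < var st1 zz -> Y t = Y (var st' zi + t).
    move=> ht; case: (leqP (var st' zr - var st' zi) t) => h.
      by have := e3 t; rewrite !EY; apply; lia.
    (* Inside the box the match is already known: as the test failed, the value at [zi - zl] reaches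
       the end of the box. *)
    have [||z1 z2 _] := h5 (var st' zi - var st' zl); try lia.
    rewrite z2; last by lia.
    by rewrite h6; [congr Y; lia | lia].
  apply: wp_seq; wwr; first exact: bv.
  apply: wp_seq; wasg; first exact: bv.
  wasg; first by have := bv zN; rewrite /= (fr1.1 zN) //= (fr.1 zN) //= -/N Ezi; lia.
  rewrite Ezi.
  wasg; first by have := bv zN; rewrite /= (fr1.1 zN) //= (fr.1 zN) //= -/N Ezi; lia.
  rewrite Ezi.
  have B1 : var st1 zz <= N - var st' zi by lia.
  split; [lia | lia | lia | lia |].
  split; [| | clear -hT hc h1 h3 h7 h8 e5 e1 e2 B1; split; lia].
    move=> j hj jN; rewrite eqxx /=; case: eqP => [->|ne] /=.
      by split=> // h; rewrite -!EY; apply: e4.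
    by rewrite (fr1.2 az) //=; apply: h5; lia.
  by move=> t ht; apply: e3'; lia.
rewrite (fr.1 zN) //= -/N => hc.
wwr; first by [].
rewrite (fr.1 zN) //= -/N.
split.
- move=> j hj; rewrite eqxx /=; case: eqP; first by lia.
  by move=> _; apply: h5; lia.
- by rewrite !eqxx.
- lia.
Qed.

End ZAlgorithm.

Lemma index_eq s v d v' d' : d < s -> d' < s ->
  (v * s + d == v' * s + d') = (v == v') && (d == d').
Proof.
move=> ds ds'; apply/eqP/andP => [e|[/eqP -> /eqP ->] //].
have s0 : 0 < s by lia.
have := congr1 (modn^~ s) e; have := congr1 (divn^~ s) e.
by rewrite /= !divnMDl // !modnMDl !modn_small // !divn_small // !addn0 => -> ->.
Qed.

(** * The construction of the suffix automaton as a program *)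

Definition arc_at v d := (v *@ vsig) +@ d.

(** Stops at the virtual state at the latest, whose transitions are all 1. *)
Definition dawg_loop1 :=
  While (Read aNext (arc_at vp vc) ==@ #0)
    (Write aNext (arc_at vp vc) vcur ;; vp ::= Read aLk vp).

Definition dawg_copy :=
  vd ::= #0 ;;
  While (vd <@ vsig)
    (Write aNext (arc_at vcl vd) (Read aNext (arc_at vq vd)) ;; vd ::= vd +@ #1).

Definition dawg_loop2 :=
  While (Read aNext (arc_at vp vc) ==@ vq)
    (Write aNext (arc_at vp vc) vcl ;; vp ::= Read aLk vp).

Definition dawg_clone :=
  vcl ::= vcnt ;; vcnt ::= vcnt +@ #1 ;;
  Write aLen vcl (Read aLen vp +@ #1) ;;
  Write aFe vcl (Read aFe vq) ;;
  Write aLk vcl (Read aLk vq) ;;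
  dawg_copy ;; dawg_loop2 ;;
  Write aLk vq vcl ;; Write aLk vcur vcl.

Definition dawg_step :=
  vc ::= Read aW vx ;; vcur ::= vcnt ;; vcnt ::= vcnt +@ #1 ;; vx ::= vx +@ #1 ;;
  Write aLen vcur (vx +@ #1) ;; Write aFe vcur vx ;; vp ::= vlast ;;
  dawg_loop1 ;;
  vq ::= Read aNext (arc_at vp vc) ;;
  If (Read aLen vp +@ #1 ==@ Read aLen vq) (Write aLk vcur vq) dawg_clone ;;
  vlast ::= vcur ;;
  Write aG vx (Read aLen (Read aLk vcur) -@ #1) ;;
  Write aSrc vx (Read aFe (Read aLk vcur)).

Section Step.

Variables (W : nat -> nat) (D : dawg) (x : nat).
Hypothesis I : dawg_inv W D x.

Local Notation c := (W x).
Local Notation suf := (suf W D x).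

(** One step down the chain adds just [p] to the states above the current one; this keeps the
    descriptions [nx1] and [nx2] exact along the loops. *)
Lemma suf_lt p v : suf p -> 0 < p -> suf v ->
  (ln D (lk D p) < ln D v) = (v == p) || (ln D p < ln D v).
Proof.
move=> sp p0 sv; have /andP[hp _] := sp.
have [|_ h _ _] := dw_lk I (v := p); first by rewrite p0.
case: (eqVneq v p) => [->//|ne] /=.
case: (ltngtP (ln D p) (ln D v)) => h'; first by lia.
  by apply/negbTE; rewrite -leqNgt; apply: (suf_below I).
by case/eqP: ne; symmetry; apply: (suf_uniq I sp sv) => //; lia.
Qed.

Lemma suf_ln v : suf v -> ln D v <= x.+1.
Proof. by case/andP=> _; rewrite LC => h; apply: leq_trans h (L_le _ _ _). Qed.

Lemma nx_lst : nx D (lst D) c = 0.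
Proof.
case: (dw_lst I) => h _ _; apply/eqP/negPn/negP => n0.
by have [_ _ [e he] _] := dw_nxP I h n0; apply: (lst_no_arc I he).
Qed.

Lemma ln_lk v : v < cnt D -> ln D (lk D v) <= ln D v.
Proof.
move=> h; case: (posnP v) => [->|v0]; first by rewrite (dw_lk0 I).
by have [|_ /ltnW] := dw_lk I (v := v); first by rewrite v0.
Qed.

(** The transition table when the first loop has come down to [p]. *)
Definition nx1 p v d :=
  if (d == c) && suf v && (ln D p < ln D v) then cnt D else nx D v d.

Definition nx_rep s (st : state) (f : nat -> nat -> nat) :=
  forall v d, d < s -> arr st aNext (v * s + d) = f v d.

End Step.

Section DawgFirstLoop.
Variables (B M : nat).
Hypotheses (M_gt : 64 <= M) (powM : M ^ 16 <= B).
Let M1 : 1 < M. Proof. exact: leq_trans M_gt. Qed.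

Section Step.

Variables (W : nat -> nat) (D : dawg) (x s : nat).
Hypotheses (I : dawg_inv W D x) (Ws : W x < s).

Local Notation c := (W x).
Local Notation suf := (suf W D x).
Local Notation nx1 := (nx1 W D x).
Local Notation nx_rep := (nx_rep s).

Lemma loop1_spec T st :
  var st vsig = s -> var st vc = c -> var st vcur = cnt D -> var st vp = lst D ->
  nx_rep st (nx D) -> (forall v, v < cnt D -> arr st aLk v = lk D v) ->
  20 * (ln D (lk D (lst D))) + 60 <= T ->
  wp B M T st dawg_loop1 (fun T' st' => exists p,
    [/\ suf p, nx D p c != 0, forall v, suf v -> ln D p < ln D v -> nx D v c = 0,
        var st' vp = p & [/\ ln D p <= ln D (lk D (lst D)), nx_rep st' (nx1 p) &
        T + 20 * ln D p <= T' + 20 * ln D (lk D (lst D)) + 60]]).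
Proof.
move=> hs hc hcur hp hnx hlk hT; rewrite /dawg_loop1.
have sl := suf_lst I; have [/andP[l0 lc] lf ll] := dw_lst I.
set l1 := ln D (lk D (lst D)) in hT *.
(* The length of the last state is that of the whole prefix and cannot be charged, so this state
   counts as one step above its link. *)
pose pot p := if p == lst D then l1.+1 else ln D p.
wwh (fun T' st' => exists p,
    [/\ suf p, forall v, suf v -> ln D p < ln D v -> nx D v c = 0,
        var st' vp = p, p = lst D \/ ln D p <= l1 & [/\ nx_rep st' (nx1 p), 
         20 * pot p + 20 <= T' & T + 20 * pot p <= T' + 20 * l1.+1 ]]).
  exists (lst D); rewrite /pot eqxx; split=> //; last split; try lia.
  - by move=> v sv; have := suf_ln sv; lia.
  - move=> v d ds; rewrite hnx // /nx1; case: ifP => // /andP[/andP[_ sv]].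
    by have := suf_ln sv; lia.
move=> T' st' b' fr [p [sp hab hp' hpl [hnx' h1 h2]]].
have E1 : var st' vsig = s by rewrite fr.1.
have E2 : var st' vc = c by rewrite fr.1.
have E3 : var st' vcur = cnt D by rewrite fr.1.
have E4 v : v < cnt D -> arr st' aLk v = lk D v by move=> ?; rewrite fr.2 ?hlk.
have [pc psuf] := andP sp.
have N : arr st' aNext (p * s + c) = nx D p c.
  by rewrite hnx' // /nx1 ltnn andbF.
split=> /=; rewrite ?b2n0 ?hp' ?E1 ?E2 ?N; first by lia.
  move/eqP=> n0.
  have p0 : 0 < p by rewrite lt0n; apply/eqP => p0; rewrite p0 (dw_nx0 I) in n0.
  have [|k1 k2 k3 _] := dw_lk I (v := p); first by rewrite p0.
  apply: wp_seq; wwr; first exact: bv.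
  rewrite hp' E1 E2 E3; wasg; first exact: b'.2.
  rewrite hp' E4 //; exists (lk D p).
  have lkl : ln D (lk D p) <= l1.
    case: hpl => [->|le]; first by [].
    by apply: leq_trans le; apply: ltnW.
  have pot_lt : pot (lk D p) < pot p.
    rewrite /pot; case: eqP => [e|_].
      by move: lkl k2 (suf_ln sp); rewrite e ll; lia.
    by case: eqP => [e|_]; lia.
  split=> //; first exact: (suf_lk I).
  - move=> v sv; rewrite (suf_lt I) // => /orP[/eqP -> //|]; exact: hab.
  - by right.
  split; try lia.
  move=> v d ds /=; rewrite index_eq // hnx' // /nx1.
  case: (boolP (suf v)) => sv; last first.
    rewrite andbF /=; case: (eqVneq v p) => // e; by rewrite e sp in sv.
  rewrite (suf_lt I sp p0 sv) !andbT andbC.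
  by case: (d == c); case: (v == p).
move=> hn; exists p; rewrite /pot in h1 h2.
have np : nx D p c != 0 by apply/eqP => e; rewrite e in hn.
have nl : p <> lst D by move=> e; rewrite e (nx_lst I) in np.
rewrite (introF eqP nl) in h1 h2.
split=> //; split=> //; [by case: hpl | lia].
Qed.
End Step.

End DawgFirstLoop.

Section DawgClone.
Variables (B M : nat).
Hypotheses (M_gt : 64 <= M) (powM : M ^ 16 <= B).
Let M1 : 1 < M. Proof. exact: leq_trans M_gt. Qed.

Lemma copy_spec T st (s q cl : nat) f :
  var st vcl = cl -> var st vq = q -> var st vsig = s -> q != cl -> nx_rep s st f ->
  40 * s + 40 <= T ->
  wp B M T st dawg_copy (fun T' st' =>
    nx_rep s st' (fun v d => if v == cl then f q d else f v d) /\ T <= T' + 40 * s + 40).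
Proof.
move=> hcl hq hs ne hnx hT; rewrite /dawg_copy.
apply: wp_seq; wasg; first by lia.
wwh (fun T' st' =>
  [/\ var st' vd <= s, nx_rep s st' (fun v d => if (v == cl) && (d < var st' vd) then f q d else f v d),
      40 * (s - var st' vd) + 20 <= T' & T <= T' + 40 * var st' vd + 20]).
  by split=> //=; [move=> v d ds /=; rewrite andbF hnx | lia | lia].
move=> T' st' b' fr [h1 h2 h3 h4].
have E1 : var st' vsig = s by rewrite fr.1.
have E2 : var st' vcl = cl by rewrite fr.1.
have E3 : var st' vq = q by rewrite fr.1.
split=> /=; rewrite ?b2n0 ?E1 ?E2; first by lia.
  move=> hd.
  apply: wp_seq; wwr; first exact: b'.2.
  rewrite E1 E2 E3 h2 // (negPf ne) /=.
  wasg; first by have := b'.1 vsig; lia.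
  split; try lia.
  move=> v d ds /=; rewrite index_eq // h2 //.
  case: (v == cl) => //=; case: eqP => [->|ned]; first by rewrite addn1 leqnn.
  by rewrite addn1 ltnS [in RHS]leq_eqVlt; case: eqP.
move=> hd; have e : var st' vd = s by lia.
split; last by lia.
by move=> v d ds; rewrite h2 // e ds andbT.
Qed.

Section Step.

Variables (W : nat -> nat) (D : dawg) (x s : nat).
Hypotheses (I : dawg_inv W D x) (Ws : W x < s).

Local Notation c := (W x).
Local Notation suf := (suf W D x).

Section Loop2.

Variable p : nat.
Hypotheses (sp : suf p) (np : nx D p c != 0).
Hypothesis above : forall v, suf v -> ln D p < ln D v -> nx D v c = 0.
Local Notation q := (nx D p c).
Local Notation cl := (cnt D).+1.
Local Notation nxp := (nx1 W D x p).
Hypothesis ne : ln D q <> (ln D p).+1.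

(** The transition table when the second loop has come down to [r]; the row of the clone is already
    complete. *)
Definition nx2 r v d :=
  if v == cl then nxp q d
  else if [&& d == c, suf v & ln D r < ln D v <= ln D p] then cl else nxp v d.

(** By [nx_between] no state below [r] still leads to [q]. *)
Lemma nx2_dstep r : suf r -> ln D r <= ln D p -> nx D r c != q ->
  (forall v, suf v -> ln D r < ln D v <= ln D p -> nx D v c = q) ->
  forall v d, nx2 r v d = nx (dstep W D x p) v d.
Proof.
move=> sr rp nr hr v d; rewrite /nx2 /= /exact_hd /hd (introF eqP ne) /=.
have lq := ln_q I sp np; have q1 : q != 1.
  by apply/eqP => e; move: ne lq; rewrite e (dw_ln1 I) /hd; case: (ln D p).
rewrite /nx1; case: (eqVneq v cl) => [_|nv].
  by rewrite (_ : ln D p < ln D q) //; case: (d == c); case: (suf q).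
case: (eqVneq d c) => [->|] //=; case: (boolP (suf v)) => //= sv.
case: (ltnP (ln D p) (ln D v)) => [lt|le]; first by rewrite andbF.
rewrite andbT; case: (ltnP (ln D r) (ln D v)) => h; first by rewrite hr ?eqxx // h.
case: eqP => // e; case/eqP: nr.
have v0 : 0 < v by rewrite lt0n; apply/eqP => v0; rewrite v0 (dw_nx0 I) in e; rewrite -e eqxx in q1.
by apply: (nx_between I sp np above sv sr v0 _ e); rewrite h.
Qed.

Lemma loop2_spec T st :
  var st vsig = s -> var st vc = c -> var st vcl = cl -> var st vp = p -> var st vq = q ->
  nx_rep s st (fun v d => if v == cl then nxp q d else nxp v d) ->
  (forall v, v < cnt D -> arr st aLk v = lk D v) ->
  20 * (ln D (lk D p)) + 60 <= T ->
  wp B M T st dawg_loop2 (fun T' st' =>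
    nx_rep s st' (nx (dstep W D x p)) /\
    T + 20 * ln D (lk D q) <= T' + 20 * ln D (lk D p) + 80).
Proof.
move=> hs hc hcl hp hq hnx hlk hT; rewrite /dawg_loop2.
have lq := ln_q I sp np; have q1 : q != 1.
  by apply/eqP => e; move: ne lq; rewrite e (dw_ln1 I) /hd; case: (ln D p).
set l1 := ln D (lk D p) in hT *.
pose pot r := if r == p then l1.+1 else ln D r.
have pn : p != cl by have /andP[h _] := sp; lia.
have suf_neq v : suf v -> (v == cl) = false by case/andP=> h _; apply/ltn_eqF; lia.
wwh (fun T' st' => exists r,
    [/\ suf r, ln D r <= ln D p, forall v, suf v -> ln D r < ln D v <= ln D p -> nx D v c = q,
        var st' vp = r & r = p \/ ln D r <= l1] /\ [/\ nx_rep s st' (nx2 r),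
         20 * pot r + 20 <= T' & T + 20 * pot r <= T' + 20 * l1.+1 ]).
  exists p; rewrite /pot eqxx; split; split=> //; try lia.
  - move=> v d ds; rewrite hnx // /nx2; case: ifP => // _.
    by case: ifP => // /and3P[_ _]; lia.
move=> T' st' b' fr [r [[sr rp hr hr' hrl] [hnx' h1 h2]]].
have E1 : var st' vsig = s by rewrite fr.1.
have E2 : var st' vc = c by rewrite fr.1.
have E3 : var st' vcl = cl by rewrite fr.1.
have E4 v : v < cnt D -> arr st' aLk v = lk D v by move=> ?; rewrite fr.2 ?hlk.
have E5 : var st' vq = q by rewrite fr.1.
have [rc rsuf] := andP sr.
have N : arr st' aNext (r * s + c) = nx D r c.
  by rewrite hnx' // /nx2 suf_neq // ltnn /= !andbF /nx1 ltnNge rp /= andbF.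
split=> /=; rewrite ?b2n0 ?hr' ?E1 ?E2 ?E5 ?N; first by lia.
  move/eqP=> n0.
  have r0 : 0 < r.
    by rewrite lt0n; apply/eqP => r0; rewrite r0 (dw_nx0 I) in n0; rewrite -n0 eqxx in q1.
  have [|k1 k2 k3 _] := dw_lk I (v := r); first by rewrite r0.
  apply: wp_seq; wwr; first exact: bv.
  rewrite hr' E1 E2 E3; wasg; first exact: b'.2.
  rewrite hr' E4 //; exists (lk D r).
  have lkl : ln D (lk D r) <= l1.
    case: hrl => [->|le]; first by [].
    by apply: leq_trans le; apply: ltnW.
  have pot_lt : pot (lk D r) < pot r.
    rewrite /pot; case: eqP => [e|_]; first by rewrite e in k2; lia.
    by case: eqP => [e|_]; lia.
  split; split=> //; try lia.
  - exact: (suf_lk I).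
  - move=> v sv; rewrite (suf_lt I sr r0 sv).
    case: eqVneq => [->//|_] /= h; exact: hr.
  - move=> v d ds /=; rewrite index_eq // hnx' // /nx2.
    case: (eqVneq v cl) => [->|nv].
      by rewrite [cl == r]eq_sym suf_neq.
    case: (boolP (suf v)) => sv; last first.
      rewrite !andbF /=; case: (eqVneq v r) => // e; by rewrite e sr in sv.
    rewrite (suf_lt I sr r0 sv) andbC; case: (d == c) => //=.
    by case: (eqVneq v r) => [->|] //=; rewrite rp.
move=> hn; rewrite /pot in h1 h2.
have nr : nx D r c != q by apply/eqP => e; rewrite e eqxx in hn.
have nl : r <> p by move=> e; rewrite e eqxx in nr.
rewrite (introF eqP nl) in h1 h2.
split; first by move=> v d ds; rewrite hnx' // (nx2_dstep sr rp nr hr).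
(* The state given by [lk_q_ex] leads to [lk D q] and not to [q], so the loop never passed it and
   [r] is at least as long. *)
suff : ln D (lk D q) <= ln D r + 1 by lia.
case: (ltnP 1 (ln D (lk D q))) => g1; last by lia.
have [v [sv v0 lv nv]] := lk_q_ex I sp np above g1.
have gh := lk_q_hd I sp np above; have [_ gq _ _] := dw_lk I (q_state I sp np).
rewrite leqNgt; apply/negP => lt.
have := hr v sv; rewrite nv => /(_ _) e.
have e' : lk D q = q by apply: e; rewrite /hd in gh; lia.
by rewrite e' in gq; lia.
Qed.

End Loop2.
End Step.

End DawgClone.

Definition dawg_rep s (D : dawg) (st : state) :=
  [/\ var st vcnt = cnt D, var st vlast = lst D, nx_rep s st (nx D) &
      forall v, v < cnt D ->
        [/\ arr st aLen v = ln D v, arr st aFe v = fe D v & arr st aLk v = lk D v]].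

(* Both loops of a step walk down suffix links; their iterations are paid for by
   the lengths of the first two links from the last state. *)
Definition dawg_pot (D : dawg) := ln D (lk D (lst D)) + ln D (lk D (lk D (lst D))).

Definition longest_prev (W : nat -> nat) (x g e : nat) :=
  [/\ e < x, g <= lcs W x e & forall e', e' < x -> lcs W x e' <= g].

Section DawgStep.
Variables (B M : nat).
Hypotheses (M_gt : 64 <= M) (powM : M ^ 16 <= B).
Let M1 : 1 < M. Proof. exact: leq_trans M_gt. Qed.

Lemma dawg_step_spec T st (W : nat -> nat) D x s :
  dawg_inv W D x -> W x < s -> arr st aW x = W x -> var st vx = x -> var st vsig = s ->
  dawg_rep s D st -> cnt D + 3 <= M -> x + 3 <= M ->
  40 * dawg_pot D + 40 * s + 600 <= T ->
  wp B M T st dawg_step (fun T' st' => exists D',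
    [/\ dawg_inv W D' x.+1, dawg_rep s D' st', var st' vx = x.+1, cnt D' <= (cnt D).+2 &
    [/\ T + 40 * dawg_pot D' <= T' + 40 * dawg_pot D + 40 * s + 600,
        longest_prev W x.+1 (arr st' aG x.+1) (arr st' aSrc x.+1) &
        forall j, j != x.+1 -> arr st' aG j = arr st aG j /\ arr st' aSrc j = arr st aSrc j]]).
Proof.
move=> I Ws hW hx hs [rcnt rlst rnx rarr] hM hM2 hT; rewrite /dawg_step.
apply: wp_bounded => b.
have [/andP[l0 lc] lf ll] := dw_lst I.
have c1 := dw_cnt I.
apply: wp_seq; wasg; first exact: b.2.
apply: wp_seq; wasg; first exact: b.1.
apply: wp_seq; wasg; first by rewrite rcnt; lia.
apply: wp_seq; wasg; first by rewrite hx; lia.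
apply: wp_seq; wwr; first by rewrite hx; lia.
apply: wp_seq; wwr; first by rewrite hx; lia.
apply: wp_seq; wasg; first by rewrite rlst; lia.
rewrite hx hW rcnt rlst !addn1.
apply: wp_seq; apply: (wp_conseq (loop1_spec M_gt powM I Ws _ _ _ _ _ _ _)) => //=.
- by move=> v vc; case: (rarr v vc).
- by move: hT; rewrite /dawg_pot; lia.
set st1 := set_var _ vp _.
move=> T1 st2 b2 fr [p [sp np above hp [hpl rnx2 hT2]]].
have E_x : var st2 vx = x.+1 by rewrite fr.1.
have E_sig : var st2 vsig = s by rewrite fr.1.
have E_c : var st2 vc = W x by rewrite fr.1.
have E_cur : var st2 vcur = cnt D by rewrite fr.1.
have E_cnt : var st2 vcnt = (cnt D).+1 by rewrite fr.1.
have E_len v : v < cnt D -> arr st2 aLen v = ln D v.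
  by move=> h; rewrite fr.2 //= ltn_eqF //; case: (rarr v h).
have E_fe v : v < cnt D -> arr st2 aFe v = fe D v.
  by move=> h; rewrite fr.2 //= ltn_eqF //; case: (rarr v h).
have E_lk v : v < cnt D -> arr st2 aLk v = lk D v.
  by move=> h; rewrite fr.2 //=; case: (rarr v h).
have E_lenc : arr st2 aLen (cnt D) = x.+2 by rewrite fr.2 //= eqxx.
have E_fec : arr st2 aFe (cnt D) = x.+1 by rewrite fr.2 //= eqxx.
have E_g j : arr st2 aG j = arr st aG j by rewrite fr.2.
have E_src j : arr st2 aSrc j = arr st aSrc j by rewrite fr.2.
have N : arr st2 aNext (p * s + W x) = nx D p (W x) by rewrite rnx2 // /nx1 ltnn andbF.
have {}hT2 : T + 20 * ln D p <= T1 + 20 * ln D (lk D (lst D)) + 100 by lia.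
clear fr st1.
rewrite /dawg_pot in hT.
have [pc psuf] := andP sp.
have /andP[q0 qc] := q_state I sp np.
have lq := ln_q I sp np; have := hd_le I sp np above; rewrite /hd => lpx.
(* [p] is on the chain at or below the first link, or is the last state itself; its link is compared
   with the second link. *)
have lkp : ln D (lk D p) <= ln D (lk D (lk D (lst D))).
  have [lp1 lp2] : suf W D x (lk D (lst D)) /\ suf W D x (lst D).
    by split; [apply: (suf_lk I) |]; apply: (suf_lst I).
  case: (ltngtP (ln D p) (ln D (lk D (lst D)))) hpl => // [h _|h _].
    by apply: leq_trans (suf_below I lp1 sp h); apply: ln_lk I _ pc.
  case: (posnP (ln D p)) => [p0|p0]; first by rewrite (p_eq0 I sp p0) (dw_lk0 I) (dw_ln0 I).
  by rewrite (suf_uniq I sp lp1 p0 h).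
have lkq := lk_q_ex I sp np above.
have [lkqc lkql _ _] := dw_lk I (q_state I sp np).
have lkqh := lk_q_hd I sp np above; rewrite /hd in lkqh.
have lnp : ln D p <= x by [].
apply: wp_seq; wasg; first exact: b2.2.
rewrite hp E_sig E_c N; set q := nx D p (W x) in q0 qc lq lkq lkqc lkql lkqh *.
have inv' := dstep_inv I sp np above.
have [hd1 hd2 hd3 hd4] := dstep_head I sp np above.
set D' := dstep W D x p in inv' hd1 hd2 hd3 hd4.
have curE : lst D' = cnt D by [].
have lkq' : ln D (lk D q) <= (ln D (lk D p)).+1.
  case: (ltnP 1 (ln D (lk D q))) => g1; last by lia.
  have [v [sv v0 lv nv]] := lkq g1.
  by have := suf_below I sp sv; lia.
(* The new first link is the head and the second one is the link of [q], cloned or not. Up to a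
   constant, the potential therefore drops by at least the descents of the two loops. *)
have pot' : dawg_pot D' = (ln D p).+1 + ln D (lk D q).
  have Elk : lk D' (cnt D) = head_state W D x p by rewrite /= eqxx.
  have Elk2 : lk D' (head_state W D x p) = lk D q.
    rewrite /= /head_state -/q; case: (exact_hd W D x p); first by rewrite (ltn_eqF qc).
    by rewrite !cl_cur eqxx.
  by rewrite /dawg_pot curE hd3 Elk Elk2 (dstep_ln _ _ _ lkqc).
pose Q3 T3 st3 := [/\ var st3 vcnt = cnt D', var st3 vcur = cnt D, var st3 vx = x.+1,
   nx_rep s st3 (nx D') &
  [/\ forall v, v < cnt D' ->
        [/\ arr st3 aLen v = ln D' v, arr st3 aFe v = fe D' v & arr st3 aLk v = lk D' v],
      forall j, arr st3 aG j = arr st aG j /\ arr st3 aSrc j = arr st aSrc j &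
      T + 40 * ((ln D p).+1 + ln D (lk D q)) <=
        T3 + 40 * (ln D (lk D (lst D)) + ln D (lk D (lk D (lst D)))) + 40 * s + 500]].
have cntle : cnt D' <= (cnt D).+2 by rewrite /=; case: ifP.
apply: wp_seq; apply: (wp_conseq (Q := Q3)); last first.
  move=> T3 st3 b3 fr [F1 F2 F3 F4 [F5 F6 F7]].
  have lkc : lk D' (cnt D) < cnt D' by have [h _ _] := dw_lst inv'; have [] := dw_lk inv' h.
  have cc : cnt D < cnt D' by have [/andP[_ h] _ _] := dw_lst inv'.
  have G : arr st3 aLk (cnt D) = lk D' (cnt D) by have [] := F5 _ cc.
  have [G1 G2 _] := F5 _ lkc.
  apply: wp_seq; wasg; first exact: b3.1.
  apply: wp_seq; wwr; first by apply: leq_trans (leq_subr _ _) _; exact: b3.2.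
  wwr; first exact: b3.2.
  rewrite F2 F3 G G1 G2.
  exists D'; split=> //.
  split; first by rewrite pot' /dawg_pot; lia.
    rewrite !eqxx hd3; split=> //; first by move: hd2; rewrite /L /hd; lia.
    by move=> e he; have := hd4 e he; rewrite /L /hd; lia.
  by move=> j jx; rewrite (negPf jx).
wif.
  rewrite hp !E_len // addn1 => /eqP eA.
  have eA' : exact_hd W D x p by rewrite /exact_hd /hd -eA.
  wwr; first by have := b2.1 vcnt; rewrite E_cnt; lia.
  rewrite E_cur; split=> //=; rewrite ?eA' //.
    move=> v d ds /=; rewrite rnx2 // /nx1 /=.
    case: (eqVneq d (W x)) => [->|_] //=.
    by case: (suf W D x v) => //=; case: ifP.
  split.
  - move=> v; rewrite ltnS leq_eqVlt => /predU1P[->|h].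
      by rewrite !ltnn !eqxx E_lenc E_fec /head_state eA'.
    by rewrite h ltn_eqF // E_len // E_fe // E_lk.
  - by move=> j; rewrite E_g E_src.
  - by lia.
rewrite hp !E_len // addn1 => /eqP; rewrite eqb0 => /eqP eA.
have eA' : exact_hd W D x p = false by apply/eqP => e; apply: eA; exact: esym e.
have ne : ln D q <> (ln D p).+1 by move=> e; apply: eA.
rewrite /dawg_clone.
apply: wp_seq; wasg; first exact: b2.1.
rewrite E_cnt; apply: wp_seq; wasg; first by rewrite E_cnt; lia.
rewrite E_cnt; apply: wp_seq; wwr; first by rewrite hp E_len //; lia.
apply: wp_seq; wwr; first exact: b2.2.
apply: wp_seq; wwr; first exact: b2.2.
have clq : ((cnt D).+1 == q) = false by apply: gtn_eqF; apply: ltnW.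
rewrite hp E_len // E_fe // E_lk // !addn1.
apply: wp_seq; apply: (wp_conseq (copy_spec M_gt powM (s := s) (q := q) (cl := (cnt D).+1) (f := nx1 W D x p) _ _ _ _ _ _)) => //=.
- by rewrite eq_sym clq.
- by lia.
set st4 := set_arr _ _ _ _.
move=> T5 st5 b5 fr5 [rnx5 hT5].
apply: wp_seq; apply: (wp_conseq (loop2_spec M_gt powM I Ws sp np above ne _ _ _ _ _ _ _ _)).
- by rewrite fr5.1.
- by rewrite fr5.1.
- by rewrite fr5.1.
- by rewrite fr5.1 //= hp.
- by rewrite fr5.1.
- exact: rnx5.
- by move=> v h; rewrite fr5.2 //= ltn_eqF ?E_lk //; apply: ltnW.
- by lia.
move=> T6 st6 b6 fr6 [rnx6 hT6].
have F1 : var st6 vcur = cnt D by rewrite fr6.1 // fr5.1.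
have F2 : var st6 vcl = (cnt D).+1 by rewrite fr6.1 // fr5.1.
have F3 : var st6 vq = q by rewrite fr6.1 // fr5.1.
have F4 : var st6 vcnt = (cnt D).+2 by rewrite fr6.1 // fr5.1.
have F5 : var st6 vx = x.+1 by rewrite fr6.1 // fr5.1.
have A1 v : arr st6 aLen v = arr st4 aLen v by rewrite fr6.2 // fr5.2.
have A2 v : arr st6 aFe v = arr st4 aFe v by rewrite fr6.2 // fr5.2.
have A3 v : arr st6 aLk v = arr st4 aLk v by rewrite fr6.2 // fr5.2.
have A4 j : arr st6 aG j = arr st aG j /\ arr st6 aSrc j = arr st aSrc j.
  by rewrite !fr6.2 // !fr5.2 //= E_g E_src.
apply: wp_seq; wwr; first by rewrite F2; lia.
wwr; first by rewrite F2; lia.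
rewrite F1 F2 F3; split=> //=; rewrite ?eA' //.
split=> //; last by rewrite -/q in hT6; lia.
move=> v vlt; case: (ltngtP v (cnt D)) => [h|h|->].
- rewrite A1 A2 A3 /= (ltn_eqF (ltnW _ : v < (cnt D).+1)) // E_len // E_fe // E_lk //.
- have -> : v = (cnt D).+1 by lia.
  by rewrite A1 A2 A3 /= !eqxx clq.
- have cc : (cnt D == (cnt D).+1) = false by apply: ltn_eqF.
  by rewrite A1 A2 /= cc E_lenc E_fec /head_state eA'.
Qed.

End DawgStep.

Definition dawg0 : dawg := {|
  cnt := 2; ln := fun v => nat_of_bool (v == 1); fe := fun _ => 0; lk := fun _ => 0;
  nx := fun v _ => nat_of_bool (v == 0); lst := 1 |}.

Lemma dawg0_inv W : dawg_inv W dawg0 0.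
Proof.
have one v : 0 < v < 2 -> v = 1 by lia.
constructor=> //=.
- by move=> v /one ->.
- by move=> v /one ->; exists 0.
- move=> e e'; rewrite !leqn0 => /eqP -> /eqP ->; exists 1; split=> //.
- by move=> v v' /one -> /one ->.
- by move=> v /one ->.
- by move=> v c e /one -> _ [].
- by move=> v c /one ->.
- by move=> [|v].
Qed.

Definition dawg_build :=
  Write aLen #1 #1 ;; vcnt ::= #2 ;; vlast ::= #1 ;; vd ::= #0 ;;
  While (vd <@ vsig) (Write aNext vd #1 ;; vd ::= vd +@ #1) ;;
  vx ::= #0 ;;
  While (vx <@ vn) dawg_step.

Section DawgBuild.
Variables (B M : nat).
Hypotheses (M_gt : 64 <= M) (powM : M ^ 16 <= B).
Let M1 : 1 < M. Proof. exact: leq_trans M_gt. Qed.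

Lemma dawg_build_spec T st (W : nat -> nat) n s :
  arr st aW =1 W -> (forall i, i < n -> W i < s) -> var st vn = n -> var st vsig = s ->
  (forall a i, 0 < a -> arr st a i = 0) -> 2 * n + 8 <= M ->
  (40 * s + 1000) * (n + 1) <= T ->
  wp B M T st dawg_build (fun T' st' =>
    (forall x, 0 < x <= n -> longest_prev W x (arr st' aG x) (arr st' aSrc x)) /\
    T <= T' + (40 * s + 1000) * (n + 1)).
Proof.
move=> hW hWs hn hs h0 hM hT; rewrite /dawg_build.
set K := 40 * s + 1000 in hT *.
have hT1 : K * n + K <= T by move: hT; rewrite mulnDr muln1.
rewrite mulnDr muln1.
have hK : K = 40 * s + 1000 by [].
clearbody K; clear hT.
apply: wp_bounded => b.
apply: wp_seq; wwr; first by lia.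
apply: wp_seq; wasg; first by lia.
apply: wp_seq; wasg; first by lia.
apply: wp_seq; wasg; first by [].
apply: wp_seq.
wwh (fun T' st' => [/\ var st' vd <= s,
   forall i, arr st' aNext i = (i < var st' vd) & 20 * (s - var st' vd) + (K * n + K - 40 * s - 100) <= T' /\
   T <= T' + 20 * var st' vd + 20]).
  by rewrite /=; split=> // [i|]; [exact: h0 | lia].
move=> T' st' b' fr [h1 h2 [h3 h4]].
have E1 : var st' vsig = s by rewrite fr.1.
split=> /=; rewrite ?b2n0 ?E1; first by lia.
  move=> hd; apply: wp_seq; wwr; first by lia.
  wasg; first by have := b'.1 vsig; lia.
  split; try lia.
  move=> i; rewrite h2; case: eqP => [->|ne] /=; first by rewrite addn1 ltnSn.
  by congr nat_of_bool; lia.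
move=> hd; have ed : var st' vd = s by lia.
apply: wp_seq; wasg; first by [].
(* Each letter adds at most two states; hence [2 * n + 8 <= M]. *)
wwh (fun T1 st1 => exists D,
  [/\ dawg_inv W D (var st1 vx), dawg_rep s D st1, cnt D <= 2 * var st1 vx + 2, var st1 vx <= n &
  [/\ forall x, 0 < x <= var st1 vx -> longest_prev W x (arr st1 aG x) (arr st1 aSrc x),
      40 * dawg_pot D + K * (n - var st1 vx) + 100 <= T1 &
      T + 40 * dawg_pot D <= T1 + K * var st1 vx + 40 * s + 100]]).
  exists dawg0; split=> //=.
  - exact: dawg0_inv.
  - split=> /=; rewrite ?fr.1 //.
      move=> v d ds /=; rewrite h2 ed; case: v => [|v]; first by rewrite add0n ds.
      by rewrite (_ : (_ < s) = false) //; apply/negbTE; rewrite -leqNgt mulSn; lia.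
    move=> v v2; rewrite !fr.2 //= !h0 // andbT; case: v v2 => [|[|]] //.
  - split; [by move=> x; lia | | ].
      by rewrite /dawg_pot /= subn0; lia.
    by rewrite /dawg_pot /=; lia.
move=> T1 st1 b1 fr1 [D [I R c1 xn [g1 g2 g3]]].
have F1 : var st1 vn = n by rewrite (fr1.1 vn) //= (fr.1 vn).
have F2 : var st1 vsig = s by rewrite (fr1.1 vsig) //= (fr.1 vsig).
split=> /=; rewrite ?b2n0 ?F1; first by lia.
  move=> xlt; have E : K * (n - var st1 vx) = K * (n - (var st1 vx).+1) + K.
    by rewrite -mulnSr; congr (_ * _); lia.
  have E3 : K * (var st1 vx).+1 = K * var st1 vx + K by rewrite mulnSr.
  apply: (wp_conseq (dawg_step_spec M_gt powM I (hWs _ xlt) _ _ F2 R _ _ _)) => //; try lia.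
    by rewrite fr1.2 //= fr.2 //= hW.
  move=> T2 st2 b2 fr2 [D' [I' R' hx c2 [k1 k2 k3]]].
  exists D'; rewrite hx; split=> //; try lia.
  split.
  - move=> x; case: (eqVneq x (var st1 vx).+1) => [-> //|ne] hxx.
    by have [-> ->] := k3 _ ne; apply: g1; lia.
  - by clear -g2 k1 E hK; lia.
  - by rewrite E3; clear -g3 k1 hK; lia.
move=> xge; have e : var st1 vx = n by lia.
rewrite e in g1 g2 g3; split=> //.
by lia.
Qed.

End DawgBuild.

(** * Factorization *)

(** The equality test contributes 1 when no nonempty suffix ends earlier, so that a new letter is a
    factor by itself. *)
Definition parse_loop :=
  vx ::= vn ;;
  While (#0 <@ vx)
    (vp ::= vx -@ Read aG vx -@ (Read aG vx ==@ #0) ;; Write aNB vp vx ;; vx ::= vp).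

(* [nb a] is the end of the factor that starts at [a], and 0 if no factor starts there. *)
Record is_parse (n : nat) (G nb : nat -> nat) : Prop := IsParse {
  ps_lt : forall a, nb a != 0 -> a < nb a <= n;
  ps_len : forall a, nb a != 0 -> a + maxn 1 (G (nb a)) = nb a;
  ps_next : forall a, nb a != 0 -> nb a = n \/ nb (nb a) != 0;
  ps_gap : forall a y, nb a != 0 -> a < y < nb a -> nb y = 0;
  ps_start : 0 < n -> nb 0 != 0 }.

Section Parse.
Variables (B M : nat).
Hypotheses (M_gt : 64 <= M) (powM : M ^ 16 <= B).
Let M1 : 1 < M. Proof. exact: leq_trans M_gt. Qed.

Lemma parse_loop_spec T st n :
  var st vn = n -> (forall x, 0 < x <= n -> arr st aG x < x) ->
  (forall i, arr st aNB i = 0) -> 50 * n + 50 <= T ->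
  wp B M T st parse_loop (fun T' st' =>
    is_parse n (arr st aG) (arr st' aNB) /\ T <= T' + 50 * n + 50).
Proof.
move=> hn hG h0 hT; rewrite /parse_loop.
apply: wp_bounded => b.
apply: wp_seq; wasg; first exact: b.1.
wwh (fun T' st' => [/\ var st' vx <= n, var st' vx = n \/ arr st' aNB (var st' vx) != 0,
   forall y, y < var st' vx -> arr st' aNB y = 0,
   (forall a, arr st' aNB a != 0 ->
     [/\ a < arr st' aNB a <= n, a + maxn 1 (arr st aG (arr st' aNB a)) = arr st' aNB a,
         arr st' aNB a = n \/ arr st' aNB (arr st' aNB a) != 0 &
         forall y, a < y < arr st' aNB a -> arr st' aNB y = 0]) &
   50 * var st' vx + 20 <= T' /\ T <= T' + 50 * (n - var st' vx) + 20]).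
  rewrite /= hn; split=> //; [by left | by move=> a; rewrite h0 | by lia].
move=> T' st' b' fr [h1 h2 h3 h4 [h5 h6]].
have EG x : arr st' aG x = arr st aG x by rewrite fr.2.
split=> /=; rewrite ?b2n0 ?EG; first by lia.
  move=> x0; set x := var st' vx in h1 h2 h3 h5 h6 x0 *.
  have Gx : arr st aG x < x by apply: hG; rewrite x0.
  set p := x - arr st aG x - (arr st aG x == 0).
  have px : p + maxn 1 (arr st aG x) = x by rewrite /p; case: (arr st aG x) Gx => [|g] Gx /=; lia.
  have xM : x <= M by exact: b'.1.
  apply: wp_seq; wasg; first by rewrite EG; lia.
  rewrite EG -/x -/p; apply: wp_seq; wwr; first by [].
  wasg; first by lia.
  have plt : p < x by lia.
  have nbx y : (if y == p then x else arr st' aNB y) != 0 -> y = p \/ p < y /\ arr st' aNB y != 0.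
    case: (eqVneq y p) => [->|ne] h; [by left | right]; split=> //.
    by rewrite ltnNge; apply/negP => le; case/eqP: h; apply: h3; lia.
  split=> /=; try lia.
  - by right; rewrite eqxx; lia.
  - by move=> y yp; rewrite ltn_eqF //; apply: h3; apply: ltn_trans yp plt.
  move=> a /nbx[->|[pa na]].
    rewrite eqxx; split=> //; first by rewrite plt.
      by case: h2 => [e|h]; [left | right; rewrite (gtn_eqF plt)].
    by move=> y /andP[y1 y2]; rewrite gtn_eqF // h3.
  rewrite (gtn_eqF pa); have [k1 k2 k3 k4] := h4 a na; split=> //.
    by case: k3 => [e|k]; [left | right; rewrite (gtn_eqF (ltn_trans pa (proj1 (andP k1))))].
  by move=> y hy; rewrite (_ : (y == p) = false); [apply: k4 | apply: gtn_eqF]; lia.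
move=> x0; have {}x0 : var st' vx = 0 by lia.
rewrite x0 in h2 h5 h6.
split; last by lia.
constructor.
- by move=> a /h4[].
- by move=> a /h4[].
- by move=> a /h4[].
- by move=> a y /h4[_ _ _]; apply.
- by move=> n0; case: h2 => // h; rewrite -h in n0.
Qed.

End Parse.

(** * Finding and deleting positions in amortized constant time *)

Definition bit (x o : nat) := odd (x %/ 2 ^ o).

Lemma pow2_gt0 o : 0 < 2 ^ o. Proof. by rewrite expn_gt0. Qed.

Lemma bitD x o o' : bit (x %/ 2 ^ o) o' = bit x (o + o').
Proof. by rewrite /bit expnD divnMA. Qed.

Lemma bit_small x b o : x < 2 ^ b -> b <= o -> bit x o = false.
Proof.
move=> xb bo; rewrite /bit divn_small //.
by apply: leq_trans xb _; rewrite leq_exp2l.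
Qed.

(** Subtracting the power of a set bit causes no borrow. This is how a mask loses a position. *)
Lemma bit_pow_sub x o o' : bit x o -> bit (x - 2 ^ o) o' = bit x o' && (o' != o).
Proof.
move=> hx.
have xo : x = (x %/ 2 ^ o).-1 * 2 ^ o + x %% 2 ^ o + 2 ^ o.
  have q0 : 0 < x %/ 2 ^ o by move: hx; rewrite /bit; case: (_ %/ _).
  by rewrite addnAC -mulSnr prednK // -divn_eq.
set q := (x %/ 2 ^ o).-1 in xo; set r := x %% _ in xo.
have rlt : r < 2 ^ o by rewrite ltn_mod pow2_gt0.
have oq : odd q = false.
  by move: hx; rewrite /bit /q; case: (_ %/ _) => //= h /negbTE.
have sq : (x - 2 ^ o) %/ 2 ^ o = q.
  by rewrite {1}xo addnK divnMDl ?pow2_gt0 // (divn_small rlt) addn0.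
have xq : x %/ 2 ^ o = q.+1.
  by rewrite {1}xo addnAC -mulSnr divnMDl ?pow2_gt0 // (divn_small rlt) addn0.
case: (ltngtP o' o) => h.
- have E : 2 ^ o = 2 ^ (o - o') * 2 ^ o' by rewrite -expnD subnK // ltnW.
  have D y : (y + 2 ^ o) %/ 2 ^ o' = 2 ^ (o - o') + y %/ 2 ^ o'.
    by rewrite addnC E divnMDl ?pow2_gt0.
  rewrite andbT xo addnK /bit D oddD oddX /= subn_eq0 leqNgt h.
  by case: (odd _).
- have E : o' = o + (1 + (o' - o).-1) by lia.
  rewrite andbT E -!(bitD _ o) sq xq -!(bitD _ 1) expn1 !divn2 /=.
  by rewrite uphalf_half oq.
- by rewrite andbF /bit h sq.
Qed.

Lemma bit_ones b o : o < b -> bit (2 ^ b - 1) o.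
Proof.
move=> ob; have E : 2 ^ b = 2 ^ (b - o) * 2 ^ o by rewrite -expnD subnK // ltnW.
have -> : 2 ^ b - 1 = (2 ^ (b - o) - 1) * 2 ^ o + (2 ^ o - 1).
  rewrite mulnBl mul1n -E addnBA ?pow2_gt0 // subnK //.
  by rewrite leq_exp2l // ltnW.
rewrite /bit divnMDl ?pow2_gt0 // divn_small ?addn0.
  by rewrite oddB ?pow2_gt0 // oddX /= subn_eq0 leqNgt ob.
by rewrite ltn_subrL pow2_gt0.
Qed.

Definition lowest_bit (y l : nat) := bit y l /\ forall o, o < l -> bit y o = false.

Lemma lowest_bit_odd y : odd y -> lowest_bit y 0.
Proof. by move=> h; split=> //; rewrite /bit expn0 divn1. Qed.

Lemma lowest_bit_half y l : odd y = false -> lowest_bit (y %/ 2) l -> lowest_bit y l.+1.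
Proof.
move=> ev [h1 h2]; have E o : bit (y %/ 2) o = bit y o.+1.
  by rewrite -{1}[2]expn1 bitD add1n.
rewrite E in h1; split=> // -[|o]; first by rewrite /bit expn0 divn1.
by rewrite ltnS -E; apply: h2.
Qed.

Lemma lowest_bit_lt y l b : y < 2 ^ b -> lowest_bit y l -> l < b.
Proof. by move=> yb [h _]; rewrite ltnNge; apply/negP => /(bit_small yb); rewrite h. Qed.

(* The blocks of [0 .. N] are grouped into intervals that end with their only
   block of nonzero mask; [id] is the label of the interval of a block. *)
Definition blocks N (id lo hi mask : nat -> nat) := forall j, j <= N ->
  [/\ id j <= N, lo (id j) <= j <= hi (id j), hi (id j) <= N &
   [/\ forall j', lo (id j) <= j' <= hi (id j) -> id j' = id j,
       forall j', j <= j' < hi (id j) -> mask j' = 0 &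
       mask (hi (id j)) != 0]].

(* A block is relabelled only when its interval at least doubles. *)
Definition block_pot N b (id lo hi : nat -> nat) :=
  \sum_(0 <= j < N.+1) (b - trunc_log 2 (hi (id j) - lo (id j)).+1).

Lemma sum_drop m (f f' : nat -> nat) a b :
  (forall j, j < m -> f' j <= f j) -> (forall j, a <= j < b -> f' j < f j) ->
  b <= m -> \sum_(0 <= j < m) f' j + (b - a) <= \sum_(0 <= j < m) f j.
Proof.
elim: m b => [|m IH] b le lt bm; first by rewrite !big_geq; lia.
rewrite !big_nat_recr //=.
have le' j : j < m -> f' j <= f j by move=> h; apply: le; apply: ltnW.
case: (ltnP b m.+1) => h.
  by have := IH b le' lt h; have := le m (ltnSn m); lia.
have e : b = m.+1 by lia.
have lt' j : a <= j < m -> f' j < f j by move=> h'; apply: lt; lia.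
have := IH m le' lt' (leqnn _).
case: (leqP a m) => am; last by have := le m (ltnSn m); lia.
have := lt m; lia.
Qed.

Section Merge.

Variables (N b : nat) (id lo hi mask : nat -> nat) (B t : nat).
Hypotheses (HB : blocks N id lo hi mask) (BN : B < N) (mB : mask B != 0).

Lemma block_hi : hi (id B) = B.
Proof.
have [_ h1 _ [_ h2 _]] := HB (ltnW BN).
apply/eqP; rewrite eqn_leq; apply/andP; split; last by case/andP: h1.
by rewrite leqNgt; apply/negP => h; move: mB; rewrite h2 // leqnn.
Qed.

Lemma block_lo : lo (id B.+1) = B.+1.
Proof.
have [_ /andP[h1 h1'] _ [h2 _ _]] := HB BN.
apply/eqP; rewrite eqn_leq h1 /= ltnNge; apply/negP => h.
have e : id B = id B.+1 by apply: h2; lia.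
by move: h1'; rewrite -e block_hi ltnn.
Qed.

Lemma block_neq : id B != id B.+1.
Proof. by apply/eqP => e; have := block_lo; rewrite -e; have [_] := HB (ltnW BN); lia. Qed.

Hypothesis ht : t = id B \/ t = id B.+1.

Let l := lo (id B).
Let h := hi (id B.+1).
(** The interval ending at the emptied block [B] is united with its right neighbour. The label [t]
    may be either of the old ones, so that the program can keep that of the larger part. *)
Definition merge_id j := if l <= j <= h then t else id j.
Definition merge_lo c := if c == t then l else lo c.
Definition merge_hi c := if c == t then h else hi c.
Definition merge_mask j := if j == B then 0 else mask j.

Lemma merge_bounds : [/\ l <= B, B < h & h <= N].
Proof.
have [_ /andP[h1 _] _ _] := HB (ltnW BN); have [_ /andP[_ h2] h3 _] := HB BN.
by split.
Qed.

Lemma id_in j : j <= N -> (l <= j <= h) = (id j == id B) || (id j == id B.+1).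
Proof.
move=> jN; have [_ j1 _ [j2 _ _]] := HB jN.
have [_ h1 _ [h2 _ _]] := HB (ltnW BN); have [_ h3 _ [h4 _ _]] := HB BN.
apply/idP/orP => [/andP[lj jh]|[]/eqP e].
- case: (leqP j B) => jB; [left | right]; apply/eqP; [apply: h2 | apply: h4].
    by rewrite lj block_hi.
  by rewrite block_lo jB.
- by rewrite e block_hi in j1; move: merge_bounds => -[]; rewrite /l; lia.
- by rewrite e block_lo in j1; move: merge_bounds => -[]; rewrite /h; lia.
Qed.

Lemma merge_blocks : blocks N merge_id merge_lo merge_hi merge_mask.
Proof.
have [b1 b2 b3] := merge_bounds.
have tN : t <= N by case: ht => ->; [case: (HB (ltnW BN)) | case: (HB BN)].
have [_ _ _ [_ z1 _]] := HB BN.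
move=> j jN; rewrite /merge_id; case: ifP => hj.
  rewrite /merge_lo /merge_hi eqxx; split=> //; split.
  - by move=> j' ->.
  - move=> j' /andP[jj' j'h]; rewrite /merge_mask; case: eqP => // /eqP ne.
    case: (ltnP j' B) => c; last by apply: z1; lia.
    have [_ _ _ [_ z2 _]] := HB jN.
    have e : id j = id B.
      by have [_ _ _ [e _ _]] := HB (ltnW BN); apply: e; rewrite block_hi; lia.
    by apply: z2; rewrite e block_hi; lia.
  - by rewrite /merge_mask (gtn_eqF b2); have [_ _ _ [_ _ z2]] := HB BN.
have nt : (id j == t) = false.
  apply/negbTE; move: hj; rewrite id_in // => /negbT; rewrite negb_or => /andP[n1 n2].
  by case: ht => ->.
have [j1 j2 j3 [j4 j5 j6]] := HB jN.
rewrite /merge_lo /merge_hi nt; split=> //; split.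
- move=> j' hj'; have j'N : j' <= N by lia.
  by rewrite id_in // (j4 _ hj') -id_in // hj.
- by move=> j' hj'; rewrite /merge_mask j5 // if_same.
- rewrite /merge_mask; case: (eqVneq (hi (id j)) B) => // e.
  have := id_in jN; rewrite hj => /esym/norP[/eqP n1 _].
  by case: n1; apply/esym/j4; lia.
Qed.

Hypothesis Nb : N < 2 ^ b.

(** For a block of the smaller part the interval at least doubles, so its logarithm grows by at
    least 1; [N < 2 ^ b] keeps the logarithm within [b], where the truncated difference really
    drops. *)
Lemma merge_pot_aux s1 s2 : 0 < s1 -> s1 <= s2 -> s1 + s2 <= N.+1 ->
  b - trunc_log 2 (s1 + s2) < b - trunc_log 2 s1.
Proof.
move=> s10 s12 sN.
have t1 : (trunc_log 2 s1).+1 <= trunc_log 2 (s1 + s2).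
  apply: trunc_log_max => //; rewrite expnS.
  have := trunc_logP (isT : 1 < 2) s10; lia.
suff : trunc_log 2 (s1 + s2) <= b by lia.
have s0 : 0 < s1 + s2 by lia.
rewrite -(leq_exp2l _ _ (isT : 1 < 2)).
by have := trunc_logP (isT : 1 < 2) s0; lia.
Qed.

Lemma merge_pot_le j : j <= N ->
  b - trunc_log 2 (merge_hi (merge_id j) - merge_lo (merge_id j)).+1 <=
  b - trunc_log 2 (hi (id j) - lo (id j)).+1.
Proof.
move=> jN; have [b1 b2 b3] := merge_bounds.
rewrite /merge_id; case: ifP => hj.
  rewrite /merge_lo /merge_hi eqxx; apply: leq_sub2l; apply: leq_trunc_log.
  by move: hj; rewrite id_in // => /orP[]/eqP ->; rewrite ?block_hi ?block_lo /l; lia.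
rewrite /merge_lo /merge_hi (_ : (id j == t) = false) //.
apply/negbTE; move: hj; rewrite id_in // => /negbT; rewrite negb_or => /andP[n1 n2].
by case: ht => ->.
Qed.

Lemma merge_pot : block_pot N b merge_id merge_lo merge_hi +
  minn (B.+1 - l) (h - B) <= block_pot N b id lo hi.
Proof.
have [b1 b2 b3] := merge_bounds.
have inl j : l <= j <= B -> id j = id B.
  by move=> hj; have [_ _ _ [e _ _]] := HB (ltnW BN); apply: e; rewrite block_hi.
have inh j : B < j <= h -> id j = id B.+1.
  by move=> hj; have [_ _ _ [e _ _]] := HB BN; apply: e; rewrite block_lo.
have e1 : (B - l).+1 = B.+1 - l by lia.
have e2 : (h - B.+1).+1 = h - B by lia.
have e3 : (h - l).+1 = B.+1 - l + (h - B) by lia.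
have in_merge j : l <= j <= h -> merge_hi (merge_id j) - merge_lo (merge_id j) = h - l.
  by move=> hj; rewrite /merge_id hj /merge_hi /merge_lo eqxx.
case: (leqP (B.+1 - l) (h - B)) => c.
  apply: sum_drop => [j|j hj|]; [exact: merge_pot_le | | lia].
  rewrite inl ?block_hi // in_merge; last by lia.
  by rewrite e1 e3; apply: merge_pot_aux; lia.
have -> : h - B = h.+1 - B.+1 by lia.
apply: sum_drop => [j|j hj|]; [exact: merge_pot_le | | lia].
rewrite inh ?block_lo // in_merge; last by lia.
by rewrite e2 e3 addnC; apply: merge_pot_aux; lia.
Qed.

End Merge.

(** * Bit tables, masks and relabelling as programs *)

Definition table_init :=
  Write aPow #0 #1 ;; Write aPow #1 #2 ;; vbb ::= #1 ;;
  While (Read aPow vbb <=@ vn)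
    (Write aPow (vbb +@ #1) (Read aPow vbb *@ #2) ;; vbb ::= vbb +@ #1) ;;
  vy ::= #1 ;;
  While (vy <@ Read aPow vbb)
    (If (vy %@ #2) Skip (Write aLsb vy (Read aLsb (vy /@ #2) +@ #1)) ;;
     vy ::= vy +@ #1) ;;
  vB ::= #0 ;;
  While (vB <=@ (vn /@ vbb))
    (Write aMask vB (Read aPow vbb -@ #1) ;; Write aId vB vB ;;
     Write aLo vB vB ;; Write aHi vB vB ;; vB ::= vB +@ #1).

(** If nothing is alive in the block of [i] from [i] on, the answer is in the last block of the
    interval of the next block, the only nonzero one there. An answer always exists, as position [n]
    is a sentinel that is never painted. *)
Definition find_alive :=
  vB ::= vi /@ vbb ;; vy ::= Read aMask vB /@ Read aPow (vi %@ vbb) ;;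
  If vy (vf ::= vi +@ Read aLsb vy)
    (vB ::= Read aHi (Read aId (vB +@ #1)) ;;
     vf ::= (vB *@ vbb) +@ Read aLsb (Read aMask vB)).

Definition relabel e := While (vj <=@ vr) (Write aId vj e ;; vj ::= vj +@ #1).

(** The two parts have [B - lo + 1] and [hi - B] blocks, so the strict test holds iff the left part
    is no larger. The surviving label changes only one of its two bounds. *)
Definition merge_cmd :=
  vp1 ::= Read aId vB ;; vq1 ::= Read aId (vB +@ #1) ;;
  If (vB -@ Read aLo vp1 <@ Read aHi vq1 -@ vB)
    (vj ::= Read aLo vp1 ;; vr ::= vB ;; Write aLo vq1 vj ;; relabel vq1)
    (vj ::= vB +@ #1 ;; vr ::= Read aHi vq1 ;; Write aHi vp1 vr ;; relabel vp1).

Definition delete_cmd :=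
  vB ::= vf /@ vbb ;;
  Write aMask vB (Read aMask vB -@ Read aPow (vf %@ vbb)) ;;
  If (Read aMask vB) Skip merge_cmd.

Record tables (b n : nat) (st : state) : Prop := Tables {
  tb_gt0 : 0 < b;
  tb_n : n < 2 ^ b;
  tb_b : var st vbb = b;
  tb_pow : forall j, j <= b -> arr st aPow j = 2 ^ j;
  tb_lsb : forall y, 0 < y < 2 ^ b -> lowest_bit y (arr st aLsb y) }.

(* Position [i] is alive while its candidate is 0. *)
Record alive_set (b n : nat) (st : state) : Prop := AliveSet {
  as_tab : tables b n st;
  as_lt : forall B, B <= n %/ b -> arr st aMask B < 2 ^ b;
  as_bit : forall B o, B <= n %/ b -> o < b ->
    bit (arr st aMask B) o = (arr st aCand (B * b + o) == 0);
  as_blocks : blocks (n %/ b) (arr st aId) (arr st aLo) (arr st aHi) (arr st aMask);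
  as_end : forall i, n <= i -> arr st aCand i = 0 }.

Section Tables.
Variables (B M : nat).
Hypotheses (M_gt : 64 <= M) (powM : M ^ 16 <= B).
Let M1 : 1 < M. Proof. exact: leq_trans M_gt. Qed.

Lemma table_init_spec T st n :
  var st vn = n -> (forall a i, 8 < a -> arr st a i = 0) -> 2 * n + 4 <= M ->
  200 * n + 400 <= T ->
  wp B M T st table_init (fun T' st' => exists b,
    [/\ alive_set b n st', forall i, arr st' aCand i = 0,
        block_pot (n %/ b) b (arr st' aId) (arr st' aLo) (arr st' aHi) <= 3 * n + 2 &
        T <= T' + 200 * n + 400]).
Proof.
move=> hn h0 hM hT; rewrite /table_init.
apply: wp_seq; wwr; first by lia.
apply: wp_seq; wwr; first by lia.
apply: wp_seq; wasg; first by lia.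
apply: wp_seq.
wwh (fun T' st' => [/\ 0 < var st' vbb, forall j, j <= var st' vbb -> arr st' aPow j = 2 ^ j,
   2 ^ var st' vbb <= 2 * n + 2,
   20 * (2 * n + 2 - 2 ^ var st' vbb) + 20 + (150 * n + 300) <= T' &
   T <= T' + 20 * 2 ^ var st' vbb + 20]).
  by rewrite /=; split=> //=; [case=> [|[|j]] | lia | lia | lia].
move=> T' st' b' fr [h1 h2 h3 h4 h5].
have E1 : var st' vn = n by rewrite fr.1.
split=> /=; rewrite ?b2n0 ?E1 ?h2 //; first by lia.
  move=> hb; apply: wp_seq; wwr; first by rewrite h2 //; lia.
  rewrite h2 //; wasg.
    by have := ltn_expl (var st' vbb) (isT : 1 < 2); lia.
  rewrite addn1 expnS mulnC; split=> //; try lia.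
  move=> j; rewrite leq_eqVlt => /predU1P[->|hj].
    by rewrite eqxx expnS.
  by rewrite (ltn_eqF hj) h2.
move=> hb; set b := var st' vbb in h1 h2 h3 h4 h5 hb *.
have n2b : n < 2 ^ b by lia.
have Eb : var st' vbb = b by [].
clearbody b; clear h4.
have bM : b < 2 ^ b by apply: ltn_expl.
apply: wp_seq; wasg; first by lia.
apply: wp_seq.
wwh (fun T1 st1 => [/\ 0 < var st1 vy <= 2 ^ b,
   forall y, 0 < y < var st1 vy -> lowest_bit y (arr st1 aLsb y) /\ arr st1 aLsb y <= b,
   forall y, var st1 vy <= y -> arr st1 aLsb y = 0,
   30 * (2 ^ b - var st1 vy) + (80 * n + 150) <= T1 &
   T <= T1 + 30 * var st1 vy + 40 * n + 80]).
  rewrite /=; split=> //; try lia.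
  by move=> y _; rewrite fr.2 //= h0.
move=> T1 st1 b1 fr1 [g1 g2 g3 g4 g5].
have F1 : var st1 vbb = b by rewrite fr1.1 // fr.1.
have F2 j : j <= b -> arr st1 aPow j = 2 ^ j by move=> jb; rewrite fr1.2 //= h2.
have F3 : var st1 vn = n by rewrite (fr1.1 vn) //= E1.
split=> /=; rewrite ?b2n0 ?F1 ?F2 //; first by lia.
  move=> yb; set y := var st1 vy in g1 g2 g3 g4 g5 yb *.
  have yM : y < M by lia.
  apply: wp_seq; wif.
    move=> oy; have {}oy : odd y by move: oy; rewrite modn2 b2n0.
    apply: wp_skip; first by lia.
    wasg; first by rewrite addn1.
    rewrite -/y addn1; split; try lia; last by move=> y' hy'; apply: g3; lia.
    move=> y' /andP[y0 ]; rewrite ltnS leq_eqVlt => /predU1P[->|hy']; last by apply: g2; rewrite y0.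
    by rewrite g3 //; split=> //; apply: lowest_bit_odd.
  move=> ey; have {}ey : odd y = false by move: ey; rewrite modn2; case: (odd y).
  have hy2 : 0 < y %/ 2 < y.
    by rewrite divn2; move: ey; have := odd_double_half y; lia.
  have [k1 k2] := g2 _ hy2.
  have lb := lowest_bit_half ey k1.
  have lb' : (arr st1 aLsb (y %/ 2)).+1 < b by apply: lowest_bit_lt lb; lia.
  wwr; first by rewrite -/y; lia.
  wasg; first by rewrite -/y; lia.
  rewrite -/y !addn1; split; try lia.
    move=> y' /andP[y0]; rewrite ltnS leq_eqVlt => /predU1P[->|hy'].
      by rewrite eqxx; split=> //; apply: ltnW.
    by rewrite (ltn_eqF hy'); apply: g2; rewrite y0.
  by move=> y' hy'; rewrite (gtn_eqF hy'); apply: g3; apply: ltnW.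
move=> yb; have {}yb : var st1 vy = 2 ^ b by lia.
rewrite yb in g2 g4 g5.
set N := n %/ b.
have Nn : N <= n by apply: leq_div.
apply: wp_seq; wasg; first by lia.
wwh (fun T2 st2 => [/\ var st2 vB <= N.+1,
   forall j, j < var st2 vB -> [/\ arr st2 aMask j = 2 ^ b - 1, arr st2 aId j = j,
      arr st2 aLo j = j & arr st2 aHi j = j],
   40 * (N.+1 - var st2 vB) + 10 <= T2 &
   T <= T2 + 40 * var st2 vB + 100 * n + 150]).
  by rewrite /=; split=> //; lia.
move=> T2 st2 b2 fr2 [k1 k2 k3 k4].
have G1 : var st2 vbb = b by rewrite fr2.1 // F1.
have G2 j : j <= b -> arr st2 aPow j = 2 ^ j by move=> jb; rewrite fr2.2 //= F2.
have G3 : var st2 vn = n by rewrite (fr2.1 vn) //= F3.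
split=> /=; rewrite ?b2n0 ?G1 ?G3 -/N //; first by lia.
  move=> jN; have jM : var st2 vB < M by lia.
  apply: wp_seq; wwr; first by rewrite G1 G2 //; lia.
  apply: wp_seq; wwr; first by apply: ltnW.
  apply: wp_seq; wwr; first by apply: ltnW.
  apply: wp_seq; wwr; first by apply: ltnW.
  wasg; first by rewrite addn1.
  rewrite G1 G2 // addn1; split; try lia.
  move=> j; rewrite ltnS leq_eqVlt => /predU1P[->|hj]; first by rewrite eqxx.
  by rewrite (ltn_eqF hj); apply: k2.
move=> jN; have {}jN : var st2 vB = N.+1 by lia.
rewrite jN in k2 k4; exists b.
have C0 i : arr st2 aCand i = 0 by rewrite fr2.2 // fr1.2 // fr.2 //= h0.
split=> //.
- split=> //.
  + split=> // y /g2[]; by rewrite (fr2.2 aLsb).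
  + by move=> j BN; have [-> _ _ _] := k2 _ BN; rewrite subn1 prednK ?pow2_gt0.
  + by move=> j o BN ob; have [-> _ _ _] := k2 _ BN; rewrite C0 bit_ones.
  + move=> j jN'; have [e1 e2 e3 e4] := k2 _ jN'.
    rewrite e2 e3 e4 leqnn; split=> //; split.
    * by move=> j' hj'; have -> : j' = j by lia.
    * by move=> j'; lia.
    * by rewrite e1; move: bM; lia.
(* There are [n %/ b + 1] blocks of potential at most [b], and [b < 2 ^ b <= 2 * n + 2]. *)
- rewrite /block_pot; apply: (@leq_trans (\sum_(0 <= j < N.+1) b)).
    by apply: leq_sum => j _; apply: leq_subr.
  rewrite sum_nat_const_nat subn0 mulSn.
  by have := leq_divM n b; rewrite -/N; lia.
- lia.
Qed.

End Tables.

Lemma blocks_ext N (id id' lo lo' hi hi' mask mask' : nat -> nat) :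
  id' =1 id -> lo' =1 lo -> hi' =1 hi -> (forall j, (mask' j == 0) = (mask j == 0)) ->
  blocks N id lo hi mask -> blocks N id' lo' hi' mask'.
Proof.
move=> e1 e2 e3 e4 H j jN; have [h1 h2 h3 [h4 h5 h6]] := H j jN.
rewrite e1 e2 e3; split=> //; split.
- by move=> j' hj'; rewrite e1; apply: h4.
- by move=> j' hj'; apply/eqP; rewrite e4; apply/eqP/h5.
- by rewrite e4.
Qed.

Lemma block_pot_ext N b (id id' lo lo' hi hi' : nat -> nat) :
  id' =1 id -> lo' =1 lo -> hi' =1 hi -> block_pot N b id' lo' hi' = block_pot N b id lo hi.
Proof. by move=> e1 e2 e3; apply: eq_bigr => j _; rewrite e1 e2 e3. Qed.

Definition st_pot b n (st : state) := block_pot (n %/ b) b (arr st aId) (arr st aLo) (arr st aHi).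

Definition alive_count n (st : state) := \sum_(0 <= i < n) (arr st aCand i == 0).

Lemma tables_frame b n st st' : tables b n st -> var st' vbb = var st vbb ->
  arr st' aPow =1 arr st aPow -> arr st' aLsb =1 arr st aLsb -> tables b n st'.
Proof.
move=> [h1 h2 h3 h4 h5] e1 e2 e3; split=> //; first by rewrite e1.
- by move=> j hj; rewrite e2 h4.
- by move=> y hy; rewrite e3; apply: h5.
Qed.

Lemma lsb_mask b n st B x l : alive_set b n st -> B <= n %/ b -> x <= b ->
  lowest_bit (arr st aMask B %/ 2 ^ x) l ->
  [/\ x + l < b, arr st aCand (B * b + (x + l)) = 0 &
      forall j, x <= j < x + l -> arr st aCand (B * b + j) != 0].
Proof.
move=> A BN xb [h1 h2]; have mb := as_lt A BN.
rewrite bitD in h1.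
have xl : x + l < b.
  by rewrite ltnNge; apply/negP => h; rewrite (bit_small mb h) in h1.
split=> //; first by move: h1; rewrite (as_bit A BN xl) => /eqP.
move=> j hj; have jb : j < b by lia.
rewrite -(as_bit A BN jb) -(subnKC (proj1 (andP hj))) -bitD h2 //; lia.
Qed.

Section FindAlive.
Variables (B M : nat).
Hypotheses (M_gt : 64 <= M) (powM : M ^ 16 <= B).
Let M1 : 1 < M. Proof. exact: leq_trans M_gt. Qed.

Lemma find_alive_spec T st b n i :
  alive_set b n st -> var st vi = i -> i <= n -> n <= M -> 60 <= T ->
  wp B M T st find_alive (fun T' st' => exists f,
    [/\ var st' vf = f, i <= f <= n, arr st aCand f = 0,
        forall j, i <= j < f -> arr st aCand j != 0 & T <= T' + 60]).
Proof.
move=> A hi iN nM hT; have [b0 nb hb hp hl] := as_tab A; rewrite /find_alive.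
apply: wp_bounded => bd.
have ib := ltn_pmod i b0; have iE := divn_eq i b.
have BN : i %/ b <= n %/ b by apply: leq_div2r.
have mb := as_lt A BN.
apply: wp_seq; wasg.
  by rewrite hi; apply: leq_trans (leq_div _ _) _; apply: leq_trans nM.
rewrite hi hb; apply: wp_seq; wasg.
  by apply: leq_trans (leq_div _ _) _; apply: bd.2.
rewrite hi hb hp; last exact: ltnW.
set y := _ %/ 2 ^ _.
have yb : y < 2 ^ b by apply: leq_ltn_trans (leq_div _ _) mb.
wif.
  move=> y0; have lb : lowest_bit y (arr st aLsb y) by apply: hl; rewrite lt0n y0.
  have [k1 k2 k3] := lsb_mask A BN (ltnW ib) lb.
  rewrite addnA -iE in k2.
  have fn : i + arr st aLsb y <= n.
    rewrite leqNgt; apply/negP => h.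
    have := k3 (n - i %/ b * b); rewrite subnKC; last by lia.
    by rewrite (as_end A) // => /(_ _)/eqP; case=> //; lia.
  wasg; first by rewrite hi; lia.
  rewrite hi; exists (i + arr st aLsb y); split=> //; [by lia | | by lia].
  move=> j hj; have := k3 (j - i %/ b * b); rewrite subnKC; last by lia.
  by apply; lia.
move=> y0.
have none j : i <= j < (i %/ b).+1 * b -> arr st aCand j != 0.
  move=> hj; have jb : j - i %/ b * b < b by move: hj; rewrite mulSn; lia.
  have := as_bit A BN jb; rewrite subnKC; last by lia.
  rewrite -(subnKC (_ : i %% b <= j - i %/ b * b)); last by lia.
  rewrite -bitD -/y y0 /bit div0n /= => /esym ->; by [].
have B1N : (i %/ b).+1 <= n %/ b.
  rewrite ltnNge; apply/negP => h; have := none n; rewrite (as_end A) // => /(_ _)/eqP.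
  case=> //; rewrite iN /=; apply: leq_trans (_ : (n %/ b).+1 * b <= _).
    by rewrite -ltn_divLR.
  by rewrite leq_mul2r ltnS h orbT.
have [j1 j2 j3 [j4 j5 j6]] := as_blocks A B1N.
apply: wp_seq; wasg; first exact: bd.2.
rewrite [i %/ b + 1]addn1; set c := arr st aHi _ in j2 j3 j4 j5 j6 *.
have mc := as_lt A j3.
have lb : lowest_bit (arr st aMask c %/ 2 ^ 0) (arr st aLsb (arr st aMask c)).
  by rewrite expn0 divn1; apply: hl; rewrite lt0n j6.
have [k1 k2 k3] := lsb_mask A j3 (leq0n b) lb; rewrite add0n in k1 k2 k3.
have none2 j : i <= j < c * b + arr st aLsb (arr st aMask c) -> arr st aCand j != 0.
  move=> hj; case: (ltnP j ((i %/ b).+1 * b)) => h1; first by apply: none; lia.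
  case: (leqP (c * b) j) => h2.
    by rewrite -(subnKC h2); apply: k3; lia.
  have jE := divn_eq j b; have jb := ltn_pmod j b0.
  have q1 : i %/ b < j %/ b by rewrite leq_divRL.
  have q2 : j %/ b < c by rewrite ltn_divLR.
  have q3 : j %/ b <= n %/ b by lia.
  have := as_bit A q3 jb; rewrite -jE j5 ?/bit ?div0n; last by lia.
  by move/esym=> /= ->.
have fn : c * b + arr st aLsb (arr st aMask c) <= n.
  rewrite leqNgt; apply/negP => h; have := none2 n; rewrite (as_end A) // => /(_ _)/eqP.
  by case=> //; lia.
have ic : i <= c * b.
  rewrite (leq_trans (_ : i <= (i %/ b).+1 * b)) //; first by rewrite mulSn; lia.
  by rewrite leq_mul2r; case/andP: j2 => _ ->; rewrite orbT.
wasg; first by rewrite hb; lia.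
rewrite hb; exists (c * b + arr st aLsb (arr st aMask c)); split=> //; lia.
Qed.

End FindAlive.

Section Kill.
Variables (B M : nat).
Hypotheses (M_gt : 64 <= M) (powM : M ^ 16 <= B).
Let M1 : 1 < M. Proof. exact: leq_trans M_gt. Qed.

Lemma relabel_spec T st x e :
  x != vj -> e = var st x -> var st vr < M -> 20 * (var st vr).+1 + 20 <= T + 20 * var st vj ->
  20 <= T -> 
  wp B M T st (relabel x) (fun T' st' =>
    (forall i, arr st' aId i = if var st vj <= i <= var st vr then e else arr st aId i) /\
    T + 20 * var st vj <= T' + 20 * maxn (var st vj) (var st vr).+1 + 20).
Proof.
move=> xj he hM hT hT2; rewrite /relabel; set h := var st vr in hM hT *; set l := var st vj in hT *.
wwh (fun T' st' => [/\ l <= var st' vj, var st' vj <= maxn l h.+1,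
   forall i, arr st' aId i = if l <= i < var st' vj then e else arr st aId i,
   20 * maxn l h.+1 + 20 <= T' + 20 * var st' vj & T + 20 * l <= T' + 20 * var st' vj]).
  split=> //; [exact: leq_maxl | | by lia].
  by move=> i; case: ifP => //; lia.
move=> T' st' b' fr [h1 h2 h3 h4 h5].
have E1 : var st' vr = h by rewrite fr.1.
have E2 : var st' x = e.
  by rewrite fr.1 -?he // inE.
split=> /=; rewrite ?b2n0 ?E1; first by lia.
  move=> hj; apply: wp_seq; wwr; first exact: b'.1.
  rewrite E2; wasg; first by lia.
  split; try lia.
  move=> i; case: (eqVneq i (var st' vj)) => [->|ne] /=; first by rewrite h1 addn1 leqnn.
  by rewrite h3; congr (if _ then _ else _); lia.
move=> hj; split; last by lia.
by move=> i; rewrite h3; case: ifP; case: ifP => //; lia.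
Qed.

(** [mask] is a ghost for the masks before the deletion: between the emptying of [Bk] and the merge,
    the stored masks violate [blocks]. *)
Lemma merge_cmd_spec T st N b Bk mask :
  blocks N (arr st aId) (arr st aLo) (arr st aHi) mask -> var st vB = Bk -> Bk < N ->
  mask Bk != 0 -> N < 2 ^ b -> N + 2 <= M ->
  20 * block_pot N b (arr st aId) (arr st aLo) (arr st aHi) + 100 <= T ->
  wp B M T st merge_cmd (fun T' st' =>
    blocks N (arr st' aId) (arr st' aLo) (arr st' aHi) (merge_mask mask Bk) /\
    T + 20 * block_pot N b (arr st' aId) (arr st' aLo) (arr st' aHi) <=
      T' + 20 * block_pot N b (arr st aId) (arr st aLo) (arr st aHi) + 100).
Proof.
move=> HB hB BN mB Nb NM hT; rewrite /merge_cmd.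
apply: wp_bounded => bd.
have hl1 := block_hi HB BN mB; have hl2 := block_lo HB BN mB; have ne := block_neq HB BN mB.
have [b1 b2 b3] := merge_bounds HB BN.
set p := arr st aId Bk in hl1 ne b1 *; set q := arr st aId Bk.+1 in hl2 ne b2 b3 *.
set l := arr st aLo p in b1 *; set h := arr st aHi q in b2 b3 *.
have pot t (ht : t = p \/ t = q) := merge_pot HB BN mB ht Nb.
have mb t (ht : t = p \/ t = q) := merge_blocks HB BN mB ht.
rewrite -/l -/h in pot.
apply: wp_seq; wasg; first exact: bd.2.
rewrite hB -/p; apply: wp_seq; wasg; first exact: bd.2.
rewrite hB [Bk + 1]addn1 -/q.
have np : minn (Bk.+1 - l) (h - Bk) <= block_pot N b (arr st aId) (arr st aLo) (arr st aHi).
  by have := pot q (or_intror erefl); lia.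
wif; rewrite hB -/l -/h => hs.
  apply: wp_seq; wasg; first exact: bd.2.
  rewrite -/l; apply: wp_seq; wasg; first by lia.
  rewrite hB; apply: wp_seq; wwr; first by lia.
  apply: (wp_conseq (relabel_spec (e := q) _ _ _ _ _)) => //=; try lia.
  move=> T1 st1 b1' fr [k1 k2].
  have e1 : arr st1 aId =1 merge_id (arr st aId) (arr st aLo) (arr st aHi) Bk q.
    move=> j; rewrite k1 /merge_id -/p -/l -/q -/h.
    case: ifP => [c|c]; first by rewrite ifT //; lia.
    case: ifP => // c'; have [_ _ _ [e _ _]] := HB _ BN; rewrite e // -/q hl2 -/h; lia.
  have e2 : arr st1 aLo =1 merge_lo (arr st aId) (arr st aLo) Bk q.
    by move=> j; rewrite fr.2.
  have e3 : arr st1 aHi =1 merge_hi (arr st aId) (arr st aHi) Bk q.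
    by move=> j; rewrite fr.2 //= /merge_hi -/q; case: eqP => [->|].
  split; first by apply: (blocks_ext e1 e2 e3 _ (mb q (or_intror erefl))).
  rewrite (block_pot_ext N b e1 e2 e3); have := pot q (or_intror erefl); lia.
apply: wp_seq; wasg; first by lia.
rewrite hB [Bk + 1]addn1; apply: wp_seq; wasg; first exact: bd.2.
rewrite -/h; apply: wp_seq; wwr; first exact: bd.2.
apply: (wp_conseq (relabel_spec (e := p) _ _ _ _ _)) => //=; try lia.
move=> T1 st1 b1' fr [k1 k2].
have e1 : arr st1 aId =1 merge_id (arr st aId) (arr st aLo) (arr st aHi) Bk p.
  move=> j; rewrite k1 /merge_id -/p -/l -/q -/h.
  case: ifP => [c|c]; first by rewrite ifT //; lia.
  case: ifP => // c'; have [_ _ _ [e _ _]] := HB _ (ltnW BN); rewrite e // -/p hl1 -/l; lia.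
have e2 : arr st1 aLo =1 merge_lo (arr st aId) (arr st aLo) Bk p.
  by move=> j; rewrite fr.2 //= /merge_lo -/p; case: eqP => [->|].
have e3 : arr st1 aHi =1 merge_hi (arr st aId) (arr st aHi) Bk p.
  by move=> j; rewrite fr.2.
split; first by apply: (blocks_ext e1 e2 e3 _ (mb p (or_introl erefl))).
rewrite (block_pot_ext N b e1 e2 e3); have := pot p (or_introl erefl); lia.
Qed.

Definition kill := Write aCand vf vm ;; delete_cmd.

Lemma kill_spec T st b n f :
  alive_set b n st -> var st vf = f -> f < n -> arr st aCand f = 0 -> 0 < var st vm ->
  n + 2 <= M -> 20 * st_pot b n st + 200 <= T ->
  wp B M T st kill (fun T' st' =>
    [/\ alive_set b n st',
        forall i, arr st' aCand i = if i == f then var st vm else arr st aCand i &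
        T + 20 * st_pot b n st' <= T' + 20 * st_pot b n st + 200]).
Proof.
move=> A hf fn cf m0 nM hT; have [b0 nb hb hp hl] := as_tab A.
rewrite /kill /delete_cmd.
apply: wp_bounded => bd.
have fb := ltn_pmod f b0; have fE := divn_eq f b.
have BN : f %/ b <= n %/ b by apply: leq_div2r; apply: ltnW.
have bitf : bit (arr st aMask (f %/ b)) (f %% b).
  by rewrite (as_bit A BN fb) -fE cf.
apply: wp_seq; wwr; first exact: bd.1.
apply: wp_seq; wasg.
  by rewrite hf; apply: leq_trans (leq_div _ _) _; lia.
rewrite hf hb; apply: wp_seq; wwr; first by apply: leq_trans (leq_subr _ _) _; exact: bd.2.
rewrite hf hb hp; last exact: ltnW.
set Bk := f %/ b in BN bitf *; set o := f %% b in fb bitf *.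
set m' := arr st aMask Bk - 2 ^ o.
set m := var st vm in m0 *.
have bit' j : bit m' j = bit (arr st aMask Bk) j && (j != o) by apply: bit_pow_sub.
have NM : n %/ b <= n by apply: leq_div.
have lt' k : k <= n %/ b -> (if k == Bk then m' else arr st aMask k) < 2 ^ b.
  move=> kN; case: eqP => [_|_]; last exact: (as_lt A).
  by apply: leq_ltn_trans (leq_subr _ _) _; apply: (as_lt A).
have bits' k o' : k <= n %/ b -> o' < b ->
    bit (if k == Bk then m' else arr st aMask k) o' =
    ((if k * b + o' == f then m else arr st aCand (k * b + o')) == 0).
  move=> kN ob; rewrite {1}fE -/Bk -/o index_eq //.
  case: (eqVneq k Bk) => [->|ne] /=; last exact: (as_bit A).
  rewrite bit' (as_bit A BN ob); case: (eqVneq o' o) => [->|_]; last by rewrite andbT.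
  by rewrite andbF; apply/esym; apply: gtn_eqF.
have end' i : n <= i -> (if i == f then m else arr st aCand i) = 0.
  by move=> ni; rewrite gtn_eqF ?(as_end A) //; apply: leq_trans fn ni.
wif.
  rewrite eqxx => m'0.
  apply: wp_skip; first by lia.
  split=> //; last by rewrite (_ : st_pot b n _ = st_pot b n st) //; lia.
  split=> //.
  apply: blocks_ext (as_blocks A) => // j /=.
  case: (eqVneq j Bk) => [->|//]; rewrite (negPf m'0).
  by apply/esym/negbTE; apply: contraL bitf => /eqP ->; rewrite /bit div0n.
rewrite eqxx => m'0.
have mB : arr st aMask Bk != 0.
  by apply: contraL bitf => /eqP ->; rewrite /bit div0n.
(* The last block contains the sentinel [n] and is never emptied, so the emptied block has a right
   neighbour. *)
have BN' : Bk < n %/ b.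
  rewrite ltn_neqAle BN andbT; apply/eqP => e.
  have nE := divn_eq n b; have nb' := ltn_pmod n b0.
  have := bits' Bk (n %% b) BN nb'; rewrite eqxx m'0 /bit div0n /= e -nE.
  by rewrite end'.
apply: (wp_conseq (merge_cmd_spec (N := n %/ b) (b := b) (Bk := Bk) (mask := arr st aMask) _ _ _ _ _ _ _)) => //=.
- exact: (as_blocks A).
- by lia.
- by lia.
- by rewrite (_ : block_pot _ _ _ _ _ = st_pot b n st) //; lia.
move=> T1 st1 b1 fr [k1 k2].
have eM j : arr st1 aMask j = if j == Bk then m' else arr st aMask j.
  by rewrite fr.2.
have eC j : arr st1 aCand j = if j == f then m else arr st aCand j.
  by rewrite fr.2.
rewrite -/(st_pot b n st1) (_ : block_pot _ _ _ _ _ = st_pot b n st) // in k2.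
split=> //; last by lia.
split.
- by apply: (tables_frame (as_tab A)) => [|j|j]; [rewrite fr.1 | rewrite fr.2 | rewrite fr.2].
- by move=> k kN; rewrite eM; apply: lt'.
- by move=> k o' kN ob; rewrite eM eC; apply: bits'.
- apply: blocks_ext k1 => // j; rewrite eM /merge_mask.
  by case: (eqVneq j Bk) => // _; rewrite m'0.
- by move=> i ni; rewrite eC; apply: end'.
Qed.

End Kill.

(** Every search restarts from the left end [vi]; its cost does not depend on how many painted
    positions it skips. *)
Definition paint := find_alive ;; While (vf <=@ vr0) (kill ;; find_alive).

(** A position dies once and thereby releases 400, which pays for its iteration; the first term pays
    for the relabelling. *)
Definition paint_pot b n st := 20 * st_pot b n st + 400 * alive_count n st.

Lemma alive_count_kill n st st' f m : 0 < m -> f < n -> arr st aCand f = 0 ->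
  (forall i, arr st' aCand i = if i == f then m else arr st aCand i) ->
  (alive_count n st').+1 = alive_count n st.
Proof.
move=> m0 fn cf E; rewrite /alive_count (@big_cat_nat _ _ _ f) ?(ltnW fn) //=.
rewrite [in RHS](@big_cat_nat _ _ _ f) ?(ltnW fn) //= (big_ltn fn) [in RHS](big_ltn fn).
rewrite E eqxx cf gtn_eqF // add0n -addnS add1n; congr (_ + _.+1).
  by apply: eq_big_nat => i hi; rewrite E (_ : (i == f) = false) //; apply: ltn_eqF; lia.
by apply: eq_big_nat => i hi; rewrite E (_ : (i == f) = false) //; apply: gtn_eqF; lia.
Qed.

Definition same_ds (st st' : state) := var st' vbb = var st vbb /\
  forall a, a \in [:: aPow; aLsb; aMask; aId; aLo; aHi; aCand] -> arr st' a =1 arr st a.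

Lemma alive_set_ext b n st st' : same_ds st st' -> alive_set b n st -> alive_set b n st'.
Proof.
move=> [e0 e] [h1 h2 h3 h4 h5]; split.
- by apply: (tables_frame h1) => //; apply: e.
- by move=> k kN; rewrite e // h2.
- by move=> k o kN ob; rewrite !e // h3.
- by apply: (blocks_ext _ _ _ _ h4) => j; rewrite e.
- by move=> i ni; rewrite e // h5.
Qed.

Lemma paint_pot_ext b n st st' : same_ds st st' -> paint_pot b n st' = paint_pot b n st.
Proof.
move=> [_ e]; rewrite /paint_pot /st_pot /alive_count; congr (_ * _ + _ * _).
  by apply: block_pot_ext; apply: e.
by apply: eq_bigr => i _; rewrite e.
Qed.

Lemma frame_same_ds c st st' : frame c st st' -> vbb \notin written_vars c ->
  ~~ has (mem [:: aPow; aLsb; aMask; aId; aLo; aHi; aCand]) (written_arrs c) -> same_ds st st'.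
Proof.
move=> [fv fa] hv ha; split=> [|a ain]; first exact: fv.
by apply: fa; apply: contra ha => h; apply/hasP; exists a.
Qed.

Section Paint.
Variables (B M : nat).
Hypotheses (M_gt : 64 <= M) (powM : M ^ 16 <= B).
Let M1 : 1 < M. Proof. exact: leq_trans M_gt. Qed.

Lemma paint_spec T st b n l r m :
  alive_set b n st -> var st vi = l -> var st vr0 = r -> var st vm = m ->
  l <= n -> r < n -> 0 < m -> n + 2 <= M ->
  paint_pot b n st + 200 <= T ->
  wp B M T st paint (fun T' st' =>
    [/\ alive_set b n st',
        forall i, arr st' aCand i = if (arr st aCand i == 0) && (l <= i <= r) then m else arr st aCand i &
        T + paint_pot b n st' <= T' + paint_pot b n st + 200]).
Proof.
rewrite /paint_pot => A hl hr hm ln rn m0 nM hT; rewrite /paint.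
apply: wp_seq; apply: (wp_conseq (find_alive_spec M_gt powM A hl ln _ _)); try lia.
move=> T1 st1 b1 fr1 [f [k1 k2 k3 k4 k5]].
have EC i : arr st1 aCand i = arr st aCand i by rewrite fr1.2.
have same st2 : arr st2 aId =1 arr st aId -> arr st2 aLo =1 arr st aLo ->
    arr st2 aHi =1 arr st aHi -> st_pot b n st2 = st_pot b n st.
  by move=> e1 e2 e3; apply: block_pot_ext.
wwh (fun T' st' => exists f, [/\ alive_set b n st', var st' vf = f, l <= f <= n,
   arr st' aCand f = 0 & [/\ forall j, l <= j < f -> arr st' aCand j != 0,
   forall i, arr st' aCand i = if (arr st aCand i == 0) && (l <= i < f) then m else arr st aCand i,
   20 * st_pot b n st' + 400 * alive_count n st' + 30 <= T',
   T + (20 * st_pot b n st' + 400 * alive_count n st') <=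
     T' + (20 * st_pot b n st + 400 * alive_count n st) + 60 &
   forall i, r < i -> arr st' aCand i = arr st aCand i]]).
  have A1 : alive_set b n st1.
    by apply: alive_set_ext A; apply: frame_same_ds fr1 _ _.
  have c1 : alive_count n st1 = alive_count n st by apply: eq_big_nat => i _; rewrite EC.
  have s1 : st_pot b n st1 = st_pot b n st by apply: same => j; rewrite fr1.2.
  exists f; rewrite s1 c1; split=> //; first by rewrite EC.
  split; try lia; [by move=> j hj; rewrite EC k4 | | by move=> i _; rewrite EC].
  move=> i; rewrite EC; case: ifP => // /andP[/eqP ci hi].
  by have := k4 i hi; rewrite ci.
move=> T' st' b' fr [f' [A' hf lf cf [g1 g2 g3 g4 g5]]].
have E1 : var st' vr0 = r by rewrite fr.1 // fr1.1.
have E2 : var st' vm = m by rewrite fr.1 // fr1.1.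
have E3 : var st' vi = l by rewrite fr.1 // fr1.1.
split=> /=; rewrite ?b2n0 ?hf ?E1; first by lia.
  move=> fr'; have fn : f' < n by lia.
  have c0 : 0 < alive_count n st'.
    by rewrite /alive_count (@big_cat_nat _ _ _ f') ?(ltnW fn) //= (big_ltn fn) cf; lia.
  apply: wp_seq; apply: (wp_conseq (kill_spec M_gt powM A' hf fn cf _ _ _)); try lia.
  move=> T2 st2 b2 fr2 [A2 c2 t2].
  rewrite E2 in c2; have cnt2 := alive_count_kill m0 fn cf c2.
  have E4 : var st2 vi = l by rewrite fr2.1.
  apply: (wp_conseq (find_alive_spec M_gt powM A2 E4 ln _ _)); try lia.
  move=> T3 st3 b3 fr3 [f2 [j1 j2 j3 j4 j5]].
  have EC3 i : arr st3 aCand i = arr st2 aCand i by rewrite fr3.2.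
  have A3 : alive_set b n st3.
    by apply: alive_set_ext A2; apply: frame_same_ds fr3 _ _.
  have c3 : alive_count n st3 = alive_count n st2 by apply: eq_big_nat => i _; rewrite EC3.
  have s3 : st_pot b n st3 = st_pot b n st2.
    by apply: block_pot_ext => j; rewrite fr3.2.
  have ff2 : f' < f2.
    rewrite ltnNge; apply/negP => h.
    case: (eqVneq f2 f') => [e|ne]; first by move: j3; rewrite c2 e eqxx; lia.
    have := g1 f2; move: j3; rewrite c2 (negPf ne) => -> h'.
    by have : 0 != 0 by apply: h'; lia.
  exists f2; rewrite s3 c3; split=> //; first by rewrite EC3.
  split; try lia; [by move=> j hj; rewrite EC3 j4 | |]; last first.
    by move=> i ri; rewrite EC3 c2 g5 // (_ : (i == f') = false) //; apply: gtn_eqF; lia.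
  move=> i; rewrite EC3 c2 g2; case: (eqVneq i f') => [->|ne].
    have cf0 : arr st aCand f' = 0.
      by move: cf; rewrite g2 ltnn !andbF.
    by rewrite cf0 ff2 eqxx (_ : l <= f') //; case/andP: lf.
  case: (boolP (arr st aCand i == 0)) => //= ci.
  case: (ltnP i f') => h; first by rewrite (ltn_trans h ff2).
  rewrite andbF; case: ifP => // /andP[h1 h2].
  have := j4 i; rewrite h1 h2 => /(_ isT); rewrite c2 (negPf ne) g2 (eqP ci) eqxx /=.
  by rewrite ltnNge h andbF.
move=> fr'; split=> //; last by lia.
  move=> i; rewrite g2; case: (boolP (arr st aCand i == 0)) => //= ci.
  case: (leqP l i) => //= li; case: (leqP i r) => ir; first by rewrite ifT //; lia.
  case: ifP => // h.
  have := g1 i; rewrite li h => /(_ isT).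
  by rewrite g5 // ci.
Qed.

End Paint.

(** * Powers across a factor boundary *)

Definition fill off len idx :=
  vt ::= #0 ;;
  While (vt <@ len) (Write aY (off +@ vt) (Read aW idx) ;; vt ::= vt +@ #1).

(** Runs the Z algorithm on a pattern, a separator and a text. The separator [vsig] is the alphabet
    size, larger than every letter code, so no match runs across it and Z values in the text are
    common prefix lengths with the pattern. *)
Definition zbuild pl pidx tl tidx az :=
  fill (#0) pl pidx ;; Write aY pl vsig ;; fill (pl +@ #1) tl tidx ;;
  zN ::= pl +@ #1 +@ tl ;; zalg az.

Definition is_lcp pl tl (P X : nat -> nat) j z :=
  [/\ z <= pl, j + z <= tl, forall t, t < z -> P t = X (j + t) &
      z < pl -> j + z < tl -> P z <> X (j + z)].

Lemma isZ_lcp pl tl P X s Y j z :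
  (forall t, t < pl -> Y t = P t) -> Y pl = s -> (forall t, t < tl -> Y (pl + 1 + t) = X t) ->
  (forall t, t < tl -> X t < s) -> isZ (pl + 1 + tl) Y (pl + 1 + j) z ->
  is_lcp pl tl P X j z.
Proof.
move=> hP hs hX Xs [z1 z2 z3].
have zpl : z <= pl.
  rewrite leqNgt; apply/negP => h; have := z2 pl h; rewrite hs -addnA hX; last by lia.
  by move=> e; have := Xs (j + pl); rewrite -e; lia.
split=> //; first by lia.
- move=> t tz; rewrite -hP; last by lia.
  rewrite (z2 _ tz) -addnA hX; [by [] | by lia].
- move=> zp zt; rewrite -(hP _ zp) -(hX _ zt).
  by rewrite addnA; apply: z3; lia.
Qed.

(* [[p - A, p + E)] is the longest interval of [[lo, b - m)] around [p] on
   which [W] agrees with its shift by [m]. *)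
Definition is_ext (W : nat -> nat) lo b p m E A :=
  [/\ p + m + E <= b, A <= p - lo, forall x, p - A <= x < p + E -> W x = W (x + m),
      p + m + E < b -> W (p + E) <> W (p + m + E) &
      A < p - lo -> W (p - A.+1) <> W (p + m - A.+1)].

(** Around [a] as around [a - m], position [a] is compared with some [y], namely [a + m] or [a - m].
    So one forward and one backward table, both anchored at [a], serve all periods. *)
Lemma lcp_ext W lo a b p m y E A :
  lo <= p -> p + m <= b -> lo <= a <= b -> 0 < m ->
  (p = a /\ y = p + m) \/ (y = p /\ a = p + m) ->
  is_lcp (b - a) (b - lo) (fun t => W (a + t)) (fun t => W (lo + t)) (y - lo) E ->
  is_lcp (a - lo) (b - lo) (fun t => W (a - 1 - t)) (fun t => W (b - 1 - t)) (b - y) A ->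
  is_ext W lo b p m E A.
Proof.
move=> lp pmb /andP[la ab] m0 hc [e1 e2 e3 e4] [f1 f2 f3 f4].
have ly : lo <= y by clear -lp hc la; lia.
have yb : y <= b by clear -hc ab pmb; lia.
have a1 t : a - 1 - t = a - t.+1 by clear; lia.
have b1 t : b - 1 - (b - y + t) = y - t.+1 by clear -yb; lia.
have E3 t : t < E -> W (p + t) = W (p + m + t).
  move=> tE; have := e3 t tE; rewrite addnA subnKC //.
  by case: hc => -[-> ->].
have F3 t : t < A -> W (p - t.+1) = W (p + m - t.+1).
  by move=> tA; have := f3 t tA; rewrite a1 b1; case: hc => -[-> ->].
split; [by clear -e1 e2 hc la ab ly yb pmb; lia | by clear -f1 f2 hc ly; lia | | |].
- move=> x hx; case: (leqP p x) => px.
    have := E3 (x - p); rewrite subnKC // => -> //; last by clear -hx px; lia.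
    by congr W; clear -px; lia.
  have := F3 (p - x).-1; rewrite prednK; last by rewrite subn_gt0.
  rewrite subKn; last exact: ltnW.
  move=> -> //; last by clear -hx px; lia.
  by congr W; clear -px; lia.
- move=> h; have := e4; rewrite addnA subnKC //.
  by case: hc => -[pa ya] h'; [subst a y | subst y a] => e; case: h'; rewrite // ?e //;
    clear -h pmb la ly lp; lia.
- move=> h; have := f4; rewrite a1 b1.
  by case: hc => -[pa ya] h'; [subst a y | subst y a] => e; case: h'; rewrite // ?e //;
    clear -h pmb la ly lp; lia.
Qed.

Definition pw (W : nat -> nat) n k i m :=
  i + k * m <= n /\ forall x, i <= x < i + (k - 1) * m -> W x = W (x + m).

Lemma mulk1 k m : 0 < k -> k * m = (k - 1) * m + m.
Proof. by case: k => // k _; rewrite subn1 mulSnr. Qed.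

Lemma ext_sound W n k lo b p m E A i : 0 < k -> b <= n ->
  is_ext W lo b p m E A -> (k - 1) * m <= A + E -> p - A <= i <= p + E - (k - 1) * m ->
  pw W n k i m /\ i + k * m <= b.
Proof.
move=> k0 bn [e1 e2 e3 _ _] le hi; rewrite /pw (mulk1 m k0).
split; last by lia.
by split; [lia | move=> x hx; apply: e3; lia].
Qed.

(** Otherwise one of the mismatches that delimit the extension would fall into the periodic range,
    which reaches [p]. *)
Lemma ext_complete W n k lo b p m E A i : 0 < k -> lo <= p ->
  is_ext W lo b p m E A -> pw W n k i m -> lo <= i -> i + k * m <= b ->
  i <= p <= i + (k - 1) * m ->
  (k - 1) * m <= A + E /\ p - A <= i <= p + E - (k - 1) * m.
Proof.
move=> k0 lop [e1 e2 e3 e4 e5] [_ hp] li; rewrite (mulk1 m k0) => ib hi.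
have hE : i + (k - 1) * m <= p + E.
  rewrite leqNgt; apply/negP => h; have := hp (p + E); rewrite addnAC => hh.
  by apply: e4; [lia | apply: hh; lia].
have hA : p <= i + A.
  rewrite leqNgt; apply/negP => h; have := hp (p - A.+1).
  rewrite (_ : p - A.+1 + m = p + m - A.+1); last by lia.
  by move=> hh; apply: e5; [lia | apply: hh; lia].
lia.
Qed.

Lemma lcs_ge W d e e' : d <= e -> d <= e' ->
  (forall t, t < d -> W (e - t.+1) = W (e' - t.+1)) -> d <= lcs W e e'.
Proof.
elim: d e e' => // d IH [|e] [|e'] // de de' h /=.
have := h 0 isT; rewrite !subn1 /= => ->; rewrite eqxx ltnS; apply: IH => // t td.
by have := h t.+1 td; rewrite !subSS.
Qed.

Lemma lcs_eq W e e' t : t < lcs W e e' -> W (e - t.+1) = W (e' - t.+1).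
Proof.
elim: e e' t => [|e IH] [|e'] //= t; case: eqP => // h.
by case: t => [|t]; rewrite ?subn1 ?subSS //= ltnS; apply: IH.
Qed.

(* A power across the end [a] of a factor starts its second period after the
   start [a0] of the factor: otherwise the factor could be extended to the left. *)
Lemma crossing_bound W n k i m a0 a g e : 0 < k -> 0 < m ->
  longest_prev W a g e -> a0 + maxn 1 g = a -> pw W n k i m -> i < a < i + k * m ->
  a0 <= i + m.
Proof.
move=> k0 m0 [_ _ hg] ha [_ hp]; rewrite (mulk1 m k0) => hi.
rewrite leqNgt; apply/negP => h.
have ma : m <= a by lia.
have : (a - a0).+1 <= lcs W a (a - m).
  apply: lcs_ge; try lia.
  move=> t td; have := hp (a - m - t.+1).
  rewrite (_ : a - m - t.+1 + m = a - t.+1); last by lia.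
  by move=> -> //; lia.
by have := hg (a - m); lia.
Qed.

Section Fill.
Variables (B M : nat).
Hypotheses (M_gt : 64 <= M) (powM : M ^ 16 <= B).
Let M1 : 1 < M. Proof. exact: leq_trans M_gt. Qed.

(** The bound and the offset of the filling loop are evaluated anew in each iteration, while the
    counter [x] and the target array [a] change. *)
Definition stable x a (st : state) (e : expr) := forall st',
  (forall y, y != x -> var st' y = var st y) ->
  (forall c, c != a -> arr st' c =1 arr st c) -> ev st' e = ev st e.

Lemma fill_spec T st off len idx o l (f : nat -> nat) :
  fits M (vt <@ len) -> fits M (off +@ vt) -> fits M (Read aW idx) ->
  cost off + cost len + cost idx <= 30 ->
  stable vt aY st off -> ev st off = o -> stable vt aY st len -> ev st len = l ->
  (forall st', (forall y, y != vt -> var st' y = var st y) -> ev st' idx = f (var st' vt)) ->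
  l < M -> 60 * l + 60 <= T ->
  wp B M T st (fill off len idx) (fun T' st' =>
    (forall j, arr st' aY j = if o <= j < o + l then arr st aW (f (j - o)) else arr st aY j) /\
    T <= T' + 60 * l + 60).
Proof.
move=> f1 f2 f3 hc so eo sl el sf lM hT; rewrite /fill.
apply: wp_seq; wasg; first by lia.
match goal with H1 : is_true (1 < ?M), H2 : is_true (?M ^ 16 <= _) |- _ =>
  apply: (@wp_while _ _ H1 H2 (fun T' st' => [/\ var st' vt <= l,
  forall j, arr st' aY j = if o <= j < o + var st' vt then arr st aW (f (j - o)) else arr st aY j,
  60 * (l - var st' vt) + 50 <= T' & T <= T' + 60 * var st' vt + 10])); first exact: f1 end.
  by rewrite /=; split=> //; try lia; move=> j; rewrite addn0; case: ifP => //; lia.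
move=> T' st' b' fr [h1 h2 h3 h4].
have v' y : y != vt -> var st' y = var st y.
  by move=> hy; rewrite fr.1 /= ?inE ?(negPf hy).
have a' c : c != aY -> arr st' c =1 arr st c.
  by move=> hc' i; rewrite fr.2 /= ?inE.
have E1 : ev st' off = o by rewrite so.
have E2 : ev st' len = l by rewrite sl.
have E3 : ev st' idx = f (var st' vt) by apply: sf.
split=> /=; rewrite ?b2n0 ?E2; first by lia.
  move=> hl; apply: wp_seq.
  wgo @wp_write; [exact: f2 | exact: f3 | by rewrite /=; lia | by move=> _; exact: b'.2 | rewrite /=].
  rewrite E1 E3 (a' aW) //.
  wasg; first by lia.
  split; try lia.
  move=> j; case: (eqVneq j (o + var st' vt)) => [->|ne] /=.
    by rewrite leq_addr ltn_add2l addn1 leqnn addKn.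
  rewrite h2; congr (if _ then _ else _); lia.
move=> hl; have e : var st' vt = l by lia.
by rewrite e in h2 h4; split=> //; lia.
Qed.

Lemma zbuild_spec T st pl pidx tl tidx az p t (P X : nat -> nat) :
  az != aY -> 
  fits M (vt <@ pl) -> fits M (Read aW pidx) -> fits M pl ->
  fits M (vt <@ tl) -> fits M (pl +@ #1 +@ vt) -> fits M (Read aW tidx) -> fits M (pl +@ #1 +@ tl) ->
  cost pl + cost pidx <= 20 -> cost pl + cost tl + cost tidx <= 20 ->
  (forall st', (forall y, y \notin [:: vt; zN] -> var st' y = var st y) ->
    [/\ ev st' pl = p, ev st' tl = t, ev st' pidx = P (var st' vt) & ev st' tidx = X (var st' vt)]) ->
  (forall j, j < p -> arr st aW (P j) < var st vsig) ->
  (forall j, j < t -> arr st aW (X j) < var st vsig) ->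
  p + t + 4 <= M -> 300 * (p + t) + 700 <= T ->
  wp B M T st (zbuild pl pidx tl tidx az) (fun T' st' =>
    (forall j, j <= t -> is_lcp p t (fun i => arr st aW (P i)) (fun i => arr st aW (X i)) j (arr st' az (p + 1 + j))) /\
    T <= T' + 300 * (p + t) + 700).
Proof.
move=> azY f1 f2 f3 f4 f5 f6 f7 c1 c2 H hP hX hM hT; rewrite /zbuild.
have ext1 st' : (forall y, y != vt -> var st' y = var st y) ->
    forall y, y \notin [:: vt; zN] -> var st' y = var st y.
  by move=> h y; rewrite !inE negb_or => /andP[h1 _]; apply: h.
have [Hpl Htl _ _] := H st (fun _ _ => erefl).
apply: wp_bounded => bd.
apply: wp_seq.
apply: (wp_conseq (fill_spec (o := 0) (l := p) (f := P) _ _ _ _ _ _ _ _ _ _ _)) => //; try lia.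
- rewrite /=; lia.
- by move=> st' h _; have [-> _ _ _] := H st' (ext1 _ h).
- by move=> st' h; have [_ _ -> _] := H st' (ext1 _ h).
move=> T1 st1 b1 fr1 [k1 k2].
have V1 y : y != vt -> var st1 y = var st y.
  by move=> hy; rewrite fr1.1 // /fill /= !inE (negPf hy).
have A1 c : c != aY -> arr st1 c =1 arr st c.
  by move=> hc i; rewrite fr1.2 // /fill /= !inE (negPf hc).
have [Hpl1 _ _ _] := H st1 (ext1 _ V1).
apply: wp_seq; wgo @wp_write; [exact: f3 | fit | by rewrite /=; lia | by move=> b; exact: b1.1 |].
rewrite Hpl1 [ev st1 _]/= V1 //.
set st2 := set_arr _ _ _ _.
have V2 st' : (forall y, y != vt -> var st' y = var st2 y) -> (forall y, y != vt -> var st' y = var st y).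
  by move=> h y hy; rewrite h // V1.
apply: wp_seq.
apply: (wp_conseq (fill_spec (o := p + 1) (l := t) (f := X) _ _ _ _ _ _ _ _ _ _ _)) => //; try lia.
- rewrite /=; lia.
- by move=> st' h _ /=; have [-> _ _ _] := H st' (ext1 _ (V2 _ h)); have [-> _ _ _] := H st2 (ext1 _ V1).
- by rewrite /=; have [-> _ _ _] := H st2 (ext1 _ V1).
- by move=> st' h _; have [_ -> _ _] := H st' (ext1 _ (V2 _ h)); have [_ -> _ _] := H st2 (ext1 _ V1).
- by have [_ -> _ _] := H st2 (ext1 _ V1).
- by move=> st' h; have [_ _ _ ->] := H st' (ext1 _ (V2 _ h)).
- by rewrite /=; lia.
move=> T3 st3 b3 fr3 [k3 /= k4].
have V3 y : y != vt -> var st3 y = var st y.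
  by move=> hy; rewrite fr3.1 ?V1 // /fill /= !inE (negPf hy).
have [Hpl3 Htl3 _ _] := H st3 (ext1 _ V3).
apply: wp_seq; wgo @wp_assign; [exact: f7 | by rewrite /=; lia | by move=> _ /=; rewrite Hpl3 Htl3; lia |].
rewrite [ev st3 _]/= Hpl3 Htl3.
apply: (wp_conseq (zalg_spec M_gt powM azY _)); first by rewrite /=; lia.
move=> T4 st4 b4 _ /= [z1 z2 z3]; split; last by lia.
have Y1 i : i < p -> arr st3 aY i = arr st aW (P i).
  move=> ip; rewrite k3 ifF /=; last by lia.
  by rewrite (_ : (i == p) = false) ?k1 ?add0n /= ?ip ?subn0 //; apply: ltn_eqF.
have Y2 : arr st3 aY p = var st vsig.
  by rewrite k3 ifF /= ?eqxx //; lia.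
have Y3 i : i < t -> arr st3 aY (p + 1 + i) = arr st aW (X i).
  move=> it; rewrite k3 ifT; last by lia.
  by rewrite addKn /= A1.
have Xs i : i < t -> arr st aW (X i) < var st vsig by apply: hX.
move=> j; rewrite leq_eqVlt => /predU1P[->|jt].
  by rewrite z2; split=> //; rewrite ?addn0; lia.
by apply: (isZ_lcp Y1 Y2 Y3 Xs); apply: z1; lia.
Qed.

End Fill.

(** * Painting the powers across one boundary *)

Definition probe :=
  ve ::= Read aZf ((vb -@ va) +@ #1 +@ (vyy -@ vlo)) ;;
  vA ::= Read aZb ((va -@ vlo) +@ #1 +@ (vb -@ vyy)) ;;
  If (((vk -@ #1) *@ vm) <=@ (vA +@ ve))
     (vi ::= vpv -@ vA ;; vr0 ::= vpv +@ ve -@ ((vk -@ #1) *@ vm) ;; paint) Skip.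

(** The boundary [a] lies either in the first [k - 1] periods of a power, in range of the first
    probe, or in the last one; then [a - m] lies in the period before it, in range of the second
    probe. *)
Definition cross_period :=
  If ((va +@ vm) <=@ vb) (vyy ::= va +@ vm ;; vpv ::= va ;; probe) Skip ;;
  If ((vlo +@ vm) <=@ va) (vyy ::= va -@ vm ;; vpv ::= vyy ;; probe) Skip.

Definition cross_loop :=
  vm ::= vs +@ #1 ;; While (vm <=@ vmm) (cross_period ;; vm ::= vm +@ #1).

(** Since [a0 <= i + m] and [m <= vmm], every power sought starts at or after [vlo]; so the window
    is at most twice as long as the two factors. *)
Definition cross :=
  vmm ::= (vb -@ va0) /@ (vk -@ #1) ;; vlo ::= va0 -@ vmm ;;
  zbuild (vb -@ va) (va +@ vt) (vb -@ vlo) (vlo +@ vt) aZf ;;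
  zbuild (va -@ vlo) (va -@ #1 -@ vt) (vb -@ vlo) (vb -@ #1 -@ vt) aZb ;;
  cross_loop.

Record cross_ctx (W : nat -> nat) (n k lo a b bb : nat) (st : state) : Prop := CrossCtx {
  cc_k : var st vk = k;
  cc_lo : var st vlo = lo;
  cc_a : var st va = a;
  cc_b : var st vb = b;
  cc_alive : alive_set bb n st;
  cc_zf : forall j, j <= b - lo -> is_lcp (b - a) (b - lo) (fun t => W (a + t))
    (fun t => W (lo + t)) j (arr st aZf (b - a + 1 + j));
  cc_zb : forall j, j <= b - lo -> is_lcp (a - lo) (b - lo) (fun t => W (a - 1 - t))
    (fun t => W (b - 1 - t)) j (arr st aZb (a - lo + 1 + j)) }.

Lemma same_ds_trans st1 st2 st3 : same_ds st1 st2 -> same_ds st2 st3 -> same_ds st1 st3.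
Proof.
move=> [e1 f1] [e2 f2]; split=> [|a ha i]; first by rewrite e2.
by rewrite f2 // f1.
Qed.

Section CrossBoundary.
Variables (B M : nat).
Hypotheses (M_gt : 64 <= M) (powM : M ^ 16 <= B).
Let M1 : 1 < M. Proof. exact: leq_trans M_gt. Qed.

Section Cross.

Variables (W : nat -> nat) (n k lo a b bb : nat).
Hypotheses (k1 : 1 < k) (loa : lo <= a) (ab : a <= b) (bn : b <= n) (nM : n + n + 4 <= M).

Local Notation ctx := (cross_ctx W n k lo a b bb).
Local Notation cand st := (arr st aCand).
Local Notation pot := (paint_pot bb n).

(** The set [S] of painted starts is left abstract: all of them start powers, but completeness is
    claimed only for powers suitably placed around [p]. *)
Lemma probe_spec T st m p y : ctx st -> var st vm = m -> 0 < m -> var st vpv = p ->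
  var st vyy = y -> lo <= p -> p + m <= b -> (p = a /\ y = p + m) \/ (y = p /\ a = p + m) ->
  pot st + 300 <= T ->
  wp B M T st probe (fun T' st' => alive_set bb n st' /\ exists S : nat -> bool,
    [/\ forall i, S i -> pw W n k i m /\ i + k * m <= b,
        forall i, lo <= i -> i + k * m <= b -> pw W n k i m -> i <= p <= i + (k - 1) * m -> S i,
        forall i, cand st' i = if (cand st i == 0) && S i then m else cand st i &
        T + pot st' <= T' + pot st + 300]).
Proof.
move=> [hk hlo ha hb A zf zb] hm m0 hp hy lop pmb hc hT; rewrite /probe.
have k0 : 0 < k by apply: ltnW.
have ylo : y - lo <= b - lo by lia.
have yb : b - y <= b - lo by lia.
have lab : lo <= a <= b by rewrite loa.
have E := lcp_ext lop pmb lab m0 hc (zf _ ylo) (zb _ yb).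
apply: wp_bounded => bd.
apply: wp_seq; wasg; first exact: bd.2.
rewrite ha hb hlo hy; apply: wp_seq; wasg; first exact: bd.2.
rewrite ha hb hlo hy.
set e := arr st aZf _ in E *; set A' := arr st aZb _ in E *.
have [x1 x2 _ _ _] := E.
wif; rewrite hk hm => hif.
  apply: wp_seq; wasg; first by rewrite hp; lia.
  rewrite hp; apply: wp_seq; wasg; first by rewrite hp; lia.
  rewrite hp hk hm.
  apply: (wp_conseq (paint_spec M_gt powM (b := bb) (n := n) (l := p - A') (r := p + e - (k - 1) * m) (m := m) _ _ _ _ _ _ _ _ _)) => //; try lia.
  - exact: alive_set_ext A.
  - by rewrite (paint_pot_ext bb n (_ : same_ds st _)) //; lia.
  move=> T1 st1 b1 fr [A1 C1 t1]; split=> //.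
  exists (fun i => p - A' <= i <= p + e - (k - 1) * m); split.
  - by move=> i hi; apply: (ext_sound k0 bn E).
  - by move=> i li ib hpw hi; have [_] := ext_complete k0 lop E hpw li ib hi.
  - by [].
  - by rewrite (paint_pot_ext bb n (_ : same_ds st (set_var _ _ _))) // in t1; lia.
apply: wp_skip; first by lia.
split; first exact: alive_set_ext A.
exists (fun=> false); split=> //.
- by move=> i li ib hpw hi; have [h _] := ext_complete k0 lop E hpw li ib hi; lia.
- by move=> i; rewrite andbF.
- by rewrite (paint_pot_ext bb n (_ : same_ds st (set_var _ _ _))) //; lia.
Qed.

Lemma ctx_frame c st st' : ctx st -> frame c st st' -> alive_set bb n st' ->
  ~~ has (mem [:: vk; vlo; va; vb]) (written_vars c) ->
  ~~ has (mem [:: aZf; aZb]) (written_arrs c) -> ctx st'.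
Proof.
move=> [h1 h2 h3 h4 h5 h6 h7] [fv fa] A hv ha.
have v' x : x \in [:: vk; vlo; va; vb] -> var st' x = var st x.
  by move=> hx; apply: fv; apply: contra hv => h; apply/hasP; exists x.
have a' x : x \in [:: aZf; aZb] -> arr st' x =1 arr st x.
  by move=> hx; apply: fa; apply: contra ha => h; apply/hasP; exists x.
split=> //; rewrite ?v' //.
- by move=> j hj; rewrite a' //; apply: h6.
- by move=> j hj; rewrite a' //; apply: h7.
Qed.

Lemma ctx_set_var st x v : ctx st -> x \notin [:: vk; vlo; va; vb; vbb] -> ctx (set_var st x v).
Proof.
move=> C; rewrite !inE !negb_or => /and5P[n1 n2 n3 n4 n5].
apply: (ctx_frame (c := Assign x #0) C).
- split=> //= y; rewrite inE => /negPf -> //.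
- apply: alive_set_ext (cc_alive C); split=> //=.
  by rewrite eq_sym (negPf n5).
- by rewrite /= orbF !inE !negb_or n1 n2 n3 n4.
- by [].
Qed.

Lemma cross_period_spec T st m : ctx st -> var st vm = m -> 0 < m -> m <= n ->
  pot st + 800 <= T ->
  wp B M T st cross_period (fun T' st' => alive_set bb n st' /\ exists S : nat -> bool,
    [/\ forall i, S i -> pw W n k i m /\ i + k * m <= b,
        forall i, lo <= i -> pw W n k i m -> i < a < i + k * m -> i + k * m <= b -> S i,
        forall i, cand st' i = if (cand st i == 0) && S i then m else cand st i &
        T + pot st' <= T' + pot st + 800]).
Proof.
move=> C hm m0 mn hT; rewrite /cross_period.
have [hk hlo ha hb A _ _] := C; have k0 : 0 < k by apply: ltnW.
pose Q1 T1 st1 := ctx st1 /\ var st1 vm = m /\ exists S1 : nat -> bool,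
  [/\ forall i, S1 i -> pw W n k i m /\ i + k * m <= b,
      forall i, lo <= i -> i + k * m <= b -> pw W n k i m -> i <= a -> a < i + (k - 1) * m -> S1 i,
      forall i, cand st1 i = if (cand st i == 0) && S1 i then m else cand st i &
      T + pot st1 <= T1 + pot st + 350].
apply: wp_seq; apply: (wp_conseq (Q := Q1)).
  wif; rewrite ha hm hb => hg.
    apply: wp_seq; wasg; first by rewrite ha; lia.
    rewrite ha hm; apply: wp_seq; wasg; first by rewrite ha; lia.
    rewrite ha; set st1 := set_var _ _ _.
    have C1 : ctx st1 by do 2 apply: ctx_set_var => //.
    have p1 : pot st1 = pot st by apply: paint_pot_ext.
    apply: (wp_conseq (probe_spec (p := a) C1 hm m0 erefl (erefl (a + m)) loa hg (or_introl (conj erefl erefl)) _)).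
      by rewrite p1; lia.
    move=> T2 st2 b2 fr [A2 [S [s1 s2 s3 s4]]]; split; first exact: (ctx_frame C1 fr A2).
    split; first by rewrite fr.1.
    exists S; split=> //.
    - by move=> i li ib hp ia hi; apply: s2 => //; rewrite ia ltnW.
    - by rewrite p1 in s4; lia.
  apply: wp_skip; first by lia.
  split=> //; split=> //; exists (fun=> false); split=> //.
  (* The first probe is skipped when [a + m] exceeds [b]; a power with [a] in its first [k - 1]
     periods would then end after [b]. *)
  - by move=> i li ib _ ia hi; move: ib; rewrite (mulk1 m k0) => ib; lia.
  - by move=> i; rewrite andbF.
  - by lia.
move=> T1 st1 b1 fr1 [C1 [hm1 [S1 [s1 s2 s3 s4]]]].
have [hk1 hlo1 ha1 hb1 A1 _ _] := C1.
wif; rewrite ha1 hm1 hlo1 => hg.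
  have lp : lo <= a - m by lia.
  have pb : a - m + m <= b by lia.
  have pa : a = a - m + m by lia.
  apply: wp_seq; wasg; first by rewrite ha1; lia.
  rewrite ha1 hm1; apply: wp_seq; wasg; first by lia.
  set st2 := set_var _ _ _.
  have C2 : ctx st2 by do 2 apply: ctx_set_var => //.
  have p2 : pot st2 = pot st1 by apply: paint_pot_ext.
  apply: (wp_conseq (probe_spec (p := a - m) (y := a - m) C2 hm1 m0 erefl erefl lp pb (or_intror (conj erefl pa)) _)).
    by rewrite p2; lia.
  move=> T3 st3 b3 fr [A3 [S [r1 r2 r3 r4]]]; split=> //.
  exists (fun i => S1 i || S i); split.
  - by move=> i /orP[/s1|/r1].
  - move=> i li hp hi ib; case: (ltnP a (i + (k - 1) * m)) => h.
      by rewrite s2 //; lia.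
    rewrite orbC r2 //; move: hi; rewrite (mulk1 m k0) => hi.
    have : m <= (k - 1) * m by rewrite leq_pmull // subn_gt0.
    by lia.
  - move=> i; rewrite r3 /= s3; case: (boolP (cand st i == 0)) => e /=.
      by case: (S1 i) => /=; rewrite ?(gtn_eqF m0) ?e.
    by rewrite (negPf e).
  - by rewrite p2 in r4; lia.
apply: wp_skip; first by lia.
split=> //; exists S1; split=> //.
- move=> i li hp hi ib; apply: s2 => //; first by lia.
  rewrite ltnNge; apply/negP => h.
  have : m <= (k - 1) * m by rewrite leq_pmull // subn_gt0.
  by lia.
- by lia.
Qed.

Lemma cross_loop_spec T st s mm : ctx st -> var st vs = s -> var st vmm = mm -> s < M -> mm <= n ->
  pot st + 850 * mm + 100 <= T ->
  wp B M T st cross_loop (fun T' st' =>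
    [/\ alive_set bb n st', forall i, cand st i != 0 -> cand st' i = cand st i,
        forall i, cand st i = 0 -> cand st' i != 0 ->
          [/\ s < cand st' i, pw W n k i (cand st' i) & i + k * cand st' i <= b],
        forall i m, s < m <= mm -> lo <= i -> pw W n k i m -> i < a < i + k * m -> i + k * m <= b ->
          cand st' i != 0 /\ (cand st i = 0 -> cand st' i <= m) &
        T + pot st' <= T' + pot st + 850 * mm + 100]).
Proof.
move=> C hs hmm sM mn hT; rewrite /cross_loop.
apply: wp_seq; wasg; first by rewrite hs; lia.
rewrite hs; set st0 := set_var _ _ _.
have C0 : ctx st0 by apply: ctx_set_var.
have p0 : pot st0 = pot st by apply: paint_pot_ext.
wwh (fun T1 st1 => [/\ ctx st1, s < var st1 vm,
  (forall i, cand st i != 0 -> cand st1 i = cand st i) /\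
  (forall i, cand st i = 0 -> cand st1 i != 0 ->
      [/\ s < cand st1 i < var st1 vm, pw W n k i (cand st1 i) & i + k * cand st1 i <= b]),
  forall i m, s < m < var st1 vm -> m <= mm -> lo <= i -> pw W n k i m -> i < a < i + k * m -> i + k * m <= b ->
          cand st1 i != 0 /\ (cand st i = 0 -> cand st1 i <= m) &
  [/\ var st1 vm <= maxn s.+1 mm.+1, pot st1 + 850 * (mm.+1 - var st1 vm) + 10 <= T1 &
      T + pot st1 <= T1 + pot st + 850 * (var st1 vm - s.+1) + 10]]).
  rewrite p0 /= addn1; split=> //; [split=> // i -> //= | by move=> i m; lia |].
  by split; [exact: leq_maxl | lia | lia].
move=> T1 st1 b1 fr [C1 g1 [g2 g3] g4 [g5 g6 g7]].
have E1 : var st1 vmm = mm by rewrite fr.1.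
split=> /=; rewrite ?b2n0 ?E1; first by lia.
  move=> hm; set m := var st1 vm in g1 g3 g4 g5 g6 g7 hm *.
  apply: wp_seq; apply: (wp_conseq (cross_period_spec (m := m) C1 erefl _ _ _)); try lia.
  move=> T2 st2 b2 fr2 [A2 [S [s1 s2 s3 s4]]].
  have C2 : ctx st2 by apply: (ctx_frame C1 fr2 A2).
  have E2 : var st2 vm = m by rewrite fr2.1.
  wasg; first by rewrite E2; lia.
  set st3 := set_var _ _ _.
  have C3 : ctx st3 by apply: ctx_set_var.
  have p3 : pot st3 = pot st2 by apply: paint_pot_ext.
  rewrite E2 addn1 p3; split=> //; try lia.
  - split=> i ci; first by rewrite /= s3 g2 // (negPf ci).
    rewrite /= s3; case: (boolP (cand st1 i == 0)) => c1 /=.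
      case: (boolP (S i)) => Si; last by rewrite (eqP c1).
      by move=> _; have [q1 q2] := s1 _ Si; split=> //; lia.
    by move=> c2; have [q1 q2 q3] := g3 i ci c1; split=> //; lia.
  - move=> i m' hm' mm' li hp hi ib; case: (ltnP m' m) => h.
      have [//|q1 q2] := g4 i m' _ mm' li hp hi ib; first by lia.
      by rewrite /= s3 (negPf q1) /=; split.
    have em : m' = m by lia.
    rewrite em in hp hi ib *; have Si := s2 i li hp hi ib.
    rewrite /= s3 Si andbT; case: (boolP (cand st1 i == 0)) => c1; first by split=> //; lia.
    by split=> // ci; have [q1 q2 q3] := g3 i ci c1; lia.
  - by split; lia.
move=> hm; have lm : mm < var st1 vm by lia.
split=> //; first exact: cc_alive C1.
- by move=> i ci c1; have [q1 q2 q3] := g3 i ci c1; split=> //; lia.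
- by move=> i m hm'; apply: g4; lia.
- by lia.
Qed.

End Cross.

Lemma cross_spec T st (W : nat -> nat) n k s a0 a b bb sig :
  arr st aW =1 W -> (forall i, i < n -> W i < sig) -> var st vsig = sig ->
  1 < k -> var st vk = k -> var st vs = s -> s < M -> n + n + n + n + 8 <= M ->
  var st va0 = a0 -> var st va = a -> var st vb = b -> a0 < a < b -> b <= n ->
  alive_set bb n st ->
  paint_pot bb n st + 3300 * (b - a0) + 2000 <= T ->
  wp B M T st cross (fun T' st' =>
    [/\ alive_set bb n st', forall i, arr st aCand i != 0 -> arr st' aCand i = arr st aCand i,
        forall i, arr st aCand i = 0 -> arr st' aCand i != 0 ->
          [/\ s < arr st' aCand i, pw W n k i (arr st' aCand i) & i + k * arr st' aCand i <= b],
        forall i m, s < m -> a0 <= i + m -> pw W n k i m -> i < a < i + k * m -> i + k * m <= b ->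
          arr st' aCand i != 0 /\ (arr st aCand i = 0 -> arr st' aCand i <= m) &
        T + paint_pot bb n st' <= T' + paint_pot bb n st + 3300 * (b - a0) + 2000]).
Proof.
move=> hW Ws hsig k1 hk hs sM nM ha0 ha hb /andP[a0a ab] bn A hT; rewrite /cross.
apply: wp_seq; wasg.
  by rewrite hb ha0; apply: leq_trans (leq_div _ _) _; lia.
rewrite hb ha0 hk; set mm := _ %/ _.
have mmL : mm <= b - a0 by apply: leq_div.
apply: wp_seq; wasg; first by rewrite ha0; lia.
rewrite ha0; set lo := a0 - mm.
set st1 := set_var _ _ _.
have lob : b - lo <= 2 * (b - a0) by lia.
have loa : lo <= a by lia.
apply: wp_seq.
apply: (wp_conseq (zbuild_spec M_gt powM (p := b - a) (t := b - lo) (P := fun t => a + t) (X := fun t => lo + t) _ _ _ _ _ _ _ _ _ _ _ _ _ _ _)) => //; try fit.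
- by move=> st' h; rewrite /= (h va) // (h vb) // (h vlo) // /st1 /= ha hb.
- by move=> j hj; rewrite /= hW hsig; apply: Ws; lia.
- by move=> j hj; rewrite /= hW hsig; apply: Ws; lia.
- by lia.
- by lia.
move=> T2 st2 b2 fr2 [zf t2].
have V2 : [/\ var st2 va = a, var st2 vb = b, var st2 vlo = lo & var st2 vsig = sig].
  by split; rewrite fr2.1.
have [ha2 hb2 hlo2 hsig2] := V2.
apply: wp_seq.
apply: (wp_conseq (zbuild_spec M_gt powM (p := a - lo) (t := b - lo) (P := fun t => a - 1 - t) (X := fun t => b - 1 - t) _ _ _ _ _ _ _ _ _ _ _ _ _ _ _)) => //; try fit.
- by move=> st' h; rewrite /= (h va) // (h vb) // (h vlo) // ha2 hb2 hlo2.
- by move=> j hj; rewrite fr2.2 //= hW hsig2; apply: Ws; lia.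
- by move=> j hj; rewrite fr2.2 //= hW hsig2; apply: Ws; lia.
- by lia.
- by lia.
move=> T3 st3 b3 fr3 [zb t3].
have D : same_ds st st3.
  apply: (same_ds_trans (_ : same_ds st st1)) => //.
  by apply: same_ds_trans (frame_same_ds fr2 _ _) (frame_same_ds fr3 _ _).
have p3 := paint_pot_ext bb n D.
have C3 : cross_ctx W n k lo a b bb st3.
  split; rewrite ?fr3.1 //.
  - by rewrite fr2.1.
  - exact: alive_set_ext D A.
  - move=> j hj; rewrite fr3.2 //; have [z1 z2 z3 z4] := zf j hj.
    by split=> // [t ht|h1 h2]; rewrite -!hW; [apply: z3 | apply: z4].
  - move=> j hj; have [z1 z2 z3 z4] := zb j hj.
    have E x : W x = arr st2 aW x by rewrite fr2.2 // -hW.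
    by split=> // [t ht|h1 h2]; rewrite !E; [apply: z3 | apply: z4].
have hs3 : var st3 vs = s by rewrite fr3.1 // fr2.1.
have hm3 : var st3 vmm = mm by rewrite fr3.1 // fr2.1.
have EC i : arr st3 aCand i = arr st aCand i by apply: D.2.
apply: (wp_conseq (cross_loop_spec k1 loa (ltnW ab) bn _ C3 hs3 hm3 sM _ _)); try lia.
move=> T4 st4 b4 fr4 [A4 c1 c2 c3 t4]; split=> //.
- by move=> i; rewrite -EC; apply: c1.
- by move=> i; rewrite -EC; apply: c2.
- move=> i m sm him hp hi ib; rewrite -EC; apply: c3 => //.
    rewrite sm /= leq_divRL; last by rewrite subn_gt0.
    by move: ib; rewrite (mulk1 m (ltnW k1)) mulnC; lia.
  rewrite /lo; suff : m <= mm by lia.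
  rewrite leq_divRL; last by rewrite subn_gt0.
  by move: ib; rewrite (mulk1 m (ltnW k1)) mulnC; lia.
- by rewrite p3 in t4; lia.
Qed.

End CrossBoundary.

(** * The pass over all boundaries and the copying pass *)

Definition cross_all :=
  va0 ::= #0 ;; va ::= Read aNB #0 ;;
  While (va <@ vn) (vb ::= Read aNB va ;; cross ;; va0 ::= va ;; va ::= vb).

(** Both registers start at 0, so the first iteration already loads a factor end. [vy] is the
    distance to the earlier occurrence; a stored 0 means no period and must not be copied as one. *)
Definition copy_pass :=
  vi ::= #0 ;; vfb ::= #0 ;;
  While (vi <@ vn)
    (If (vi ==@ vfb) (vfb ::= Read aNB vi) Skip ;;
     vy ::= vfb -@ Read aSrc vfb ;; vm ::= Read aOut (vi -@ vy) ;;
     If ((#0 <@ Read aG vfb) *@ (#0 <@ vm) *@ (((vi -@ vy) +@ (vk *@ vm)) <=@ (vfb -@ vy)))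
        (Write aOut vi vm) (Write aOut vi (Read aCand vi)) ;;
     vi ::= vi +@ #1).

(** The value 0 stands for the absence of a period, as in [code]. *)
Definition min_period W n k s i v :=
  if v == 0 then forall m, s < m -> ~ pw W n k i m
  else [/\ s < v, pw W n k i v & forall m, s < m -> pw W n k i m -> v <= m].

Section Copy.

Variables (W : nat -> nat) (n k s : nat) (a b g e i : nat) (cand out : nat -> nat).
Hypotheses (k1 : 1 < k) (hg : longest_prev W b g e) (hab : a + maxn 1 g = b) (bn : b <= n).
Hypothesis (hi : a <= i < b).
Hypothesis sound : forall i, cand i != 0 -> s < cand i /\ pw W n k i (cand i).
Hypothesis complete : forall m, s < m -> pw W n k i m -> b < i + k * m ->
  cand i != 0 /\ cand i <= m.
Hypothesis prev : forall j, j < i -> min_period W n k s j (out j).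

Let d := b - e.

Lemma copy_shift : 0 < g -> d <= i /\ forall x, a <= x < b -> W x = W (x - d).
Proof.
case: hg => eb ge _ g0; have hab' := hab; rewrite (maxn_idPr g0) in hab'.
have ele : g <= e by apply: leq_trans ge _; rewrite lcsC; apply: lcs_le.
split=> [|x hx]; first by rewrite /d; lia.
have := @lcs_eq W b e (b - x.+1) _; rewrite (_ : b - (b - x.+1).+1 = x); last by lia.
rewrite (_ : e - (b - x.+1).+1 = x - d); last by rewrite /d; lia.
by apply; lia.
Qed.

Lemma copy_pw m : 0 < g -> i + k * m <= b -> pw W n k i m <-> pw W n k (i - d) m.
Proof.
move=> g0 le; have [di sh] := copy_shift g0.
have k0 : 0 < k by apply: ltnW.
have le' := le; rewrite (mulk1 m k0) in le'.
split=> -[h1 h2]; split; try lia.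
  move=> x hx; have := h2 (x + d); rewrite (sh (x + d)); last by lia.
  rewrite (sh (x + d + m)); last by lia.
  rewrite addnK (_ : x + d + m - d = x + m); last by lia.
  by apply; lia.
move=> x hx; rewrite (sh x); last by lia.
rewrite (sh (x + m)); last by lia.
rewrite (_ : x + m - d = x - d + m); last by lia.
by apply: h2; lia.
Qed.

(** If the power of least period at the earlier position fits into the factor, so does that of any
    smaller period at [i], and the copied value is least. If it does not fit, no power at [i] stays
    inside the factor, and the painted colour decides. *)
Lemma copy_min_period : min_period W n k s i
  (if [&& 0 < g, 0 < out (i - d) & i - d + k * out (i - d) <= b - d]
   then out (i - d) else cand i).
Proof.
have k0 : 0 < k by apply: ltnW.
case: hg => eb ge _.
have d0 : 0 < d by rewrite /d; lia.
case: ifP => [/and3P[g0 v0 le]|hF].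
  have [di sh] := copy_shift g0.
  have := prev (j := i - d); set v := out _ in v0 le *; rewrite /min_period gtn_eqF //.
  case; first by lia.
  move=> sv pv mv.
  have le' : i + k * v <= b by lia.
  split=> //; first exact/(copy_pw g0 le').
  move=> m sm pm; case: (leqP (i + k * m) b) => h; first by apply: mv => //; apply/(copy_pw g0 h).
  by rewrite -(leq_pmul2l k0); lia.
have far m : s < m -> pw W n k i m -> b < i + k * m.
  move=> sm pm; rewrite ltnNge; apply/negP => le.
  case: (posnP g) hF => [g0 _|g0 hF].
    (* A new letter is a factor of length 1, too short for a power. *)
    have km : 1 < k * m by apply: leq_trans k1 _; rewrite leq_pmulr //; lia.
    by move: hab; rewrite g0; lia.
  have [di sh] := copy_shift g0.
  have pm' : pw W n k (i - d) m by apply/(copy_pw g0 le).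
  have idi : i - d < i by lia.
  have := prev idi; set v := out _; rewrite /min_period.
  case: (posnP v) => [_ /(_ m sm) //|v0].
  move=> [_ _ mv].
  have km : k * v <= k * m by rewrite leq_mul2l mv ?orbT.
  by move: hF; rewrite -/v v0 /=; lia.
rewrite /min_period; case: eqP => [c0|/eqP c0].
  by move=> m sm pm; have [] := complete sm pm (far _ sm pm); rewrite c0.
have [h1 h2] := sound c0; split=> // m sm pm.
by have [] := complete sm pm (far _ sm pm).
Qed.

End Copy.

Section Passes.
Variables (B M : nat).
Hypotheses (M_gt : 64 <= M) (powM : M ^ 16 <= B).
Let M1 : 1 < M. Proof. exact: leq_trans M_gt. Qed.

Lemma cross_all_spec T st (W : nat -> nat) n k s bb sig :
  arr st aW =1 W -> (forall i, i < n -> W i < sig) -> var st vsig = sig ->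
  1 < k -> var st vk = k -> var st vs = s -> s < M -> n + n + n + n + 8 <= M -> var st vn = n ->
  is_parse n (arr st aG) (arr st aNB) ->
  (forall x, 0 < x <= n -> longest_prev W x (arr st aG x) (arr st aSrc x)) ->
  alive_set bb n st -> (forall i, arr st aCand i = 0) ->
  paint_pot bb n st + 2 * (4400 * n) + 100 <= T ->
  wp B M T st cross_all (fun T' st' =>
    [/\ forall i, arr st' aCand i != 0 -> s < arr st' aCand i /\ pw W n k i (arr st' aCand i),
        forall i m c, s < m -> pw W n k i m -> arr st aNB c != 0 -> i < c < i + k * m ->
          arr st' aCand i != 0 /\ arr st' aCand i <= m &
        T <= T' + paint_pot bb n st + 2 * (4400 * n) + 100]).
Proof.
move=> hW Ws hsig k1 hk hs sM nM hn [ps1 ps2 ps3 ps4 ps5] lp A c0 hT; rewrite /cross_all.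
have k0 : 0 < k by apply: ltnW.
set NB := arr st aNB in ps1 ps2 ps3 ps4 ps5 *.
apply: wp_bounded => bd.
apply: wp_seq; wasg; first by [].
apply: wp_seq; wasg; first exact: bd.2.
rewrite -/NB.
wwh (fun T1 st1 => exists a0 a, [/\ var st1 va0 = a0, var st1 va = a, a0 <= a <= n,
    (0 < n -> a0 < a /\ NB a0 = a) & [/\ alive_set bb n st1,
  forall i, arr st1 aCand i != 0 -> [/\ s < arr st1 aCand i, pw W n k i (arr st1 aCand i) &
    i + k * arr st1 aCand i <= a],
  forall i m c, s < m -> pw W n k i m -> NB c != 0 -> i < c < i + k * m -> i + k * m <= a ->
          arr st1 aCand i != 0 /\ arr st1 aCand i <= m &
  paint_pot bb n st1 + 4400 * (2 * n - a0 - a) + 20 <= T1 /\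
  T + paint_pot bb n st1 <= T1 + paint_pot bb n st + 4400 * (a0 + a) + 20]]).
  set st0 := set_var _ _ _.
  have D : same_ds st st0 by [].
  exists 0, (NB 0); split=> //.
  - by case: (eqVneq (NB 0) 0) => [-> //|h]; case/andP: (ps1 _ h).
  - by move=> n0; have /ps1/andP[] := ps5 n0.
  split.
  - exact: alive_set_ext A.
  - by move=> i; rewrite /= c0.
  - move=> i m c _ _ nc hc le; have h : 0 < c < NB 0 by lia.
    case: (posnP n) => [n0|n0]; first by have := ps1 _ nc; lia.
    by rewrite (ps4 _ _ (ps5 n0) h) in nc.
  - by rewrite (paint_pot_ext bb n D); lia.
move=> T1 st1 b1 fr [a0 [a [ha0 ha an hNB [A1 g1 g2 [g3 g4]]]]].
have E1 : var st1 vn = n by rewrite fr.1.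
have EW : arr st1 aW =1 W by move=> i; rewrite fr.2 //= hW.
have Esig : var st1 vsig = sig by rewrite fr.1.
have Ek : var st1 vk = k by rewrite fr.1.
have Es : var st1 vs = s by rewrite fr.1.
have ENB : arr st1 aNB =1 NB by move=> i; rewrite fr.2.
split=> /=; rewrite ?b2n0 ?E1 ?ha; first by lia.
  move=> altn; have [a0a nba0] : a0 < a /\ NB a0 = a by apply: hNB; lia.
  have nba : NB a != 0.
    have [||//] := ps3 a0; first by rewrite nba0; lia.
      by rewrite nba0; lia.
    by rewrite nba0.
  have [ab bn] := andP (ps1 _ nba).
  apply: wp_seq; wasg; first exact: b1.2.
  rewrite ha ENB; set b := NB a in nba ab bn *; set st2 := set_var _ _ _.
  have D2 : same_ds st1 st2 by [].
  have p2 := paint_pot_ext bb n D2; have A2 := alive_set_ext D2 A1.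
  have lpa := lp a; have aa : 0 < a <= n by lia.
  apply: wp_seq; apply: (wp_conseq (cross_spec (W := W) (n := n) (k := k) (s := s) (a0 := a0) (a := a) (b := b) (bb := bb) (sig := sig) M_gt powM _ _ _ _ _ _ _ _ _ _ _ _ _ _ _)) => //.
  - by rewrite a0a.
  - by rewrite p2; lia.
  move=> T3 st3 b3 fr3 [A3 x1' x2 x3 x4].
  have x1 i : arr st1 aCand i != 0 -> arr st3 aCand i = arr st1 aCand i := x1' i.
  have F1 : var st3 va = a by rewrite fr3.1.
  have F2 : var st3 vb = b by rewrite fr3.1.
  apply: wp_seq; wasg; first by rewrite F1; lia.
  rewrite F1; wasg; first by rewrite F2; lia.
  rewrite F2; set st4 := set_var _ _ _.
  have D4 : same_ds st3 st4 by [].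
  have p4 := paint_pot_ext bb n D4; have A4 := alive_set_ext D4 A3.
  exists a, b; split=> //; first by rewrite (ltnW ab).
  split=> //.
  - move=> i; rewrite /= => h; case: (eqVneq (arr st1 aCand i) 0) => c1.
      by have [] := x2 i c1 h.
    by rewrite x1 //; have [q1 q2 q3] := g1 i c1; split=> //; lia.
  - move=> i m c sm hp nc hc le; rewrite /=.
    case: (leqP (i + k * m) a) => h.
      have [q1 q2] := g2 i m c sm hp nc hc h.
      by rewrite x1.
    (* No boundary lies strictly between [a] and [b], so a crossing power that ends in this factor
       starts before [a]. *)
    have ia : i < a.
      rewrite ltnNge; apply/negP => ai.
      have hc' : a < c < NB a by rewrite -/b; lia.
      by rewrite (ps4 _ _ nba hc') in nc.
    have hm : a0 <= i + m.
      apply: (crossing_bound k0 _ (lpa aa) _ hp); [by lia | | by rewrite ia].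
      by have := ps2 a0; rewrite nba0; apply; lia.
    have iab : i < a < i + k * m by rewrite ia.
    have [q1 q2] := x3 i m sm hm hp iab le; split=> //.
    case: (eqVneq (arr st1 aCand i) 0) => c1; first exact: q2.
    (* An older colour belongs to a power that ends by [a], so its period is the smaller one. *)
    rewrite x1 //; have [r1 r2 r3] := g1 i c1.
    by rewrite -(leq_pmul2l k0); lia.
  - rewrite p4 /=; rewrite p2 in x4; clear -x4 g3 g4 a0a ab bn an hT; lia.
move=> nlt; have e : a = n by lia.
rewrite e in g1 g2; split.
- by move=> i /g1[].
- by move=> i m c sm hp nc hc; apply: (g2 i m c) => //; case: hp.
- by lia.
Qed.

Lemma copy_pass_spec T st (W : nat -> nat) n k s :
  1 < k -> var st vk = k -> n + 2 <= M -> var st vn = n ->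
  is_parse n (arr st aG) (arr st aNB) ->
  (forall x, 0 < x <= n -> longest_prev W x (arr st aG x) (arr st aSrc x)) ->
  (forall i, arr st aCand i != 0 -> s < arr st aCand i /\ pw W n k i (arr st aCand i)) ->
  (forall i m c, s < m -> pw W n k i m -> arr st aNB c != 0 -> i < c < i + k * m ->
     arr st aCand i != 0 /\ arr st aCand i <= m) ->
  100 * n + 100 <= T ->
  wp B M T st copy_pass (fun T' st' => forall i, i < n -> min_period W n k s i (arr st' aOut i)).
Proof.
move=> k1 hk nM hn [ps1 ps2 ps3 ps4 ps5] lp snd cpl hT; rewrite /copy_pass.
set NB := arr st aNB in ps1 ps2 ps3 ps4 ps5 cpl *.
apply: wp_seq; wasg; first by [].
apply: wp_seq; wasg; first by [].
wwh (fun T' st' => [/\ var st' vi <= n,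
   (var st' vi = 0 /\ var st' vfb = 0) \/
     (exists a, [/\ NB a != 0, NB a = var st' vfb & a < var st' vi <= var st' vfb]),
   forall j, j < var st' vi -> min_period W n k s j (arr st' aOut j) &
   90 * (n - var st' vi) + 20 <= T']).
  by rewrite /=; split=> //; [left | lia].
move=> T1 st1 b1 fr [g1 g2 g3 g4].
have E1 : var st1 vn = n by rewrite fr.1.
have E2 : var st1 vk = k by rewrite fr.1.
have E3 : arr st1 aNB =1 NB by move=> j; rewrite fr.2.
have E4 : arr st1 aG =1 arr st aG by move=> j; rewrite fr.2.
have E5 : arr st1 aSrc =1 arr st aSrc by move=> j; rewrite fr.2.
have E6 : arr st1 aCand =1 arr st aCand by move=> j; rewrite fr.2.
split=> /=; rewrite ?b2n0 ?E1; first by lia.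
  set i := var st1 vi in g1 g2 g3 g4 * => hi.
  pose Q2 T2 st2 := [/\ T1 <= T2 + 15, var st2 vi = i, exists a, [/\ NB a != 0, NB a = var st2 vfb & a <= i < var st2 vfb]
    & frame (vfb ::= #0) st1 st2].
  apply: wp_seq; apply: (wp_conseq (Q := Q2)).
    wif; rewrite -/i.
      move/eqP=> e; wasg; first exact: b1.2.
      have nbi : NB i != 0.
        case: g2 => [[i0 _]|[a [na ea ia]]]; first by rewrite i0; apply: ps5; lia.
        by have [] := ps3 a na; rewrite ea -e //; lia.
      split=> //=; first by lia.
        exists i; rewrite E3; split=> //.
        by have /andP[h _] := ps1 _ nbi; rewrite leqnn.
      by split=> // y; rewrite inE /= => /negPf ->.
    move=> ne; apply: wp_skip; first by lia.
    split=> //; first by lia.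
    case: g2 => [[i0 f0]|[a [na ea ia]]].
      by move: ne; rewrite -/i i0 f0.
    exists a; split=> //; have : i <> var st1 vfb by move=> e; rewrite e eqxx in ne.
    by lia.
  move=> T2 st2 b2 _ [t2 hi2 [a [na ea ai]] fr2].
  set b := var st2 vfb in ea ai *.
  have [ab bn] := andP (ps1 _ na); rewrite ea in ab bn.
  have b0 : 0 < b <= n by lia.
  have G := lp b b0.
  have F1 : var st2 vk = k by rewrite fr2.1.
  have F2 x : arr st2 x =1 arr st1 x by apply: fr2.2.
  have FG : arr st2 aG b = arr st aG b by rewrite F2 E4.
  have FS : arr st2 aSrc b = arr st aSrc b by rewrite F2 E5.
  apply: wp_seq; wasg; first by apply: leq_trans (leq_subr _ _) _; exact: b2.1.
  rewrite -/b FS; apply: wp_seq; wasg; first exact: b2.2.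
  rewrite hi2 F2; set d := b - _; set v := arr st1 aOut _.
  have hab : a + maxn 1 (arr st aG b) = b by have := ps2 a na; rewrite ea.
  have cpl' m : s < m -> pw W n k i m -> b < i + k * m ->
      arr st aCand i != 0 /\ arr st aCand i <= m.
    move=> sm hp hb; apply: (cpl i m b sm hp); last by lia.
    (* After the last factor there is no boundary, but [b = n] and no power ends beyond [n]. *)
    have [e|] := ps3 a na; last by rewrite ea.
    by rewrite ea in e; case: hp => hp _; lia.
  have main := copy_min_period k1 G hab bn ai snd cpl' g3.
  apply: wp_seq; apply: (wp_conseq (Q := fun T3 st3 => [/\ T2 <= T3 + 55,
     var st3 vi = i, var st3 vfb = b & forall j, arr st3 aOut j = if j == i then
      (if [&& 0 < arr st aG b, 0 < v & i - d + k * v <= b - d] then v else arr st aCand i)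
      else arr st1 aOut j])).
    wif; rewrite -/b hi2 FG F1.
      move=> hc; wwr; first exact: b1.2.
      rewrite hi2; split=> //=; first by lia.
      move=> j; rewrite F2; case: eqP => // _; rewrite ifT //.
      by move: hc; case: (0 < arr st aG b); case: (0 < v); case: (_ <= _).
    move=> hc; wwr; first exact: b2.2.
    rewrite hi2 F2 E6; split=> //=; first by lia.
    move=> j; rewrite F2; case: eqP => // _; rewrite ifF //.
    by move: hc; case: (0 < arr st aG b); case: (0 < v); case: (_ <= _).
  move=> T3 st3 b3 _ [t3 h1 h2 h3].
  wasg; first by rewrite h1; lia.
  rewrite h1 h2 addn1; split=> //; last by lia.
    right; exists a; split=> //; lia.
  move=> j; rewrite ltnS leq_eqVlt => /predU1P[->|ji].
    by rewrite h3 eqxx; exact: main.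
  by rewrite h3 (ltn_eqF ji); apply: g3.
move=> hi j jn; apply: g3; lia.
Qed.

End Passes.

(** * From powers of words to shifts of letter codes *)

Lemma size_wpow (T : Type) (x : seq T) k : size (wpow x k) = k * size x.
Proof. by elim: k => //= k IH; rewrite /wpow /= size_cat -/(wpow x k) IH mulSn. Qed.

Lemma nth_wpow (T : Type) (x0 : T) (x : seq T) k j : j < k * size x ->
  nth x0 (wpow x k) j = nth x0 x (j %% size x).
Proof.
elim: k j => //= k IH j; rewrite /wpow /= nth_cat -/(wpow x k) => h.
case: ltnP => hj; first by rewrite modn_small.
rewrite IH; last by rewrite mulSn in h; lia.
by rewrite -{2}(subnK hj) modnDr.
Qed.

Lemma power_prefixP (T : eqType) (x0 : T) k m (u : seq T) : 0 < k -> 0 < m ->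
  power_prefix k u m <-> k * m <= size u /\
    forall x, x < (k - 1) * m -> nth x0 u x = nth x0 u (x + m).
Proof.
move=> k0 m0; rewrite /power_prefix; case: (leqP (k * m) (size u)) => h /=; last by split=> // -[].
have km := mulk1 m k0.
have mu : m <= size u by apply: leq_trans h; rewrite leq_pmull.
have st : size (take m u) = m by rewrite size_takel.
have P j : j < k * m -> nth x0 (wpow (take m u) k) j = nth x0 u (j %% m).
  by move=> hj; rewrite nth_wpow ?st // nth_take // ltn_mod.
split=> [/eqP e|[_ e]].
  split=> // x hx.
  have E j : j < k * m -> nth x0 u j = nth x0 u (j %% m).
    by move=> hj; rewrite -P // -e nth_take.
  have [hx1 hx2] : x < k * m /\ x + m < k * m by lia.
  by rewrite (E _ hx1) (E _ hx2) modnDr.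
apply/eqP/(@eq_from_nth _ x0); first by rewrite size_wpow st size_takel.
move=> j; rewrite size_takel // => hj; rewrite P // nth_take //.
elim/ltn_ind: j hj => j IH hj; case: (ltnP j m) => jm; first by rewrite modn_small.
have := e (j - m); rewrite subnK // => <-; last by lia.
by rewrite IH; [rewrite -{2}(subnK jm) modnDr | lia | lia].
Qed.

Section Word.

Variables (A : finType) (w : seq A).

Definition letter i := nth 0 [seq val (enum_rank x) | x <- w] i.

Lemma letter_lt i : i < size w -> letter i < #|A|.
Proof.
rewrite /letter; case: w => // x0 w' h; rewrite (nth_map x0) //.
exact: (ltn_ord (enum_rank _)).
Qed.

Lemma power_prefix_pw k i m : 0 < k -> 0 < m -> i < size w ->
  power_prefix k (drop i w) m <-> pw letter (size w) k i m.
Proof.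
move=> k0 m0 iw; have x0 : A by case: w iw => // x.
have E x : x < size w -> letter x = val (enum_rank (nth x0 w x)).
  by move=> h; rewrite /letter (nth_map x0).
(* Past the end [letter] defaults to 0, which is also the code of a letter; injectivity is therefore
   restricted to the word. *)
have inj x y : x < size w -> y < size w -> letter x = letter y <-> nth x0 w x = nth x0 w y.
  by move=> hx hy; rewrite !E //; split=> [/val_inj/enum_rank_inj|->].
rewrite (power_prefixP x0) // size_drop /pw (mulk1 m k0).
move: iw inj; move: (size w) => n iw inj.
split=> -[h1 h2]; (split; first by lia) => x hx.
  have := h2 (x - i); rewrite !nth_drop !addnA subnKC; last by lia.
  by move=> e; apply/inj; [lia | lia | apply: e; lia].
rewrite !nth_drop addnA; apply/inj; [lia | lia | apply: h2; lia].
Qed.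

Lemma min_period_mp k s i v : 0 < k -> i < size w ->
  min_period letter (size w) k s i v -> v = code (mp k s (drop i w)).
Proof.
move=> k0 iw; rewrite /min_period; have := mpP s (drop i w) k0.
case: (mp k s (drop i w)) => [m|] /=; last first.
  by move=> none; case: eqP => // _ [sv pv _]; case/negP: (none v sv); apply/power_prefix_pw => //; lia.
move=> [sm pm min]; have pm' : pw letter (size w) k i m by apply/power_prefix_pw => //; lia.
case: eqP => [-> /(_ m sm)//|_ [sv pv mv]].
apply/eqP; rewrite eqn_leq mv // min //; apply/power_prefix_pw => //; lia.
Qed.

End Word.

(** * The complete program and its bounds *)

Definition min_period_prog sigma :=
  vsig ::= #sigma ;; dawg_build ;; parse_loop ;; table_init ;; cross_all ;; copy_pass.

Section MainProgram.
Variables (B M : nat).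
Hypotheses (M_gt : 64 <= M) (powM : M ^ 16 <= B).
Let M1 : 1 < M. Proof. exact: leq_trans M_gt. Qed.

Lemma min_period_prog_spec T (A : finType) k s (w : seq A) :
  let n := size w in
  1 < k -> s < M -> #|A| <= M -> 4 * n + 8 <= M ->
  (40 * #|A| + 1000) * (n + 1) + 10 * (1100 * n) + 2000 <= T ->
  wp B M T (input k s w) (min_period_prog #|A|) (fun T' st' =>
    output n st' = map code (rmp k s w)).
Proof.
move=> n k1 sM AM nM hT; rewrite /min_period_prog.
set st0 := input k s w; set W := @letter A w; set sg := #|A| in AM hT *.
have Ws i : i < n -> W i < sg by apply: letter_lt.
have k0 : 0 < k by apply: ltnW.
move: hT; set K := (40 * sg + 1000) * (n + 1) => hT.
apply: wp_seq; wgo @wp_assign; [ | by rewrite /=; lia | by [] | rewrite /=].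
  by rewrite /fits /=.
set st1 := set_var _ _ _.
apply: wp_seq; apply: (wp_conseq (dawg_build_spec (W := W) (n := n) (s := sg) M_gt powM _ _ _ _ _ _ _)) => //.
- by move=> [|a] i.
- by lia.
- by rewrite -/K; lia.
move=> T2 st2 b2 fr2 [lp2 t2]; rewrite -/K in t2.
have lt2 x : 0 < x <= n -> arr st2 aG x < x.
  move=> hx; have [e1 e2 _] := lp2 x hx.
  by apply: leq_ltn_trans e2 _; rewrite lcsC; apply: leq_ltn_trans (lcs_le _ _ _) e1.
apply: wp_seq; apply: (wp_conseq (parse_loop_spec (n := n) M_gt powM _ lt2 _ _)).
- by rewrite fr2.1.
- by move=> i; rewrite fr2.2.
- by lia.
move=> T3 st3 b3 fr3 [ps t3].
have z3 a i : 8 < a -> arr st3 a i = 0.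
  (* Arrays numbered above 8 belong to the later phases and are still zero. *)
  move=> a8; have no c : all (fun x => x <= 8) (written_arrs c) -> a \notin written_arrs c.
    by move=> /allP h; apply/negP => /h; lia.
  by rewrite fr3.2 ?fr2.2 ?no //=; case: (a) a8.
apply: wp_seq; apply: (wp_conseq (table_init_spec (n := n) M_gt powM _ z3 _ _)).
- by rewrite fr3.1 // fr2.1.
- by lia.
- by lia.
move=> T4 st4 b4 fr4 [bb [A4 c4 p4 t4]].
have pot4 : paint_pot bb n st4 <= 20 * (3 * n + 2) + 400 * n.
  rewrite /paint_pot leq_add // leq_mul2l /=; first exact: p4.
  rewrite /alive_count -[X in _ <= X]subn0 -[X in _ <= X]muln1 -sum_nat_const_nat.
  by apply: leq_sum => i _; apply: leq_b1.
have EG x : arr st4 aG x = arr st2 aG x by rewrite fr4.2 // fr3.2.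
have ES x : arr st4 aSrc x = arr st2 aSrc x by rewrite fr4.2 // fr3.2.
have EN x : arr st4 aNB x = arr st3 aNB x by rewrite fr4.2.
have ps4 : is_parse n (arr st4 aG) (arr st4 aNB).
  have [h1 h2 h3 h4 h5] := ps; split.
  - by move=> a; rewrite EN; apply: h1.
  - by move=> a; rewrite EN EG; apply: h2.
  - by move=> a; rewrite !EN; apply: h3.
  - by move=> a y; rewrite !EN; apply: h4.
  - by rewrite EN.
have lp4 x : 0 < x <= n -> longest_prev W x (arr st4 aG x) (arr st4 aSrc x).
  by move=> hx; rewrite EG ES; apply: lp2.
have V4 x : x \in [:: vn; vk; vs; vsig] -> var st4 x = var st1 x.
  by rewrite !inE => /or4P[] /eqP ->; rewrite fr4.1 // fr3.1 // fr2.1.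
apply: wp_seq; apply: (wp_conseq (cross_all_spec (W := W) (n := n) (k := k) (s := s) (bb := bb) (sig := sg) M_gt powM _ Ws _ k1 _ _ sM _ _ ps4 lp4 A4 c4 _)).
- by move=> i; rewrite fr4.2 // fr3.2 // fr2.2.
- by rewrite V4.
- by rewrite V4.
- by rewrite V4.
- by lia.
- by rewrite V4.
- by lia.
move=> T5 st5 b5 fr5 [snd5 cpl5 t5].
have EG5 x : arr st5 aG x = arr st4 aG x by rewrite fr5.2.
have ES5 x : arr st5 aSrc x = arr st4 aSrc x by rewrite fr5.2.
have EN5 x : arr st5 aNB x = arr st4 aNB x by rewrite fr5.2.
apply: (wp_conseq (copy_pass_spec (W := W) (n := n) (k := k) (s := s) M_gt powM k1 _ _ _ _ _ snd5 _ _)).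
- by rewrite fr5.1 // V4.
- by lia.
- by rewrite fr5.1 // V4.
- have [h1 h2 h3 h4 h5] := ps4; split.
  + by move=> a; rewrite EN5; apply: h1.
  + by move=> a; rewrite EN5 EG5; apply: h2.
  + by move=> a; rewrite !EN5; apply: h3.
  + by move=> a y; rewrite !EN5; apply: h4.
  + by rewrite EN5.
- by move=> x hx; rewrite EG5 ES5; apply: lp4.
- by move=> i m c; rewrite EN5; apply: cpl5.
- by lia.
move=> T6 st6 b6 _ mp6.
apply: (@eq_from_nth _ 0); first by rewrite size_map !size_mkseq.
move=> i; rewrite size_mkseq => hi.
rewrite (nth_map None) ?size_mkseq // !nth_mkseq //.
exact: min_period_mp k0 hi (mp6 i hi).
Qed.

End MainProgram.

Theorem theorem2 (A : finType) :
  exists (P : cmd) (C c : nat),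
  forall (k s : nat) (w : seq A), 2 <= k ->
  exists (t : nat) (st : state),
    [/\ exec (max_word c (size w) k s) P (input k s w) t st,
        t <= C * (k * size w + 1)
      & output (size w) st = map code (rmp k s w)].
Proof.
(* With [N >= 2] one has [M = N * (#|A| + 64) <= N ^ (#|A| + 65)], and words must hold [M ^ 16]. In
   the time bound 14 * 1000 dominates both 1000 + 10 * 1100 and 1000 + 2000. *)
exists (min_period_prog #|A|), (40 * #|A| + 14 * 1000), (16 * (#|A| + 65)).
move=> k s w k2; set n := size w; set N := n + k + s + 2.
have N2 : 1 < N by rewrite /N; lia.
pose M := N * (#|A| + 64).
have MN : 64 * N <= M by rewrite /M mulnC leq_mul2l leq_addl orbT.
have M_gt : 64 <= M by apply: leq_trans MN; rewrite leq_pmulr // ltnW.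
have AM : #|A| <= M.
  by apply: leq_trans (leq_addr 64 _) _; rewrite leq_pmull // ltnW.
have powM : M ^ 16 <= max_word (16 * (#|A| + 65)) n k s.
  rewrite /max_word -/N mulnC expnM leq_exp2r // /M [#|A| + 65]addnS expnS leq_mul2l.
  by apply/orP; right; apply: ltnW; apply: ltn_expl.
have bd : bounded M (input k s w).
  have nM : n + k + s <= M by apply: leq_trans MN; rewrite /N; lia.
  split=> [[|[|[|x]]]|a i] /=; rewrite -/n; try lia; first by rewrite nth_nil.
  case: eqP => // _; case: (ltnP i n) => h; last by rewrite nth_default // size_map.
  by apply: leq_trans AM; apply: ltnW; apply: letter_lt.
pose T := (40 * #|A| + 1000) * (n + 1) + 10 * (1100 * n) + 2000.
have sM : s < M by apply: leq_trans MN; rewrite /N; lia.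
have nM : 4 * n + 8 <= M by apply: leq_trans MN; rewrite /N; lia.
have [t [st [ex tT _ out]]] := min_period_prog_spec M_gt powM k2 sM AM nM (leqnn T) bd.
exists t, st; split=> //; apply: leq_trans tT _.
have kn : n <= k * n by rewrite leq_pmull // ltnW.
apply: (@leq_trans ((40 * #|A| + 14 * 1000) * (n + 1))); last by rewrite leq_mul2l leq_add2r kn orbT.
by rewrite /T !mulnDl; lia.
Qed.
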